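(* Let $P\in\mathbb C[z]$ be a non-constant polynomial and let $\phi(z)=P(z)e^z$. Then $\phi(D)$, acting on $H(\mathbb C)$ endowed with the pointwise product, supports a hypercyclic algebra.
   Context: $H(\mathbb C)$ is the Fréchet algebra of entire functions with the topology of uniform convergence on compact sets and pointwise multiplication. $D:f\mapsto f'$; for an entire function $\phi(z)=\sum_{n\ge0}a_nz^n$ of exponential type, $\phi(D)f=\sum_{n\ge0}a_nf^{(n)}$, a continuous linear operator on $H(\mathbb C)$. $HC(T)$ is the set of $x\in X$ whose orbit $\{x,Tx,T^2x,\dots\}$ is dense in $X$. A hypercyclic algebra for $T$ is a subalgebra of $X$, different from $\{0\}$ and not required to be unital, contained in $HC(T)\cup\{0\}$. *)

(* Defs.v *)
From HB Require Import structures.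
From mathcomp Require Import all_boot all_order all_algebra complex.
From mathcomp Require Import all_classical all_reals all_analysis.
Import Order.TTheory GRing.Theory Num.Theory numFieldNormedType.Exports.
Set Implicit Arguments.
Unset Strict Implicit.
Unset Printing Implicit Defensive.
Local Open Scope ring_scope.
Local Open Scope classical_set_scope.

(* The intended instance is [C = R[i]] with [R : realType]. Abstracting [C] gives
   access to the topology and norm that the library attaches to every
   [numFieldType]; with them, [derivable f z 1] and [derive1n] refer to complex
   differentiation. *)
Section EntireFunctions.
Variable C : numClosedFieldType.

Definition entire : set (C -> C) :=
  [set f : C -> C | forall z : C, derivable f z 1].

Definition cexp (z : C) : C := limn (series (fun n => z ^+ n / n`!%:R)).

Definition taylor_coef (phi : C -> C) (n : nat) : C :=
  derive1n n phi 0 / n`!%:R.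

(* [phi(D) f = \sum_n a_n f^(n)], where [phi z = \sum_n a_n z^n]. For [f] entire
   and [phi] entire of exponential type the series converges uniformly on compact
   sets, so its sum can be taken pointwise. *)
Definition phiD (phi f : C -> C) : C -> C :=
  fun z => limn (series (fun n => taylor_coef phi n * derive1n n f z)).

(* [{family compact, C -> C}] is the topology of uniform convergence on compact
   sets. The orbit has to be dense in the entire functions, not among all
   functions [C -> C], hence the inclusion in the closure. *)
Definition HC (T : (C -> C) -> (C -> C)) : set (C -> C) :=
  [set f : C -> C | entire f /\
    entire `<=`
      closure (range (fun n => iter n T f) : set {family compact, C -> C})].

(* Subalgebras of the entire functions for the pointwise operations, not
   necessarily containing the constant function 1. *)
Record subalgebra (A : set (C -> C)) : Prop := Subalgebra {
  subalgebra_entire : A `<=` entire;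
  subalgebra0 : A 0;
  subalgebraD : forall f g : C -> C, A f -> A g -> A (f + g);
  subalgebraZ : forall (a : C) (f : C -> C), A f -> A (a *: f);
  subalgebraM : forall f g : C -> C, A f -> A g -> A (f * g) }.

Definition hypercyclic_algebra (T : (C -> C) -> (C -> C)) (A : set (C -> C)) :=
  [/\ subalgebra A, A <> [set 0] & A `<=` HC T `|` [set 0]].

End EntireFunctions.

(* Main.v *)
(* Write T = phi(D), so that T exp(l z) = phi(l) exp(l z), and T f(z) = (P(D) f)(z + 1).
   A Baire-type construction reduces the theorem to the following: given entire
   f, v and exponents m0 <= M, find u close to f and n with T^n (u^m0) close to v
   and T^n (u^m) close to 0 for m0 < m <= M; every nonzero polynomial without
   constant term in a generic w is then hypercyclic, m0 being its lowest degree.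

   Approximate v by sums of b_l exp(lambda_l z) with lambda_l in the segment
   iy + [0, 1], y large, and f by exponentials whose frequencies lie on the
   negative axis, far to the left, where |phi| is tiny. On the segment |phi| > 1,
   ln |phi| is strictly convex, and |phi(k lambda / m0)| < |phi(lambda)|^(k / m0)
   for m0 < k <= M because ln |P| grows only logarithmically. These three facts
   kill all terms of T^n (u^m) except the one reproducing v.

   Everything rests on the density of polynomials among the complex
   differentiable functions. Discrete Goursat: trapezoidal sums of a difference
   quotient over finer and finer grids of an annulus tend to 0, hence the
   polynomials interpolating f at the 2^n-th roots of unity converge to f. *)
Require Import Defs.
From mathcomp Require Import all_boot all_order all_algebra complex.
From mathcomp Require Import all_classical all_reals all_analysis.
From mathcomp Require Import ring lra zify.
Import Order.TTheory GRing.Theory Num.Theory numFieldNormedType.Exports.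
Import ComplexField.Normc.
Set Implicit Arguments.
Unset Strict Implicit.
Unset Printing Implicit Defensive.
Local Open Scope ring_scope.
Local Open Scope classical_set_scope.

(** * Complex differentiation and limits by epsilon-delta *)

Section EpsilonDelta.
Variable C : numFieldType.
Implicit Types (f g : C -> C) (z d e r : C) (u : nat -> C).

(** The exponential factor of |phi| is the exponential of the linear form Re, so it cancels when phi
    at a sum of frequencies is compared with a product of values of phi, and ln |P| decides alone.
    Off the zeros of P, ln |P| is harmonic: it can be convex in a direction only if it is concave in
    the orthogonal one. High above the zeros the convex direction is the horizontal one, since the
    second derivative of ln |x + ih| in x is (h^2 - x^2) / (x^2 + h^2)^2; hence the horizontal
    segment of frequencies. The obstacle is that u^m contains all products of the exponentials of u,
    and strictness of the convexity is what separates mixed products from pure ones. For k < m0 the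
    comparison of |phi(k lambda / m0)| with |phi(lambda)|^(k / m0) is reversed, so lower powers of u
    would blow up: m0 has to be the lowest degree.

    [entire] only asks for a derivative at each point. Once entire functions are locally uniform
    limits of polynomials, Cauchy estimates and Taylor expansions pass to them from polynomials,
    where they follow from finite sums. *)

Lemma is_derive1_eps f z d :
  (forall e, 0 < e -> exists2 r, 0 < r &
    forall h, `|h| <= r -> `|f (h + z) - f z - h * d| <= e * `|h|) ->
  is_derive z 1 f d.
Proof.
move=> fd.
have H : (fun h => h^-1 *: ((f \o shift z) (h *: 1) - f z)) @ 0^' --> d.
  apply/cvgrPdist_le => e e0; have [r r0 fr] := fd e e0.
  near=> h.
  have h0 : h != 0 by near: h; exact: nbhs_dnbhs_neq.
  have hr : `|h| <= r by near: h; apply: dnbhs0_le.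
  have := fr h hr; rewrite /shift /= /GRing.scale /= mulr1 => le.
  have -> : d - h^-1 * (f (h + z) - f z) = - (h^-1 * (f (h + z) - f z - h * d)).
    by rewrite [X in _ = - X]mulrBr mulKf // opprB.
  by rewrite normrN normrM normfV ler_pdivrMl ?normr_gt0 // [_ * e]mulrC.
by apply: DeriveDef; [apply/cvg_ex; exists d | exact: cvg_lim H].
Unshelve. all: by end_near. Qed.

Lemma derivable_eps f z : derivable f z 1 ->
  exists d, forall e, 0 < e -> exists2 r, 0 < r &
    forall h, `|h| <= r -> `|f (h + z) - f z - h * d| <= e * `|h|.
Proof.
move=> /cvg_ex[d /cvgrPdist_le H]; exists d => e e0.
have /= := H _ e0; rewrite /dnbhs /within /= => /nbhs_norm0P[r /= r0 Hr].
exists (r / 2); first by rewrite divr_gt0.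
move=> h hr; have [->|h0] := eqVneq h 0.
  by rewrite add0r subrr mul0r subr0 normr0 mulr0.
have hr' : `|h| < r by apply: le_lt_trans hr _; rewrite ltr_pdivrMr // ltr_pMr // ltr1n.
have := Hr h hr' h0; rewrite /shift /= /GRing.scale /= mulr1 => le.
have -> : f (h + z) - f z - h * d = - (h * (d - h^-1 * (f (h + z) - f z))).
  by rewrite mulrBr mulVKf // opprB.
by rewrite normrN normrM mulrC ler_wpM2r.
Qed.

Lemma limn_eps u d :
  (forall e, 0 < e -> exists N, forall n, (N <= n)%N -> `|u n - d| <= e) ->
  limn u = d.
Proof.
move=> H; apply: (@cvg_lim C) => //.
apply/cvgrPdist_le => e /H[N HN]; near=> n.
rewrite distrC HN //; near: n; exact: nbhs_infty_ge.
Unshelve. all: by end_near. Qed.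

Lemma compact_normle (K : set C) : compact K ->
  exists2 r, 0 < r & forall z, K z -> `|z| <= r.
Proof.
rewrite compact_cover => Kco.
have [| |D _ KD] := Kco C setT (fun i => [set p | `|p| < i]).
- move=> i _; rewrite openE => p /=; rewrite -subr_gt0 => ltpi.
  apply/nbhs_ballP; exists (i - `|p|) => // q.
  rewrite -ball_normE /= ltrBrDr distrC; apply: le_lt_trans.
  by rewrite -{1}(subrK p q) ler_normD.
- by move=> p _; exists (`|p| + 1) => //=; rewrite ltrDl ltr01.
(* The order of [C] is partial, so the sum of the radii of the finite subcover replaces their
   maximum. *)
exists (1 + \sum_(i <- finmap.enum_fset D) `|i|).
  by rewrite ltr_pwDl // sumr_ge0.
move=> p /KD[i Di /= lt_pi].
have iD : i \in finmap.enum_fset D by [].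
rewrite (big_rem i) //= addrCA; apply: ler_wpDr; first by rewrite addr_ge0 ?sumr_ge0.
by apply: ltW; apply: (lt_le_trans lt_pi); apply: real_ler_norm; rewrite gtr0_real // (le_lt_trans _ lt_pi).
Qed.

(** A single parameter [r] rules both the disc and the tolerance, so the sets [B r] decrease in [r]
    and generate a filter. It converges to [g] because every compact set lies in a disc. *)
Lemma closure_family_compact (A : set (C -> C)) g :
  (forall r, 0 < r ->
    exists2 f, A f & forall z, `|z| <= r -> `|f z - g z| <= r^-1) ->
  closure (A : set {family compact, C -> C}) g.
Proof.
move=> H; rewrite closureEcvg /=.
pose B r := [set f | A f /\ forall z, `|z| <= r -> `|f z - g z| <= r^-1].
pose G : set_system (C -> C) := filter_from [set r : C | 0 < r] B.
have FG : ProperFilter G.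
  apply: filter_from_proper; last by move=> r /H[f Af fg]; exists f.
  apply: filter_from_filter; first by exists 1; rewrite /= ltr01.
  move=> r s /= r0 s0; exists (r + s); first exact: addr_gt0.
  move=> f [Af fg]; split; split => // z zr.
  - apply: (le_trans (fg z _)); first by rewrite (le_trans zr) // lerDl ltW.
    by rewrite lef_pV2 ?posrE ?addr_gt0 // lerDl ltW.
  - apply: (le_trans (fg z _)); first by rewrite (le_trans zr) // lerDr ltW.
    by rewrite lef_pV2 ?posrE ?addr_gt0 // lerDr ltW.
exists G => //; split; last first.
  move=> X AX; exists 1; first exact: ltr01.
  by move=> f [Af _]; exact: AX.
rewrite -fam_cvgE; apply/fam_cvgP => K cK.
move=> P /uniform_nbhs[E [entE EP]].
have [r r0 Kr] := compact_normle cK.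
have [e /= e0 eE] := entE.
(* This radius exceeds that of the disc around [K], and its inverse is below [e]. *)
exists (r + e^-1); first by rewrite /= addr_gt0 // invr_gt0.
move=> f [Af fg]; apply: EP => z Kz; apply: eE => /=.
suff : ball (g z) e (f z) by [].
rewrite -ball_normE /= distrC.
apply: (le_lt_trans (fg z _)).
  by rewrite (le_trans (Kr _ Kz)) // lerDl invr_ge0 ltW.
rewrite -[ltRHS]invrK ltf_pV2 ?posrE ?addr_gt0 ?invr_gt0 //.
by rewrite ltrDr.
Qed.

End EpsilonDelta.

(** * Moduli of complex numbers as real numbers *)

Section Modulus.
Variable R : realType.
Implicit Types x y z : R[i].

Lemma norm_normc z : `|z| = (normc z)%:C%C.
Proof. by []. Qed.

Lemma normc_ge0 z : 0 <= normc z.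
Proof. by rewrite -lecR -norm_normc normr_ge0. Qed.

Lemma normcD x y : normc (x + y) <= normc x + normc y.
Proof. exact: le_normcD. Qed.

Lemma normcN x : normc (- x) = normc x.
Proof. exact: complex.normcN. Qed.

Lemma normcB x y : normc (x - y) <= normc x + normc y.
Proof. by rewrite -(normcN y) normcD. Qed.

Lemma normc_distC x y : normc (x - y) = normc (y - x).
Proof. by rewrite -normcN opprB. Qed.

Lemma normc_triangle y x z : normc (x - z) <= normc (x - y) + normc (y - z).
Proof. by rewrite (le_trans _ (normcD _ _)) // addrA subrK. Qed.

Lemma normc_real (a : R) : normc a%:C%C = `|a|.
Proof. by rewrite /= expr0n addr0 sqrtr_sqr. Qed.

Lemma normc_nat n : normc (n%:R : R[i]) = n%:R.
Proof. by rewrite -(rmorph_nat (real_complex R)) normc_real ger0_norm. Qed.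

Lemma normcX x n : normc (x ^+ n) = normc x ^+ n.
Proof.
by elim: n => [|n IH]; rewrite ?expr0 ?normc1 // !exprS normcM IH.
Qed.

Lemma normc_sum (I : Type) (s : seq I) (P : pred I) (F : I -> R[i]) :
  normc (\sum_(i <- s | P i) F i) <= \sum_(i <- s | P i) normc (F i).
Proof.
elim/big_rec2: _ => [|i a b _ IH]; first by rewrite normc0.
by rewrite (le_trans (normcD _ _)) // lerD2l.
Qed.

Lemma normc_prod (I : Type) (s : seq I) (P : pred I) (F : I -> R[i]) :
  normc (\prod_(i <- s | P i) F i) = \prod_(i <- s | P i) normc (F i).
Proof.
by elim/big_rec2: _ => [|i a b _ IH]; rewrite ?normc1 // normcM IH.
Qed.

Lemma normc_gt0 x : (0 < normc x) = (x != 0).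
Proof. by rewrite -ltcR -norm_normc normr_gt0. Qed.

Lemma normc_eq0 x : (normc x == 0) = (x == 0).
Proof. by apply/eqP/eqP => [/eq0_normc|->]; rewrite ?normc0. Qed.

Lemma ler_Re_normc x : `|complex.Re x| <= normc x.
Proof. by rewrite -lecR; exact: normc_ge_Re. Qed.

Lemma ler_Im_normc x : `|complex.Im x| <= normc x.
Proof.
by case: x => a b; rewrite /= -[leLHS]sqrtr_sqr ler_wsqrtr // lerDr sqr_ge0.
Qed.

Lemma normc_le_ReIm x : normc x <= `|complex.Re x| + `|complex.Im x|.
Proof.
rewrite {1}(complexE x) (le_trans (normcD _ _)) // normc_real normcM.
by rewrite [normc 'i%C]/= expr0n expr1n add0r sqrtr1 mul1r normc_real.
Qed.

Lemma normc_sqr x : normc x ^+ 2 = complex.Re x ^+ 2 + complex.Im x ^+ 2.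
Proof. by case: x => a b /=; rewrite sqr_sqrtr // addr_ge0 ?sqr_ge0. Qed.

Lemma ler_normcB_dist x y : normc x - normc y <= normc (x - y).
Proof. by rewrite lerBlDr -{1}(subrK y x) normcD. Qed.

Lemma complex_gt0P z : 0 < z -> exists2 a : R, 0 < a & z = a%:C%C.
Proof.
case: z => a b; rewrite ltcE /= => /andP[/eqP -> a0]; by exists a.
Qed.

End Modulus.

(** * Complex derivatives with real error bounds *)

Section ComplexDerivative.
Variable R : realType.
Notation C := (R[i] : numClosedFieldType).
Implicit Types (f g : C -> C) (z d : C) (e r : R).

(** Tolerances and radii are taken in [R], so that all estimates live in a totally ordered field
    rather than in [R[i]]. *)
Definition cdiff f z d := forall e, 0 < e -> exists2 r, 0 < r &
  forall h : C, normc h <= r -> normc (f (z + h) - f z - h * d) <= e * normc h.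

Lemma derivable_cdiff f z : derivable f z 1 -> exists d, cdiff f z d.
Proof.
move=> /derivable_eps[d H]; exists d => e e0.
have e0' : (0 : C) < e%:C%C by rewrite ltcR.
have [r' /complex_gt0P[r r0 ->] Hr] := H _ e0'; exists r => // h hr.
have := Hr h; rewrite !norm_normc -rmorphM /= !lecR [h + z]addrC => Hh.
exact: Hh hr.
Qed.

Lemma cdiff_is_derive1 f z d : cdiff f z d -> is_derive z (1 : C) f d.
Proof.
move=> H; apply: is_derive1_eps => e' /complex_gt0P[e e0 ->].
have [r r0 Hr] := H _ e0; exists r%:C%C; first by rewrite ltcR.
by move=> h; rewrite !norm_normc -rmorphM /= !lecR (addrC h); exact: Hr.
Qed.

Lemma cdiff_entire f g : (forall z, cdiff f z (g z)) -> entire f.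
Proof. by move=> H z; have [] := cdiff_is_derive1 (H z). Qed.

Lemma cdiff_derive1 f g : (forall z, cdiff f z (g z)) -> derive1 f = g.
Proof.
move=> H; apply/funext => z; rewrite derive1E.
by apply: derive_val; exact: cdiff_is_derive1.
Qed.

Lemma limn_normc (u : nat -> C) (l : C) :
  (forall e, 0 < e -> exists N, forall n, (N <= n)%N -> normc (u n - l) <= e) ->
  limn u = l.
Proof.
move=> H; apply: limn_eps => e' /complex_gt0P[e e0 ->].
by have [N HN] := H e e0; exists N => n /HN; rewrite norm_normc lecR.
Qed.

Lemma closure_compact_normc (A : set (C -> C)) g :
  (forall r, 0 < r ->
    exists2 f, A f & forall z, normc z <= r -> normc (f z - g z) <= r^-1) ->
  closure (A : set {family compact, C -> C}) g.
Proof.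
move=> H; apply: closure_family_compact => r' /complex_gt0P[r r0 ->].
have [f Af fg] := H r r0; exists f => // z.
by rewrite !norm_normc -fmorphV !lecR; exact: fg.
Qed.

End ComplexDerivative.

(** * Roots of unity and coefficient bounds *)

Section Circle.
Variable R : realType.
Implicit Types (s t : R).

Definition circle t : R[i] := Complex (cos (2 * pi * t)) (sin (2 * pi * t)).

Lemma circle0 : circle 0 = 1.
Proof. by rewrite /circle mulr0 cos0 sin0. Qed.

Lemma circleD s t : circle (s + t) = circle s * circle t.
Proof.
rewrite /circle mulrDr cosD sinD; apply/eqP; rewrite eq_complex /=.
by rewrite eqxx /= addrC.
Qed.

Lemma circle_half : circle 2^-1 = -1.
Proof.
rewrite /circle mulrAC divff // mul1r cospi sinpi.
by apply/eqP; rewrite eq_complex /= oppr0 !eqxx.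
Qed.

Lemma normc_circle t : normc (circle t) = 1.
Proof. by rewrite /= cos2Dsin2 sqrtr1. Qed.

Lemma circle_neq0 t : circle t != 0.
Proof. by rewrite -normc_gt0 normc_circle. Qed.

Lemma lipschitz_derive1 (f g : R -> R) : (forall x : R, is_derive x (1 : R) f (g x)) ->
  (forall x, `|g x| <= 1) -> forall x y, `|f x - f y| <= `|x - y|.
Proof.
move=> fg g1 x y; wlog xy : x y / x < y => [H|].
  have [xy|yx|->] := ltgtP x y; first exact: H.
    by rewrite distrC (distrC x) H.
  by rewrite !subrr.
have cf : {within `[x, y], continuous f}.
  by apply: derivable_within_continuous => z _; have [] := fg z.
have [c _] := @MVT R f g x y xy (fun z _ => fg z) cf.
rewrite distrC (distrC x) => ->.
by rewrite normrM ler_piMl.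
Qed.

Lemma normc_circleB s t : normc (circle s - circle t) <= 4 * pi * `|s - t|.
Proof.
rewrite (le_trans (normc_le_ReIm _)) //=.
have -> : 4 * pi * `|s - t| = `|2 * pi * s - 2 * pi * t| + `|2 * pi * s - 2 * pi * t|.
  rewrite -mulrBr normrM (ger0_norm (_ : 0 <= 2 * pi)) ?mulr_ge0 ?pi_ge0 //.
  by ring.
apply: lerD.
  apply: (@lipschitz_derive1 cos (fun x => - sin x)) => x.
  by rewrite normrN; apply/ler_normlP; rewrite lerNl sin_geN1 sin_le1.
apply: (@lipschitz_derive1 sin cos) => x.
by apply/ler_normlP; rewrite lerNl cos_geN1 cos_le1.
Qed.

Definition root2 n : R[i] := circle (2 ^+ n)^-1.

Lemma circle_natM k t : circle (k%:R * t) = circle t ^+ k.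
Proof.
elim: k => [|k IH]; first by rewrite mul0r circle0 expr0.
by rewrite -natr1 mulrDl mul1r circleD IH exprSr.
Qed.

Lemma circle1 : circle 1 = 1.
Proof.
have -> : (1 : R) = 2^-1 + 2^-1 by field.
by rewrite circleD circle_half mulrNN mulr1.
Qed.

Lemma root2_circle n k : root2 n ^+ k = circle (k%:R / 2 ^+ n).
Proof. by rewrite circle_natM. Qed.

Lemma root2_expr n : root2 n ^+ (2 ^ n) = 1.
Proof. by rewrite root2_circle natrX divff ?expf_neq0 // circle1. Qed.

Lemma root2_half n : root2 n.+1 ^+ (2 ^ n) = -1.
Proof.
by rewrite root2_circle natrX exprS invfM mulrCA divff ?expf_neq0 // mulr1 circle_half.
Qed.

(** The order is exactly [2 ^ n]: if m is an odd number times 2^k with k < n, raising [root2 n ^+ m]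
    to a suitable power of two gives an odd power of -1. *)
Lemma root2_expr_eq1 n m : (root2 n ^+ m == 1) = (2 ^ n %| m)%N.
Proof.
apply/idP/idP => [wm|/dvdnP[k ->]]; last by rewrite mulnC exprM root2_expr expr1n.
have [->|m0] := posnP m; first exact: dvdn0.
have [b co mE] := pfactor_coprime (isT : prime 2) m0.
rewrite mE dvdn_mull // dvdn_exp2l // leqNgt; apply/negP => lt.
case: n wm lt => [//|n] wm; rewrite ltnS => le.
have : (root2 n.+1 ^+ m) ^+ (2 ^ (n - logn 2 m)) = -1.
  rewrite -exprM {1}mE -mulnA -expnD subnKC // mulnC exprM root2_half.
  by rewrite -signr_odd -coprime2n co expr1.
rewrite (eqP wm) expr1n => /eqP; rewrite -subr_eq0 opprK.
by rewrite (_ : 1 + 1 = 2%:R :> R[i]) // pnatr_eq0.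
Qed.

Lemma sum_root2 n m :
  \sum_(k < 2 ^ n) (root2 n ^+ m) ^+ k = if (2 ^ n %| m)%N then (2 ^ n)%:R else 0.
Proof.
rewrite -root2_expr_eq1; case: eqP => [->|/eqP w1].
  by under eq_bigr do rewrite expr1n; rewrite sumr_const card_ord.
apply: (mulfI (x := root2 n ^+ m - 1)); first by rewrite subr_eq0.
by rewrite mulr0 -subrX1 exprAC root2_expr expr1n subrr.
Qed.

Lemma normc_root2X n k : normc (root2 n ^+ k) = 1.
Proof. by rewrite root2_circle normc_circle. Qed.

(** Discrete Fourier inversion. The exponent [2 ^ n - j] stands for [- j], as [root2 n] has order
    [2 ^ n]. *)
Lemma coef_root2 (p : {poly R[i]}) (r : R[i]) n j :
  (size p <= 2 ^ n)%N -> (j < 2 ^ n)%N ->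
  \sum_(k < 2 ^ n) p.[r * root2 n ^+ k] * root2 n ^+ (k * (2 ^ n - j)) =
  (2 ^ n)%:R * (p`_j * r ^+ j).
Proof.
move=> sp jn; under eq_bigr => k _.
  rewrite (horner_coef_wide _ sp) mulr_suml.
  over.
have E (i : 'I_(2 ^ n)) : \sum_(k < 2 ^ n)
    p`_i * (r * root2 n ^+ k) ^+ i * root2 n ^+ (k * (2 ^ n - j)) =
    if i == Ordinal jn then (2 ^ n)%:R * (p`_j * r ^+ j) else 0.
  transitivity (p`_i * r ^+ i *
      \sum_(k < 2 ^ n) (root2 n ^+ (i + (2 ^ n - j))) ^+ k).
    rewrite mulr_sumr; apply: eq_bigr => k _.
    rewrite exprMn -!exprM mulrA -mulrA -exprD; congr (_ * _ ^+ _).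
    by rewrite mulnDl (mulnC i) (mulnC (2 ^ n - j)%N).
  rewrite sum_root2; case: eqP => [->|/eqP /negPf ij] /=.
    by rewrite subnKC 1?ltnW // dvdnn mulrC.
  rewrite (_ : _ %| _ = false)%N ?mulr0 //.
  apply/negP => /dvdnP[q qE]; have := ltn_ord i; move/negP: ij; rewrite -val_eqE /=.
  case: q qE => [|[|q]]; lia.
rewrite exchange_big /=; under eq_bigr => i _ do rewrite E.
by rewrite -big_mkcond /= big_pred1_eq.
Qed.

(** Cauchy's estimate without an integral: as soon as [2 ^ n] exceeds the degree and [j], the
    coefficient is an exact average over [2 ^ n] points of the circle. *)
Lemma normc_coef_le (p : {poly R[i]}) (r M : R) j : 0 <= r ->
  (forall z, normc z = r -> normc p.[z] <= M) -> normc p`_j * r ^+ j <= M.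
Proof.
move=> r0 pM; have [n pn jn] : exists2 n, (size p <= 2 ^ n)%N & (j < 2 ^ n)%N.
  exists (size p + j)%N; rewrite expnD.
    by rewrite (leq_trans (ltnW (ltn_expl _ (ltnSn 1)))) // leq_pmulr // expn_gt0.
  by rewrite (leq_trans (ltn_expl _ (ltnSn 1))) // leq_pmull // expn_gt0.
have N0 : 0 < (2 ^ n)%:R :> R by rewrite ltr0n expn_gt0.
rewrite -(ler_pM2l N0) -{1}normc_nat -[r in leLHS]ger0_norm // -normc_real -normcX.
rewrite -!normcM -coef_root2 // (le_trans (normc_sum _ _ _)) //.
rewrite -[leRHS]mulrC mulr_natr -[in leRHS](card_ord (2 ^ n)) -sumr_const.
apply: ler_sum => k _; rewrite normcM normc_root2X mulr1 pM //.
by rewrite normcM normc_root2X mulr1 normc_real ger0_norm.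
Qed.

End Circle.

(** * Goursat's theorem by bisection *)

Section Grid.
Variable R : realType.
Notation C := (R[i] : numClosedFieldType).
Implicit Types (W : R -> R -> C) (g : C -> C).

(* Trapezoidal sums around a closed polygon vanish exactly on affine functions,
   so Goursat's bisection needs no integral. *)
Definition trapezoid g (u v : C) : C := (g u + g v) / 2 * (v - u).

Definition node W n i j : C := W (i%:R / 2 ^+ n) (j%:R / 2 ^+ n).

Definition edge1 W g n i j := trapezoid g (node W n i j) (node W n i.+1 j).

Definition edge2 W g n i j := trapezoid g (node W n i j) (node W n i j.+1).

Definition cell W g n i j :=
  edge1 W g n i j + edge2 W g n i.+1 j - edge1 W g n i j.+1 - edge2 W g n i j.

(** The square (i, j) of level [m], cut into 4^d cells: [m] counts the bisections already made and
    [d] the further refinement used for the sum. *)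
Definition block W g m d i j :=
  \sum_(k < 2 ^ d) \sum_(l < 2 ^ d) cell W g (m + d) (i * 2 ^ d + k) (j * 2 ^ d + l).

(** Each inner edge occurs in two cells with opposite signs; the sums telescope in both
    directions. *)
Lemma block_boundary W g m d i j :
  block W g m d i j =
  \sum_(k < 2 ^ d) (edge1 W g (m + d) (i * 2 ^ d + k) (j * 2 ^ d) -
                    edge1 W g (m + d) (i * 2 ^ d + k) (j.+1 * 2 ^ d)) +
  \sum_(l < 2 ^ d) (edge2 W g (m + d) (i.+1 * 2 ^ d) (j * 2 ^ d + l) -
                    edge2 W g (m + d) (i * 2 ^ d) (j * 2 ^ d + l)).
Proof.
rewrite /block.
transitivity (\sum_(k < 2 ^ d) \sum_(l < 2 ^ d)
   (- (edge1 W g (m + d) (i * 2 ^ d + k) (j * 2 ^ d + l.+1) -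
       edge1 W g (m + d) (i * 2 ^ d + k) (j * 2 ^ d + l)))
 + \sum_(l < 2 ^ d) \sum_(k < 2 ^ d)
   (edge2 W g (m + d) (i * 2 ^ d + k.+1) (j * 2 ^ d + l) -
       edge2 W g (m + d) (i * 2 ^ d + k) (j * 2 ^ d + l))).
  rewrite [X in _ = _ + X]exchange_big -big_split; apply: eq_bigr => k _ /=.
  rewrite -big_split; apply: eq_bigr => l _ /=.
  by rewrite /cell !addnS; ring.
have tel (f : nat -> C) : \sum_(k < 2 ^ d) (f k.+1 - f k) = f (2 ^ d)%N - f 0%N.
  by rewrite -(big_mkord xpredT (fun k => f k.+1 - f k)) telescope_sumr.
congr (_ + _); apply: eq_bigr => k _.
  rewrite sumrN (tel (fun l => edge1 W g (m + d) (i * 2 ^ d + k) (j * 2 ^ d + l))).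
  by rewrite opprB addn0 mulSn [(2 ^ d + _)%N]addnC.
rewrite (tel (fun l => edge2 W g (m + d) (i * 2 ^ d + l) (j * 2 ^ d + k))).
by rewrite addn0 mulSn [(2 ^ d + _)%N]addnC.
Qed.

Lemma block_quarters W g m d i j :
  block W g m d.+1 i j =
  block W g m.+1 d i.*2 j.*2 + block W g m.+1 d i.*2 j.*2.+1 +
  (block W g m.+1 d i.*2.+1 j.*2 + block W g m.+1 d i.*2.+1 j.*2.+1).
Proof.
have E (F : nat -> C) b : \sum_(k < 2 ^ d.+1) F (b * 2 ^ d.+1 + k)%N =
    \sum_(k < 2 ^ d) F (b.*2 * 2 ^ d + k)%N + \sum_(k < 2 ^ d) F (b.*2.+1 * 2 ^ d + k)%N.
  rewrite -(big_mkord xpredT (fun k => F (b * 2 ^ d.+1 + k)%N)).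
  rewrite expnS mul2n -addnn big_mkord big_split_ord /=.
  by congr (_ + _); apply: eq_bigr => k _; congr F; lia.
rewrite /block addnS addSn.
rewrite (E (fun x => \sum_(l < 2 ^ d.+1) cell W g (m + d).+1 x (j * 2 ^ d.+1 + l))).
congr (_ + _); rewrite -big_split; apply: eq_bigr => k _;
  exact: (E (fun y => cell W g (m + d).+1 _ y)).
Qed.

(** The trapezoidal rule is exact on affine functions: each edge contributes the increment of a
    quadratic primitive, and these cancel around the cell. *)
Lemma eq_cell_affine W g (w0 d : C) n i j :
  cell W g n i j = cell W (fun u => g u - g w0 - (u - w0) * d) n i j.
Proof.
rewrite /cell /edge1 /edge2 /trapezoid.
by field.
Qed.

Section Bisection.
Variables (W : R -> R -> C) (L : R) (g : C -> C).
Hypothesis WL : forall a a' b b',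
  normc (W a b - W a' b') <= L * (`|a - a'| + `|b - b'|).
Hypothesis gd : forall a b, 0 <= a <= 1 -> 0 <= b <= 1 ->
  exists d, cdiff g (W a b) d.

Lemma lipschitz_const_ge0 : 0 <= L.
Proof.
have := WL 1 0 0 0; rewrite subrr normr0 addr0 subr0 normr1 mulr1.
by apply: le_trans; exact: normc_ge0.
Qed.

(** Only the boundary counts: 4 * 2^d edges, each of length at most L / 2^(m+d), on which the affine
    remainder of [g] at [W a b] is at most e * 2L / 2^m. The product of the three does not depend on
    [d]. *)
Lemma block_small m d i j a b (e r : R) (D : C) :
  i%:R / 2 ^+ m <= a <= i.+1%:R / 2 ^+ m ->
  j%:R / 2 ^+ m <= b <= j.+1%:R / 2 ^+ m ->
  0 <= e ->
  (forall h, normc h <= r ->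
    normc (g (W a b + h) - g (W a b) - h * D) <= e * normc h) ->
  2 * L / 2 ^+ m <= r ->
  normc (block W g m d i j) <= 8 * L ^+ 2 * e / 4 ^+ m.
Proof.
move=> ia jb e0 gr Lr; have L0 := lipschitz_const_ge0.
set w0 := W a b in gr *.
pose rm u := g u - g w0 - (u - w0) * D.
have -> : block W g m d i j = block W rm m d i j.
  by apply: eq_bigr => k _; apply: eq_bigr => l _; exact: eq_cell_affine.
have m0 : (0 : R) < 2 ^+ m by rewrite exprn_gt0.
have d0 : (0 : R) < 2 ^+ d by rewrite exprn_gt0.
have frac q p : (p <= 2 ^ d)%N -> let x : R := (q * 2 ^ d + p)%:R / 2 ^+ (m + d) in
    (q%:R / 2 ^+ m : R) <= x /\ x <= q.+1%:R / 2 ^+ m.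
  move=> pd x; have pd' : p%:R <= 2 ^+ d :> R by rewrite -natrX ler_nat.
  have p0 : 0 <= p%:R :> R by [].
  have -> : x = q%:R / 2 ^+ m + p%:R / 2 ^+ d / 2 ^+ m.
    by rewrite /x exprD natrD natrM natrX; field; rewrite !gt_eqF.
  rewrite -[q.+1%:R]natr1 mulrDl lerD2l lerDl; split; first by rewrite !divr_ge0 // ltW.
  by rewrite ler_pM2r ?invr_gt0 // ler_pdivrMr // mul1r.
have near k l : (k <= 2 ^ d)%N -> (l <= 2 ^ d)%N ->
    normc (rm (node W (m + d) (i * 2 ^ d + k) (j * 2 ^ d + l))) <= e * (2 * L / 2 ^+ m).
  move=> kd ld; set u := node _ _ _ _.
  have uw : normc (u - w0) <= 2 * L / 2 ^+ m.
    rewrite (le_trans (WL _ _ _ _)) // mulrAC mulrC ler_wpM2r //.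
    have [k1 k2] := frac i k kd; have [l1 l2] := frac j l ld.
    have /andP[a1 a2] := ia; have /andP[b1 b2] := jb.
    have -> : 2 / 2 ^+ m = (2 ^+ m)^-1 + (2 ^+ m)^-1 :> R by rewrite mulr_natl mulr2n.
    have S q : q.+1%:R / 2 ^+ m = q%:R / 2 ^+ m + (2 ^+ m)^-1 :> R.
      by rewrite -[q.+1%:R]natr1 mulrDl mul1r.
    rewrite !S in a2 b2 k2 l2.
    apply: lerD; apply/ler_normlP; split; lra.
  have := gr (u - w0) (le_trans uw Lr); rewrite [w0 + _]addrC subrK => H.
  by rewrite (le_trans H) // ler_wpM2l.
have step : forall x : nat, `|x.+1%:R / 2 ^+ (m + d) - x%:R / 2 ^+ (m + d)| = (2 ^+ (m + d))^-1 :> R.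
  move=> x; by rewrite -mulrBl -[x.+1%:R]natr1 addrAC subrr add0r mul1r ger0_norm //.
pose B := e * (2 * L / 2 ^+ m) * (L / 2 ^+ (m + d)).
have trapB u v : normc (rm u) <= e * (2 * L / 2 ^+ m) -> normc (rm v) <= e * (2 * L / 2 ^+ m) ->
    normc (v - u) <= L / 2 ^+ (m + d) -> normc (trapezoid rm u v) <= B.
  move=> ru rv uv; rewrite /trapezoid normcM ler_pM ?normc_ge0 //.
  rewrite normcM normcV normc_nat ler_pdivrMr // (le_trans (normcD _ _)) //.
  by rewrite mulr_natr mulr2n lerD.
have B1 k l : (k < 2 ^ d)%N -> (l <= 2 ^ d)%N ->
    normc (edge1 W rm (m + d) (i * 2 ^ d + k) (j * 2 ^ d + l)) <= B.
  move=> kd ld; apply: trapB; rewrite -?addnS ?near // 1?ltnW //.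
  by rewrite (le_trans (WL _ _ _ _)) // addnS step subrr normr0 addr0.
have B2 k l : (k <= 2 ^ d)%N -> (l < 2 ^ d)%N ->
    normc (edge2 W rm (m + d) (i * 2 ^ d + k) (j * 2 ^ d + l)) <= B.
  move=> kd ld; apply: trapB; rewrite -?addnS ?near // 1?ltnW //.
  by rewrite (le_trans (WL _ _ _ _)) // addnS step subrr normr0 add0r.
rewrite block_boundary (le_trans (normcD _ _)) //.
have sumB (F : 'I_(2 ^ d) -> C) : (forall k, normc (F k) <= B + B) ->
    normc (\sum_k F k) <= 2 ^+ d * (B + B).
  move=> FB; rewrite (le_trans (normc_sum _ _ _)) //.
  rewrite -natrX mulr_natl -[in leRHS](card_ord (2 ^ d)) -sumr_const.
  by apply: ler_sum.
have -> : 8 * L ^+ 2 * e / 4 ^+ m = 2 ^+ d * (B + B) + 2 ^+ d * (B + B).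
  rewrite /B exprD (_ : 4 = 2 * 2) ?exprMn; last by ring.
  by field; rewrite !gt_eqF.
apply: lerD; apply: sumB => k; apply: (le_trans (normcB _ _)); apply: lerD.
- by rewrite -(addn0 (j * 2 ^ d)%N) B1.
- by rewrite mulSn [(2 ^ d + _)%N]addnC B1.
- by rewrite mulSn [(2 ^ d + _)%N]addnC B2.
- by rewrite -(addn0 (i * 2 ^ d)%N) B2.
Qed.


(** Since the value of a block depends on [d], smallness is required for all large [d]. In
    contrapositive form, a bad block has a bad quarter. *)
Lemma block_bisection (e : R) (m i j : nat) :
  (forall i' j', i'./2 = i -> j'./2 = j -> exists d0, forall d, (d0 <= d)%N ->
     normc (block W g m.+1 d i' j') <= e / 4 ^+ m.+1) ->
  exists d0, forall d, (d0 <= d)%N -> normc (block W g m d i j) <= e / 4 ^+ m.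
Proof.
move=> H.
have [d1 H1] := H i.*2 j.*2 (doubleK i) (doubleK j).
have [d2 H2] := H i.*2 j.*2.+1 (doubleK i) (uphalf_double j).
have [d3 H3] := H i.*2.+1 j.*2 (uphalf_double i) (doubleK j).
have [d4 H4] := H i.*2.+1 j.*2.+1 (uphalf_double i) (uphalf_double j).
exists (d1 + d2 + d3 + d4).+1 => -[//|d]; rewrite ltnS => le_d.
have -> : e / 4 ^+ m = e / 4 ^+ m.+1 + e / 4 ^+ m.+1 + (e / 4 ^+ m.+1 + e / 4 ^+ m.+1).
  by rewrite exprS; field; rewrite expf_neq0.
rewrite block_quarters.
by do 2 rewrite (le_trans (normcD _ _)) // ?lerD //; rewrite ?H1 ?H2 ?H3 ?H4 //; lia.
Qed.

(** The intervals are nested, and the supremum of the left end points lies in all of them. *)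
Lemma nested_dyadic (x : nat -> nat) : (x 0 = 0)%N ->
  (forall m, (x m.+1)./2 = x m) ->
  exists2 a : R, 0 <= a <= 1 &
    forall m, (x m)%:R / 2 ^+ m <= a <= (x m).+1%:R / 2 ^+ m.
Proof.
move=> x0 xS; pose u m : R := (x m)%:R / 2 ^+ m; pose v m : R := (x m).+1%:R / 2 ^+ m.
have pos m : (0 : R) < 2 ^+ m by rewrite exprn_gt0.
have uS m : u m <= u m.+1 /\ v m.+1 <= v m.
  rewrite /u /v exprS invfM !mulrA !ler_pM2r ?invr_gt0 //.
  rewrite ler_pdivlMr // ler_pdivrMr // -!natrM !ler_nat.
  by have := odd_double_half (x m.+1); rewrite xS; case: (odd _); lia.
have le_u m k : u m <= u (m + k)%N.
  by elim: k => [|k IH]; rewrite ?addn0 // addnS (le_trans IH) //; case: (uS (m + k)%N).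
have le_v m k : v (m + k)%N <= v m.
  elim: k => [|k IH]; rewrite ?addn0 // addnS (le_trans _ IH) //.
  by case: (uS (m + k)%N).
have uv m k : u m <= v k.
  rewrite (le_trans (le_u m k)) // (le_trans _ (le_v k m)) // addnC /u /v.
  by rewrite ler_pM2r ?invr_gt0 // ler_nat.
have hs : has_sup (range u).
  by split; [exists (u 0%N); exists 0%N | exists (v 0%N) => _ [m _ <-]; exact: uv].
pose a := sup (range u).
have ua m : u m <= a by apply: sup_upper_bound => //; exists m.
have av m : a <= v m.
  by apply: sup_le_ub => [|_ [k _ <-]]; [case: hs | exact: uv].
exists a => [|m]; last by rewrite ua av.
have := ua 0%N; have := av 0%N; rewrite /u /v x0 expr0 invr1 !mulr1.
by move=> -> ->.
Qed.

(** Otherwise bad blocks shrink to a parameter (a, b), and differentiability of [g] at [W a b] makes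
    the small ones good by [block_small], with no refinement threshold. *)
Lemma goursat_grid (e : R) : 0 < e ->
  exists d0, forall d, (d0 <= d)%N -> normc (block W g 0 d 0 0) <= e.
Proof.
move=> e0.
pose bad (s : nat * nat * nat) := ~ exists d0, forall d, (d0 <= d)%N ->
  normc (block W g s.1.1 d s.1.2 s.2) <= e / 4 ^+ s.1.1.
suff : ~ bad (0, 0, 0)%N by move=> /contrapT /=; rewrite expr0 invr1 mulr1.
move=> bad0.
pose next (s t : {s | bad s}) := [/\ (sval t).1.1 = (sval s).1.1.+1,
  (sval t).1.2./2 = (sval s).1.2 & (sval t).2./2 = (sval s).2].
have ex_next s : {t | next s t}.
  apply/cid; case: s => -[[m i] j] bs; apply: contrapT => nx; apply: (bs).
  apply: block_bisection => i' j' /= ii' jj'; apply: contrapT => bij.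
  by apply: nx; exists (exist bad (m.+1, i', j') bij).
have [s [s0 sS]] := dependent_choice ex_next (exist bad _ bad0).
have sm m : (sval (s m)).1.1 = m.
  by elim: m => [|m IH]; [rewrite s0 | case: (sS m) => ->; rewrite IH].
have [a a01 ia] := @nested_dyadic (fun m => (sval (s m)).1.2)
  (congr1 (fun t => (sval t).1.2) s0) (fun m => let: And3 _ E _ := sS m in E).
have [b b01 jb] := @nested_dyadic (fun m => (sval (s m)).2)
  (congr1 (fun t => (sval t).2) s0) (fun m => let: And3 _ _ E := sS m in E).
have [D gD] := gd a01 b01.
have L0 := lipschitz_const_ge0.
(* Chosen so that 8 L^2 eta is at most [e]; the added 1 covers L = 0. *)
pose eta := e / (8 * (L ^+ 2 + 1)).
have L2 : 0 < L ^+ 2 + 1 by rewrite ltr_wpDl ?sqr_ge0.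
have eta0 : 0 < eta by rewrite divr_gt0 // mulr_gt0.
have [r r0 Hr] := gD _ eta0.
have [m Hm] : exists m, 2 * L / 2 ^+ m <= r.
  exists (Num.truncn (2 * L / r)).+1; rewrite ler_pdivrMr ?exprn_gt0 // [r * _]mulrC -ler_pdivrMr //.
  rewrite (le_trans (ltW (truncnS_gt _))) //.
  by rewrite -natrX ler_nat ltnW // ltn_expl.
have := svalP (s m); apply; exists 0%N => d _; rewrite sm.
have := block_small d (ia m) (jb m) (ltW eta0) Hr Hm.
move=> /le_trans; apply; rewrite ler_pM2r ?invr_gt0 ?exprn_gt0 //.
rewrite /eta mulrA ler_pdivrMr ?mulr_gt0 // [_ * e]mulrC ler_pM2l //.
by rewrite ler_pM2l // lerDl.
Qed.

End Bisection.
End Grid.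

(** * Difference quotients and the annulus map *)

Section Cauchy.
Variable R : realType.
Notation C := (R[i] : numClosedFieldType).
Implicit Types (f : C -> C) (z : C) (e r : R).

Definition difference_quotient f z (u : C) : C := (f u - f z) / (u - z).

Lemma derivable_difference_quotient f z u : entire f -> u != z ->
  derivable (difference_quotient f z) u 1.
Proof.
move=> ef uz; apply: derivableM.
  by apply: derivableB; [exact: ef | exact: derivable_cst].
apply: derivableV; first by rewrite subr_eq0.
by apply: derivableB; [exact: derivable_id | exact: derivable_cst].
Qed.

(** The singularity at [z] enters only through this bound: multiplied by the length of a small curve
    around [z], it tends to 0. *)
Lemma difference_quotient_bounded f z : entire f ->
  exists r B, [/\ 0 < r, 0 < B & forall u : C, normc (u - z) <= r -> u != z ->
    normc (difference_quotient f z u) <= B].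
Proof.
move=> ef; have [d fd] := derivable_cdiff (ef z).
have [r r0 Hr] := fd 1 ltr01; exists r, (normc d + 1); split => //.
  by rewrite ltr_wpDl ?normc_ge0.
move=> u uz unz; have uz0 : 0 < normc (u - z) by rewrite normc_gt0 subr_eq0.
have := Hr _ uz; rewrite [z + _]addrC subrK mul1r => H.
rewrite /difference_quotient normcM normcV ler_pdivrMr //.
rewrite -[f u - f z](subrK ((u - z) * d)) (le_trans (normcD _ _)) //.
rewrite normcM; lra.
Qed.

(** Retraction of the line onto [0, 1]. It makes [annulus] Lipschitz and different from [z] for all
    real parameters. *)
Definition clamp (a : R) := Num.max 0 (Num.min 1 a).

Lemma clamp01 a : 0 <= clamp a <= 1.
Proof. by rewrite /clamp le_max lexx /= ge_max ler01 ge_min lexx. Qed.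

Lemma clampK a : 0 <= a <= 1 -> clamp a = a.
Proof. by case/andP=> a0 a1; rewrite /clamp min_r // max_r. Qed.

Lemma clamp_lipschitz a b : `|clamp a - clamp b| <= `|a - b|.
Proof.
rewrite /clamp; set x := Num.min 1 a; set y := Num.min 1 b.
apply: (@le_trans _ _ `|x - y|).
  have h := real_ler_norm (num_real (x - y)).
  have h' := real_ler_norm (num_real (- (x - y))); rewrite normrN in h'.
  have n0 := normr_ge0 (x - y).
  by apply/ler_normlP; case: (leP 0 x) => ?; case: (leP 0 y) => ?; split; lra.
have h := real_ler_norm (num_real (a - b)).
have h' := real_ler_norm (num_real (- (a - b))); rewrite normrN in h'.
have n0 := normr_ge0 (a - b).
by apply/ler_normlP; rewrite /x /y; case: (leP 1 a) => ?; case: (leP 1 b) => ?; split; lra.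
Qed.

(* The annulus between the circle of radius [r] about [0] and its image under
   the homothety of centre [z] and ratio [a0]. *)
Definition annulus (a0 r : R) z (a b : R) : C :=
  z + (a0 + (1 - a0) * clamp a)%:C%C * (r%:C%C * circle b - z).

Section Annulus.
Variables (a0 r : R) (z : C).
Hypotheses (a01 : 0 < a0 <= 1) (zr : normc z < r).

Let r0 : 0 < r. Proof. exact: le_lt_trans (normc_ge0 _) zr. Qed.

Lemma normc_circle_sub b : 0 < normc (r%:C%C * circle b - z) <= 2 * r.
Proof.
have E : normc (r%:C%C * circle b) = r.
  by rewrite normcM normc_circle normc_real mulr1 gtr0_norm.
have := ler_normcB_dist (r%:C%C * circle b) z.
have := normcB (r%:C%C * circle b) z; rewrite E => h1 h2.
by have h3 := zr; apply/andP; split; lra.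
Qed.

(** The angle is moved first, at speed at most 4 pi r, then the scale, along a segment of length at
    most 2r. *)
Lemma annulus_lipschitz a a' b b' :
  normc (annulus a0 r z a b - annulus a0 r z a' b') <=
    r * (4 * pi + 2) * (`|a - a'| + `|b - b'|).
Proof.
pose s a := a0 + (1 - a0) * clamp a.
have -> : annulus a0 r z a b - annulus a0 r z a' b' =
   (s a * r)%:C%C * (circle b - circle b') + (s a - s a')%:C%C * (r%:C%C * circle b' - z).
  by rewrite /annulus rmorphM rmorphB /= /s; ring.
have [c0 c1] := andP (clamp01 a); have [a0p a0l] := andP a01.
have s0 : 0 <= s a by rewrite /s addr_ge0 ?mulr_ge0 // ?subr_ge0 // ltW.
have s1 : s a <= 1 by rewrite /s; nra.
have ss : `|s a - s a'| <= `|a - a'|.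
  have -> : s a - s a' = (1 - a0) * (clamp a - clamp a') by rewrite /s; ring.
  rewrite normrM (le_trans _ (clamp_lipschitz a a')) // ler_piMl //.
  by rewrite ger0_norm; lra.
have pi0 := pi_ge0 R.
rewrite (le_trans (normcD _ _)) // !normcM !normc_real.
have yl := normc_circleB b b'; have /andP[_ x2] := normc_circle_sub b'.
rewrite (ger0_norm (mulr_ge0 s0 (ltW r0))).
set A := `|a - a'|; set B := `|b - b'|.
have A0 : 0 <= A := normr_ge0 _; have B0 : 0 <= B := normr_ge0 _.
have h1 : s a * r * normc (circle b - circle b') <= r * (4 * pi * B).
  by apply: ler_pM; rewrite ?normc_ge0 ?mulr_ge0 ?ler_piMl // ?(ltW r0).
have h2 : `|s a - s a'| * normc (r%:C%C * circle b' - z) <= A * (2 * r).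
  by apply: ler_pM; rewrite ?normc_ge0.
apply: (le_trans (lerD h1 h2)).
have := mulr_ge0 (ltW r0) A0; have := mulr_ge0 (ltW r0) B0.
have := mulr_ge0 (mulr_ge0 (ltW r0) A0) pi0.
rewrite (_ : r * (4 * pi + 2) * (A + B) =
  4 * (r * A * pi) + r * (4 * pi * B) + 2 * (r * A) + 2 * (r * B)); last by ring.
lra.
Qed.

Lemma annulus_neq a b : annulus a0 r z a b != z.
Proof.
rewrite -subr_eq0 addrAC subrr add0r mulf_neq0 //.
  rewrite -normc_gt0 normc_real normr_gt0 gt_eqF //.
  by have [] := andP (clamp01 a); have [] := andP a01; move: (clamp a) => t; nra.
by rewrite -normc_gt0; case/andP: (normc_circle_sub b).
Qed.

Lemma annulus1 b : annulus a0 r z 1 b = r%:C%C * circle b.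
Proof.
by rewrite /annulus clampK ?ler01 ?lexx // mulr1 subrKC rmorph1 mul1r subrKC.
Qed.

Lemma annulus0 b : annulus a0 r z 0 b = z + a0%:C%C * (r%:C%C * circle b - z).
Proof. by rewrite /annulus clampK ?ler01 ?lexx // mulr0 addr0. Qed.

End Annulus.
End Cauchy.

(** * Cauchy's theorem for means over roots of unity *)

Section CauchyMean.
Variable R : realType.
Notation C := (R[i] : numClosedFieldType).
Implicit Types (f : C -> C) (z : C) (e r : R).

Lemma sum_cyclic_shift (V : zmodType) (F : nat -> V) N :
  F N = F 0%N -> \sum_(l < N) F l.+1 = \sum_(l < N) F l.
Proof.
move=> FN; apply/eqP; rewrite -subr_eq0 -sumrB.
by rewrite -(big_mkord xpredT (fun l => F l.+1 - F l)) telescope_sumr // FN subrr.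
Qed.

Lemma root2_neq0 n : root2 R n != 0.
Proof. exact: circle_neq0. Qed.

(** With N = 2^(n-2), (w^2)^N - 1 = -2 factors as w^2 - 1 times a sum of N numbers of modulus 1, so
    |w^2 - 1| is at least 2 / N. *)
Lemma root2_gap n : (1 < n)%N -> 8 / 2 ^+ n <= normc (root2 R n - (root2 R n)^-1).
Proof.
case: n => [//|[//|n]] _; set w := root2 R _.
have w0 : w != 0 by exact: root2_neq0.
have wn k : normc (w ^+ k) = 1 by exact: normc_root2X.
have -> : normc (w - w^-1) = normc (w ^+ 2 - 1).
  have -> : w ^+ 2 - 1 = (w - w^-1) * w by rewrite mulrBl mulVf.
  by rewrite normcM [normc w]normc_circle mulr1.
have : normc ((w ^+ 2) ^+ (2 ^ n) - 1) = 2.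
  by rewrite -exprM -expnS root2_half -opprD normcN -[1 + 1]/(2%:R) normc_nat.
rewrite subrX1 normcM => E.
have S : normc (\sum_(i < 2 ^ n) (w ^+ 2) ^+ i) <= 2 ^+ n.
  rewrite (le_trans (normc_sum _ _ _)) //.
  rewrite (eq_bigr (fun _ => 1)) => [|i _]; last by rewrite -exprM wn.
  by rewrite sumr_const card_ord natrX.
rewrite [2 ^+ n.+2]exprS [2 ^+ n.+1]exprS ler_pdivrMr ?mulr_gt0 ?exprn_gt0 //.
have := ler_wpM2l (normc_ge0 (w ^+ 2 - 1)) S; rewrite E.
set x := normc _; set y := 2 ^+ n; lra.
Qed.

Lemma node_annulus1 (a0 r : R) z n l :
  node (annulus a0 r z) n (2 ^ n) l = r%:C%C * root2 R n ^+ l.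
Proof. by rewrite /node natrX divff ?expf_neq0 // annulus1 root2_circle. Qed.

(** Summation by parts: in the closed trapezoidal sum the node r w^l receives the weight r (w^(l+1)
    - w^(l-1)) / 2, a fixed multiple of the node itself. *)
Lemma outer_boundary_sum (a0 r : R) z (g : C -> C) n :
  \sum_(l < 2 ^ n) edge2 (annulus a0 r z) g n (2 ^ n) l =
  (root2 R n - (root2 R n)^-1) / 2 *
    \sum_(l < 2 ^ n) (r%:C%C * root2 R n ^+ l) * g (r%:C%C * root2 R n ^+ l).
Proof.
set w := root2 R n; have w0 : w != 0 by exact: root2_neq0.
pose G l := g (r%:C%C * w ^+ l); pose F l := r%:C%C / 2 * (1 - w^-1) * (G l * w ^+ l).
transitivity (\sum_(l < 2 ^ n) (r%:C%C / 2 * (w - 1) * (G l * w ^+ l) + F l.+1)).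
  apply: eq_bigr => l _; rewrite /edge2 /trapezoid !node_annulus1 -/w -/(G l) -/(G l.+1).
  by rewrite /F exprS; field.
rewrite big_split /= sum_cyclic_shift.
  rewrite -!mulr_sumr -mulrDl; under [in RHS]eq_bigr do rewrite -mulrA.
  rewrite -mulr_sumr; under [in RHS]eq_bigr do rewrite mulrC -/(G _).
  by field.
by rewrite /F /G root2_expr expr0.
Qed.

Lemma inner_boundary_sum (a0 r B : R) z (g : C -> C) n :
  0 < a0 <= 1 -> normc z < r ->
  (forall u, normc (u - z) <= 2 * r * a0 -> u != z -> normc (g u) <= B) ->
  normc (\sum_(l < 2 ^ n) edge2 (annulus a0 r z) g n 0 l) <= B * (a0 * r * (4 * pi)).
Proof.
move=> a01 zr gB; have r0 : 0 < r := le_lt_trans (normc_ge0 _) zr.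
have [a0p _] := andP a01.
have N0 : (0 : R) < 2 ^+ n by rewrite exprn_gt0.
have gnode l : normc (g (node (annulus a0 r z) n 0 l)) <= B.
  apply: gB; last exact: annulus_neq.
  rewrite /node mul0r annulus0 addrAC subrr add0r normcM normc_real gtr0_norm //.
  rewrite mulrC ler_pM2r //; have /andP[_] := normc_circle_sub zr (l%:R / 2 ^+ n); exact.
have step l : normc (node (annulus a0 r z) n 0 l.+1 - node (annulus a0 r z) n 0 l) <=
    a0 * r * (4 * pi) / 2 ^+ n.
  rewrite /node mul0r !annulus0.
  set b := circle _; set b' := circle _.
  have -> : z + a0%:C%C * (r%:C%C * b - z) - (z + a0%:C%C * (r%:C%C * b' - z)) =
    (a0 * r)%:C%C * (b - b') by rewrite rmorphM /=; ring.
  rewrite normcM normc_real ger0_norm; last by rewrite mulr_ge0 ?ltW.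
  apply: (le_trans (ler_wpM2l _ (normc_circleB _ _))); first by rewrite mulr_ge0 ?ltW.
  rewrite -mulrBl -[l.+1%:R]natr1 [l%:R + 1]addrC addrK mul1r ger0_norm ?invr_ge0 ?(ltW N0) //.
  by rewrite !mulrA.
rewrite (le_trans (normc_sum _ _ _)) //.
have -> : B * (a0 * r * (4 * pi)) = \sum_(l < 2 ^ n) (B * (a0 * r * (4 * pi) / 2 ^+ n)).
  by rewrite sumr_const card_ord -[RHS]mulr_natr natrX -!mulrA mulVf ?mulr1 // gt_eqF.
apply: ler_sum => l _; rewrite /edge2 /trapezoid normcM ler_pM ?normc_ge0 //.
rewrite normcM normcV normc_nat ler_pdivrMr // (le_trans (normcD _ _)) //.
by rewrite mulr_natr mulr2n lerD.
Qed.

(** Discrete form of the vanishing of the integral of (f u - f z) / (u - z) over the circle, du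
    being proportional to u times the increment of the angle. Goursat on the annulus moves the sum
    to a tiny circle around [z]. *)
Lemma cauchy_mean f z r : entire f -> normc z < r -> forall e, 0 < e ->
  exists n0, forall n, (n0 <= n)%N ->
  normc (\sum_(l < 2 ^ n) (r%:C%C * root2 R n ^+ l) *
           difference_quotient f z (r%:C%C * root2 R n ^+ l)) <= e * 2 ^+ n.
Proof.
move=> ef zr e e0; have r0 : 0 < r := le_lt_trans (normc_ge0 _) zr.
have pi0 : 0 < pi :> R := pi_gt0 R.
have [s [B [s0 B0 gB]]] := difference_quotient_bounded z ef.
pose K := B * (r * (4 * pi)).
have K0 : 0 < K by rewrite !mulr_gt0.
(* The second bound puts the inner circle where the difference quotient is at most [B], the third
   makes its contribution at most [e]. *)
pose a0 := Num.min 1 (Num.min (s / (2 * r)) (e / K)).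
have a01 : 0 < a0 <= 1.
  by rewrite /a0 !lt_min ltr01 !divr_gt0 ?mulr_gt0 // ge_min lexx.
have a0s : 2 * r * a0 <= s.
  by rewrite mulrC -ler_pdivlMr ?mulr_gt0 // /a0 !ge_min lexx orbT.
have a0e : a0 * K <= e by rewrite -ler_pdivlMr // /a0 !ge_min lexx !orbT.
have gd a b : 0 <= a <= 1 -> 0 <= b <= 1 ->
    exists d, cdiff (difference_quotient f z) (annulus a0 r z a b) d.
  move=> _ _; apply: derivable_cdiff; apply: derivable_difference_quotient => //.
  exact: annulus_neq.
have [n0 Hn] := goursat_grid (annulus_lipschitz a01 zr) gd e0.
exists (n0 + 2)%N => n le_n.
have := Hn n (leq_trans (leq_addr _ _) le_n).
(* The radial sides b = 0 and b = 1 are the same curve and cancel. *)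
rewrite block_boundary big1 ?add0r; last first.
  move=> k _; rewrite mul0n mul1n /edge1.
  have per i : node (annulus a0 r z) (0 + n) i (2 ^ n) = node (annulus a0 r z) (0 + n) i 0.
    by rewrite /node add0n natrX divff ?expf_neq0 // mul0r /annulus circle0 circle1.
  by rewrite !per subrr.
rewrite mul1n !mul0n !add0n sumrB outer_boundary_sum.
set S := \sum_(l < _) _ * _; set I := \sum_(l < _) _ => H.
have IB : normc I <= e.
  rewrite (le_trans _ a0e) // (_ : a0 * K = B * (a0 * r * (4 * pi))); last by rewrite /K; ring.
  apply: inner_boundary_sum => // u uz; apply: gB; exact: le_trans uz a0s.
have SB : normc ((root2 R n - (root2 R n)^-1) / 2 * S) <= 2 * e.
  rewrite -[X in normc X](subrK I) (le_trans (normcD _ _)) //.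
  by rewrite mulr_natl mulr2n lerD.
have gap : 4 / 2 ^+ n <= normc ((root2 R n - (root2 R n)^-1) / 2).
  have := root2_gap (leq_trans (leq_addl n0 2) le_n).
  rewrite normcM normcV normc_nat ler_pdivlMr //; lra.
move: SB; rewrite normcM => SB.
have := le_trans (ler_wpM2r (normc_ge0 S) gap) SB.
have N0 : (0 : R) < 2 ^+ n by rewrite exprn_gt0.
rewrite mulrAC ler_pdivrMr //.
by have := mulr_gt0 e0 N0; lra.
Qed.

End CauchyMean.

(** * Polynomial interpolation at roots of unity *)

Section Interpolation.
Variable R : realType.
Notation C := (R[i] : numClosedFieldType).
Implicit Types (f : C -> C) (z : C) (e r : R).

(* The coefficients are those of the polynomial of degree less than [2 ^ n]
   interpolating [f] at the [2 ^ n]-th roots of [r ^ (2 ^ n)]. *)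
Definition interpolant f (r : R) n : {poly R[i]} :=
  \poly_(j < 2 ^ n) ((2 ^ n)%:R^-1 * (r%:C%C ^+ j)^-1 *
    \sum_(k < 2 ^ n) f (r%:C%C * root2 R n ^+ k) * root2 R n ^+ (k * (2 ^ n - j))).

Lemma root2_partial_fraction n k (x : R[i]) :
  (root2 R n ^+ k - x) * \sum_(j < 2 ^ n) x ^+ j * root2 R n ^+ (k * (2 ^ n - j)) =
  root2 R n ^+ k * (1 - x ^+ (2 ^ n)).
Proof.
have -> : 1 = (root2 R n ^+ k) ^+ (2 ^ n) by rewrite exprAC root2_expr expr1n.
rewrite subrXX [RHS]mulrCA.
congr (_ * _); rewrite mulr_sumr; apply: eq_bigr => j _.
rewrite mulrA mulrC -exprS -exprM; congr (_ ^+ _ * _); congr (_ * _)%N.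
by have := ltn_ord j; lia.
Qed.

(** Barycentric form of the interpolant: the factor in front is the nodal polynomial, up to
    normalization. *)
Lemma horner_interpolant f r z n : 0 < r -> normc z < r ->
  (2 ^ n)%:R * (interpolant f r n).[z] =
  (1 - (z / r%:C%C) ^+ (2 ^ n)) *
   \sum_(k < 2 ^ n) f (r%:C%C * root2 R n ^+ k) *
     (root2 R n ^+ k / (root2 R n ^+ k - z / r%:C%C)).
Proof.
move=> r0 zr; set x := z / _; set w := root2 R n.
have rC0 : r%:C%C != 0 by rewrite eq_complex /= gt_eqF.
have N0 : (2 ^ n)%:R != 0 :> R[i] by rewrite pnatr_eq0 expn_eq0.
have wx (k : nat) : w ^+ k - x != 0.
  rewrite subr_eq0; apply/eqP => /(congr1 (@normc R)).
  rewrite normc_root2X normcM normcV normc_real gtr0_norm // => /esym/eqP.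
  by rewrite lt_eqF // ltr_pdivrMr // mul1r.
rewrite /interpolant horner_poly mulr_sumr mulr_sumr.
transitivity (\sum_(j < 2 ^ n) \sum_(k < 2 ^ n)
  f (r%:C%C * w ^+ k) * (x ^+ j * w ^+ (k * (2 ^ n - j)))).
  apply: eq_bigr => j _; rewrite -!mulrA mulVKf //.
  rewrite mulr_suml mulr_sumr; apply: eq_bigr => k _.
  by rewrite /x exprMn exprVn -/w; ring.
rewrite exchange_big /=; apply: eq_bigr => k _.
rewrite -mulr_sumr mulrCA; congr (_ * _).
apply: (mulfI (wx k)); rewrite root2_partial_fraction -/w mulrC; field.
exact: wx.
Qed.

(** The constant 1 is its own interpolant. *)
Lemma sum_root2_kernel r z n : 0 < r -> normc z < r ->
  (1 - (z / r%:C%C) ^+ (2 ^ n)) *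
   \sum_(k < 2 ^ n) (root2 R n ^+ k / (root2 R n ^+ k - z / r%:C%C)) = (2 ^ n)%:R.
Proof.
move=> r0 zr; have := @horner_interpolant (fun _ => 1) r z n r0 zr.
under [X in _ = _ * X]eq_bigr do rewrite mul1r.
move=> <-; rewrite -[RHS]mulr1; congr (_ * _).
have N0 : (2 ^ n)%:R != 0 :> R[i] by rewrite pnatr_eq0 expn_eq0.
rewrite /interpolant horner_poly.
have n0 : (0 < 2 ^ n)%N by rewrite expn_gt0.
rewrite (bigD1 (Ordinal n0)) //= [X in _ + X]big1 ?addr0.
  rewrite !expr0 invr1 !mulr1 ?subn0 (eq_bigr (fun _ => 1)); last first.
    by move=> k _; rewrite mul1r mulnC exprM root2_expr expr1n.
  by rewrite sumr_const card_ord mulVf.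
move=> j j0; rewrite (eq_bigr (fun k : 'I__ => (root2 R n ^+ (2 ^ n - j)) ^+ k)); last first.
  by move=> k _; rewrite mul1r -exprM mulnC.
rewrite sum_root2 ifF ?mulr0 ?mul0r //.
apply/negP => /dvdn_leq; have := ltn_ord j; move: j0; rewrite -val_eqE /=; lia.
Qed.

(** Writing [f z] with the kernel identity turns the interpolation error into the sum controlled by
    [cauchy_mean]. *)
Lemma interpolant_sub f r z n : 0 < r -> normc z < r ->
  (2 ^ n)%:R * ((interpolant f r n).[z] - f z) =
  (1 - (z / r%:C%C) ^+ (2 ^ n)) *
   \sum_(k < 2 ^ n) (r%:C%C * root2 R n ^+ k) *
           difference_quotient f z (r%:C%C * root2 R n ^+ k).
Proof.
move=> r0 zr; rewrite mulrBr horner_interpolant // -(@sum_root2_kernel r z n) //.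
rewrite -[X in _ - X]mulrA -mulrBr; congr (_ * _).
rewrite mulr_suml -sumrB; apply: eq_bigr => k _; rewrite /difference_quotient.
have rC0 : r%:C%C != 0 by rewrite eq_complex /= gt_eqF.
have wx : r%:C%C * root2 R n ^+ k - z != 0.
  rewrite subr_eq0; apply/eqP => /(congr1 (@normc R)).
  by rewrite normcM normc_root2X normc_real gtr0_norm // mulr1 => E; rewrite E ltxx in zr.
field.
by apply/andP; split.
Qed.

Lemma interpolant_cvg f r z : entire f -> normc z < r -> forall e, 0 < e ->
  exists n0, forall n, (n0 <= n)%N -> normc ((interpolant f r n).[z] - f z) <= e.
Proof.
move=> ef zr e e0; have r0 : 0 < r := le_lt_trans (normc_ge0 _) zr.
have e20 : 0 < e / 2 by rewrite divr_gt0.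
have [n0 Hn] := cauchy_mean ef zr e20; exists n0 => n /Hn.
have N0 : (0 : R) < 2 ^+ n by rewrite exprn_gt0.
move=> SB; rewrite -(ler_pM2l N0).
have -> : 2 ^+ n * normc ((interpolant f r n).[z] - f z) =
    normc ((2 ^ n)%:R * ((interpolant f r n).[z] - f z)).
  by rewrite normcM normc_nat natrX.
rewrite interpolant_sub // normcM.
have x1 : normc (1 - (z / r%:C%C) ^+ (2 ^ n)) <= 2.
  rewrite (le_trans (normcB _ _)) // normc1 normcX -[2]/(1 + 1) lerD2l.
  rewrite exprn_ile1 ?normc_ge0 // normcM normcV normc_real gtr0_norm //.
  by rewrite ler_pdivrMr // mul1r ltW.
apply: (le_trans (ler_pM (normc_ge0 _) (normc_ge0 _) x1 SB)).
by rewrite mulrA [2 * _]mulrC divfK // mulrC.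
Qed.

End Interpolation.

(** * Uniform approximation of entire functions by polynomials *)

Section PolynomialApproximation.
Variable R : realType.
Notation C := (R[i] : numClosedFieldType).
Implicit Types (f : C -> C) (z : C) (e r : R).

Definition poly_approx f := forall r e, 0 < e ->
  exists p : {poly R[i]}, forall z, normc z <= r -> normc (f z - p.[z]) <= e.

Lemma cdiff_continuous f z d e : cdiff f z d -> 0 < e ->
  exists2 r, 0 < r & forall u, normc (u - z) <= r -> normc (f u - f z) <= e.
Proof.
move=> fd e0; have [r r0 Hr] := fd 1 ltr01.
have d0 : 0 < normc d + 1 by rewrite ltr_wpDl ?normc_ge0.
exists (Num.min r (e / (normc d + 1))); first by rewrite lt_min r0 divr_gt0.
move=> u; rewrite le_min ler_pdivlMr // => /andP[ur ue].
have := Hr _ ur; rewrite [z + _]addrC subrK mul1r => H.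
rewrite (le_trans _ ue) // -[X in normc X](subrK ((u - z) * d)).
by rewrite (le_trans (normcD _ _)) // normcM mulrDr mulr1 addrC lerD2l.
Qed.

Lemma entire_circle_bounded f r : entire f ->
  exists M, forall t, 0 <= t <= 1 -> normc (f (r%:C%C * circle t)) <= M.
Proof.
move=> ef; pose F t := normc (f (r%:C%C * circle t)).
have cF : continuous F.
  move=> t; apply/cvgrPdist_le => e e0.
  have [d fd] := derivable_cdiff (ef (r%:C%C * circle t)).
  have [s s0 Hs] := cdiff_continuous fd e0.
  pose K := `|r| * (4 * pi) + 1.
  have K0 : 0 < K by rewrite ltr_wpDl ?mulr_ge0 ?pi_ge0.
  near=> u; rewrite distrC.
  have close : normc (r%:C%C * circle u - r%:C%C * circle t) <= s.
    rewrite -mulrBr normcM normc_real.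
    apply: (le_trans (ler_wpM2l _ (normc_circleB _ _))) => //.
    rewrite mulrA (@le_trans _ _ (K * `|u - t|)) //.
      by rewrite ler_wpM2r // lerDl.
    rewrite mulrC -ler_pdivlMr // distrC.
    near: u; apply/nbhs_ballP; exists (s / K) => /=; first by rewrite divr_gt0.
    by move=> v; rewrite /ball /= => /ltW.
  have fuv := Hs _ close.
  apply/ler_normlP; split; rewrite /F.
    by rewrite opprB (le_trans (ler_normcB_dist _ _)) // normc_distC.
  by rewrite (le_trans (ler_normcB_dist _ _)).
have [c _ Hc] := @EVT_max R F 0 1 ler01 (continuous_subspaceT cF).
by exists (F c) => t t01; apply: Hc; rewrite in_itv.
Unshelve. all: by end_near. Qed.

Lemma coef_interpolant_le f r M n j : 0 < r ->
  (forall t, 0 <= t <= 1 -> normc (f (r%:C%C * circle t)) <= M) ->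
  normc (interpolant f r n)`_j <= M / r ^+ j.
Proof.
move=> r0 fM.
have M0 : 0 <= M by rewrite (le_trans _ (fM 0 _)) ?normc_ge0 // lexx ler01.
have N0 : 0 < (2 ^ n)%:R :> R by rewrite ltr0n expn_gt0.
rewrite coef_poly; case: ifP => _; last by rewrite normc0 divr_ge0 // exprn_ge0 // ltW.
rewrite !normcM !normcV normc_nat normcX normc_real gtr0_norm // [_ * (_ ^+ _)^-1]mulrC.
rewrite -mulrA mulrC ler_pM2r ?invr_gt0 ?exprn_gt0 // ler_pdivrMl //.
rewrite (le_trans (normc_sum _ _ _)) // mulr_natl -[in leRHS](card_ord (2 ^ n)) -sumr_const.
apply: ler_sum => k _; rewrite normcM normc_root2X mulr1 root2_circle fM //.
rewrite divr_ge0 ?exprn_ge0 //= ler_pdivrMr ?exprn_gt0 // mul1r -natrX ler_nat.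
by rewrite ltnW.
Qed.

Lemma normc_subXX_le (x y : R[i]) r j : normc x <= r -> normc y <= r ->
  normc (x ^+ j - y ^+ j) <= j%:R * r ^+ j.-1 * normc (x - y).
Proof.
move=> xr yr; have r0 : 0 <= r := le_trans (normc_ge0 _) xr.
rewrite subrXX normcM mulrC ler_wpM2r ?normc_ge0 //.
have -> : j%:R * r ^+ j.-1 = \sum_(k < j) r ^+ j.-1.
  by rewrite sumr_const card_ord mulr_natl.
rewrite (le_trans (normc_sum _ _ _)) //; apply: ler_sum => k _.
have kj : (k <= j.-1)%N by have := ltn_ord k; lia.
have -> : r ^+ j.-1 = r ^+ (j.-1 - k) * r ^+ k by rewrite -exprD subnK.
rewrite normcM !normcX.
by apply: ler_pM; rewrite ?exprn_ge0 ?normc_ge0 ?lerXn2r ?nnegrE ?normc_ge0.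
Qed.

Lemma sum_half_le n : \sum_(j < n) (j%:R / 2 ^+ j) <= 2 :> R.
Proof.
have E : \sum_(j < n) (j%:R / 2 ^+ j) = 2 - 2 * (n%:R + 1) / 2 ^+ n :> R.
  elim: n => [|n IH]; first by rewrite big_ord0 expr0; field.
  rewrite big_ord_recr /= IH exprS -[n.+1%:R]natr1.
  by field; rewrite expf_neq0.
by rewrite E lerBlDr lerDl divr_ge0 ?exprn_ge0 ?mulr_ge0 ?addr_ge0.
Qed.

(** The nodes lie on the circle of radius 2r and the points in the disc of radius r, so the j-th
    term is at most j / 2^j times M / r; this makes the constant independent of [n]. *)
Lemma interpolant_lipschitz f r M n x y : 0 < r ->
  (forall t, 0 <= t <= 1 -> normc (f ((2 * r)%:C%C * circle t)) <= M) ->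
  normc x <= r -> normc y <= r ->
  normc ((interpolant f (2 * r) n).[x] - (interpolant f (2 * r) n).[y]) <=
  2 * M / r * normc (x - y).
Proof.
move=> r0 fM xr yr; set p := interpolant _ _ _.
have M0 : 0 <= M by rewrite (le_trans _ (fM 0 _)) ?normc_ge0 // lexx ler01.
rewrite !horner_coef -sumrB (le_trans (normc_sum _ _ _)) //.
have -> : 2 * M / r * normc (x - y) = (M / r * normc (x - y)) * 2 by field; rewrite gt_eqF.
apply: (le_trans _ (ler_wpM2l _ (sum_half_le (size p)))); last first.
  by rewrite mulr_ge0 ?divr_ge0 ?normc_ge0 // ltW.
rewrite mulr_sumr; apply: ler_sum => j _.
have r20 : 0 < 2 * r by rewrite mulr_gt0.
rewrite -mulrBr normcM; have := coef_interpolant_le n j r20 fM; rewrite -/p.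
move=> /ler_pM /(_ (normc_subXX_le j xr yr)) H.
apply: (le_trans (H _ _)); rewrite ?normc_ge0 //.
case: (nat_of_ord j) => [|k]; first by rewrite !mul0r !mulr0.
rewrite exprMn !exprS /=.
rewrite le_eqVlt; apply/orP; left; apply/eqP; field.
by rewrite !expf_neq0 // gt_eqF.
Qed.

Lemma real_net r d : 0 < d ->
  exists s : seq R, forall x, `|x| <= r -> exists2 y, y \in s & `|x - y| <= d.
Proof.
move=> d0.
exists [seq k%:R * d - r | k <- iota 0 (Num.truncn (2 * r / d)).+1] => x xr.
have := xr; rewrite ler_norml => /andP[x1 x2].
have t0 : 0 <= (x + r) / d by rewrite divr_ge0 ?(ltW d0) //; lra.
exists ((Num.truncn ((x + r) / d))%:R * d - r).
  apply/mapP; exists (Num.truncn ((x + r) / d)) => //; rewrite mem_iota /= add0n ltnS.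
  apply: le_truncn; rewrite ler_pM2r ?invr_gt0 //; lra.
have /andP[] := truncn_itv t0; rewrite ler_pdivlMr // ltr_pdivrMr //.
set t := Num.truncn _; rewrite -[t.+1%:R]natr1 mulrDl mul1r => h1 h2; apply/ler_normlP; split; lra.
Qed.

Lemma complex_net r d : 0 < d ->
  exists s : seq R[i], forall z, normc z <= r -> exists2 y, y \in s & normc (z - y) <= d.
Proof.
move=> d0; have d20 : 0 < d / 2 by rewrite divr_gt0.
have [s Hs] := real_net r d20.
exists [seq Complex a b | a <- s, b <- s] => -[x y] zr.
have [a sa xa] := Hs x (le_trans (ler_Re_normc (Complex x y)) zr).
have [b sb yb] := Hs y (le_trans (ler_Im_normc (Complex x y)) zr).
exists (Complex a b); first by apply/allpairsP; exists (a, b).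
by rewrite (le_trans (normc_le_ReIm _)) //= [d]splitr lerD.
Qed.

Lemma uniform_threshold (T : eqType) (s : seq T) (P : T -> nat -> Prop) :
  (forall x, x \in s -> exists n0, forall n, (n0 <= n)%N -> P x n) ->
  exists n0, forall n, (n0 <= n)%N -> forall x, x \in s -> P x n.
Proof.
elim: s => [|x s IH] H; first by exists 0%N.
have [n1 H1] := H x (mem_head _ _).
have [|n2 H2] := IH; first by move=> y ys; apply: H; rewrite inE ys orbT.
exists (n1 + n2)%N => n le y; rewrite inE => /predU1P[->|ys].
  by apply: H1; lia.
by apply: H2 => //; lia.
Qed.

(* The interpolants converge pointwise and are equi-Lipschitz, hence converge
   uniformly on discs. *)
Lemma entire_poly_approx f : entire f -> poly_approx f.
Proof.
move=> ef r' e e0.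
pose r := Num.max r' 1; have r1 : 1 <= r by rewrite le_max lexx orbT.
suff [p Hp] : exists p : {poly R[i]}, forall z, normc z <= r -> normc (f z - p.[z]) <= e.
  by exists p => z zr; apply: Hp; rewrite le_max zr.
have r0 : 0 < r by rewrite (lt_le_trans ltr01).
(* A net point near the disc of radius [r] may fall outside it, but by at most [d <= 1]. *)
pose s := r + 1; have s0 : 0 < s by rewrite addr_gt0.
have [M fM] := entire_circle_bounded (2 * s) ef.
have M0 : 0 <= M by rewrite (le_trans _ (fM 0 _)) ?normc_ge0 // lexx ler01.
pose p n := interpolant f (2 * s) n.
have pl n x y : normc x <= s -> normc y <= s ->
  normc ((p n).[x] - (p n).[y]) <= 2 * M / s * normc (x - y).
  exact: interpolant_lipschitz.
have s2 x : normc x <= s -> normc x < 2 * s by lra.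
have cvg_p x e' : normc x <= s -> 0 < e' ->
    exists n0, forall n, (n0 <= n)%N -> normc ((p n).[x] - f x) <= e'.
  by move=> /s2 xs; exact: interpolant_cvg.
pose K := 2 * M / s + 1.
have K0 : 0 < K by rewrite ltr_wpDl // divr_ge0 ?mulr_ge0 // ltW.
pose d := Num.min 1 (e / (5 * K)).
have d0 : 0 < d by rewrite lt_min ltr01 divr_gt0 ?mulr_gt0.
have d1 : d <= 1 by rewrite ge_min lexx.
have Kd : K * d <= e / 5.
  have : d <= e / (5 * K) by rewrite ge_min lexx orbT.
  by rewrite ler_pdivlMr ?mulr_gt0 // => h; lra.
have [net Hnet] := complex_net r d0.
have e50 : 0 < e / 5 by rewrite divr_gt0.
have [x|n0 Hn] := @uniform_threshold _ net (fun x n => normc x <= s -> normc ((p n).[x] - f x) <= e / 5).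
  move=> _; have [xs|xs] := leP (normc x) s; last by exists 0%N => n _; lra.
  by have [n0 Hn] := cvg_p x _ xs e50; exists n0 => n /Hn.
exists (p n0) => z zr.
have [y ynet zy] := Hnet z zr.
have ys : normc y <= s.
  rewrite -(subrK z y) (le_trans (normcD _ _)) // addrC lerD // normc_distC.
  exact: le_trans zy d1.
have zs : normc z <= s by rewrite /s; lra.
have [n1 Hn1] := cvg_p z _ zs e50.
have [n2 Hn2] := cvg_p y _ ys e50.
(* This index depends on [z] and is only a bridge between [f] and the fixed [p n0]: the path f z, p
   n z, p n y, f y, p n0 y, p n0 z has five steps of size at most e / 5. *)
pose n := (n1 + n2)%N.
have h1 := Hn1 n (leq_addr _ _).
have h2 := Hn2 n (leq_addl _ _).
have h3 := Hn n0 (leqnn _) y ynet ys.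
have pl' k : normc ((p k).[z] - (p k).[y]) <= e / 5.
  rewrite (le_trans (pl k z y zs ys)) // (le_trans _ Kd) //.
  apply: ler_pM => //; first by rewrite divr_ge0 ?mulr_ge0 // ltW.
    exact: normc_ge0.
  by rewrite lerDl.
move: h1 h2 h3 (pl' n) (pl' n0).
rewrite [normc (_ - f z)]normc_distC [normc ((p n0).[y] - _)]normc_distC.
rewrite [normc ((p n0).[z] - _)]normc_distC => h1 h2 h3 h4 h5.
have t1 := normc_triangle (p n).[z] (f z) (p n0).[z].
have t2 := normc_triangle (p n).[y] (p n).[z] (p n0).[z].
have t3 := normc_triangle (f y) (p n).[y] (p n0).[z].
have t4 := normc_triangle (p n0).[y] (f y) (p n0).[z].
lra.
Qed.


End PolynomialApproximation.

(** * Locally uniform limits of polynomials *)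

Section Completeness.
Variable R : realType.
Notation C := (R[i] : numClosedFieldType).

Lemma real_cauchy_limit (u : nat -> R) :
  (forall e, 0 < e -> exists N, forall m n, (N <= m)%N -> (N <= n)%N -> `|u m - u n| <= e) ->
  exists l, forall e, 0 < e -> exists N, forall n, (N <= n)%N -> `|u n - l| <= e.
Proof.
(* The limit is obtained as the lower limit, the supremum of the eventual lower bounds. *)
move=> Cu; pose A := [set x | exists N, forall n, (N <= n)%N -> x <= u n].
have [N0 H0] := Cu 1 ltr01.
have A0 : A (u N0 - 1).
  by exists N0 => n Nn; have := H0 N0 n (leqnn _) Nn; rewrite ler_norml => /andP[]; lra.
have Aub x : A x -> x <= u N0 + 1.
  move=> [N HN]; have := HN (N0 + N)%N (leq_addl _ _).
  by have := H0 N0 (N0 + N)%N (leqnn _) (leq_addr _ _); rewrite ler_norml => /andP[]; lra.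
have hs : has_sup A by split; [exists (u N0 - 1) | exists (u N0 + 1)].
exists (sup A) => e e0; have [N HN] := Cu e e0; exists N => n Nn.
apply/ler_normlP; split.
  rewrite opprB lerBlDr; apply: sup_le_ub; first by case: hs.
  move=> x [N1 H1]; have := H1 (n + N1)%N (leq_addl _ _).
  have := HN n (n + N1)%N Nn (leq_trans Nn (leq_addr _ _)).
  by rewrite ler_norml => /andP[]; lra.
rewrite lerBlDl; have : A (u n - e).
  by exists N => m Nm; have := HN n m Nn Nm; rewrite ler_norml => /andP[]; lra.
by move/(ub_le_sup hs.2); lra.
Qed.

Lemma complex_cauchy_limit (u : nat -> R[i]) :
  (forall e, 0 < e ->
    exists N, forall m n, (N <= m)%N -> (N <= n)%N -> normc (u m - u n) <= e) ->
  exists l, forall e, 0 < e -> exists N, forall n, (N <= n)%N -> normc (u n - l) <= e.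
Proof.
move=> Cu.
have ReB (x y : R[i]) : complex.Re x - complex.Re y = complex.Re (x - y) by case: x y => ? ? [].
have ImB (x y : R[i]) : complex.Im x - complex.Im y = complex.Im (x - y) by case: x y => ? ? [].
have [e /Cu[N HN]|a Ha] := @real_cauchy_limit (fun n => complex.Re (u n)).
  exists N => m n /HN H /H; rewrite ReB; exact: le_trans (ler_Re_normc _).
have [e /Cu[N HN]|b Hb] := @real_cauchy_limit (fun n => complex.Im (u n)).
  exists N => m n /HN H /H; rewrite ImB; exact: le_trans (ler_Im_normc _).
exists (Complex a b) => e e0; have e20 : 0 < e / 2 by rewrite divr_gt0.
have [N1 H1] := Ha _ e20; have [N2 H2] := Hb _ e20.
exists (N1 + N2)%N => n le_n.
rewrite (le_trans (normc_le_ReIm _)) // -ReB -ImB /= [e]splitr.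
by apply: lerD; [apply: H1 | apply: H2]; lia.
Qed.

Definition cvg_discs (F : nat -> C -> C) (f : C -> C) := forall r e : R, 0 < e ->
  exists N, forall n, (N <= n)%N -> forall z, normc z <= r -> normc (F n z - f z) <= e.

Lemma cauchy_discs (F : nat -> C -> C) :
  (forall r e : R, 0 < e -> exists N, forall m n, (N <= m)%N -> (N <= n)%N ->
    forall z, normc z <= r -> normc (F m z - F n z) <= e) ->
  exists f, cvg_discs F f.
Proof.
move=> CF.
have lim z : exists l, forall e, 0 < e ->
    exists N, forall n, (N <= n)%N -> normc (F n z - l) <= e.
  apply: complex_cauchy_limit => e e0; have [N HN] := CF (normc z) e e0.
  by exists N => m n Nm Nn; exact: HN.
have [f Hf] := choice lim; exists f => r e e0.
have e20 : 0 < e / 2 by rewrite divr_gt0.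
have [N HN] := CF r _ e20; exists N => n Nn z zr.
have [N1 HN1] := Hf z _ e20.
rewrite (le_trans (normc_triangle (F (N + N1)%N z) _ _)) // [e]splitr lerD //.
  by apply: HN => //; lia.
by apply: HN1; lia.
Qed.

Lemma cvg_discs_unique (F : nat -> C -> C) f g : cvg_discs F f -> cvg_discs F g -> f = g.
Proof.
move=> Ff Fg; apply/funext => z; apply/eqP; rewrite -subr_eq0 -normc_eq0.
rewrite eq_le normc_ge0 andbT; apply/ler_addgt0Pr => e e0; rewrite add0r.
have e20 : 0 < e / 2 by rewrite divr_gt0.
have [N HN] := Ff (normc z) _ e20; have [M HM] := Fg (normc z) _ e20.
rewrite (le_trans (normc_triangle (F (N + M)%N z) _ _)) // [e]splitr lerD //.
  by rewrite normc_distC HN //; lia.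
by rewrite HM //; lia.
Qed.

End Completeness.

(** * Cauchy estimates and Taylor remainders for polynomials *)

Section PolynomialCauchyEstimates.
Variable R : realType.
Implicit Types (p : {poly R[i]}) (z h : R[i]) (r M : R).

Definition recentered p z : {poly R[i]} := \poly_(i < size p) p^`N(i).[z].

Lemma coef_recentered p z j : (recentered p z)`_j = p^`N(j).[z].
Proof.
rewrite coef_poly; case: ltnP => // /nderivn_poly0 ->.
by rewrite horner0.
Qed.

Lemma horner_recentered p z h : (recentered p z).[h] = p.[z + h].
Proof. by rewrite horner_poly nderiv_taylor //; exact: mulrC. Qed.

Lemma normc_nderivn_le p z r M j : 0 <= r ->
  (forall w, normc (w - z) <= r -> normc p.[w] <= M) ->
  normc p^`N(j).[z] * r ^+ j <= M.
Proof.
move=> r0 pM; rewrite -coef_recentered; apply: normc_coef_le => // h hr.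
by rewrite horner_recentered pM // [z + h]addrC addrK hr.
Qed.

Lemma sum_geometric_le (q : R) n : 0 <= q <= 2^-1 -> \sum_(i < n) q ^+ i <= 2.
Proof.
move=> /andP[q0 q1].
have : (1 - q) * \sum_(i < n) q ^+ i <= 1.
  by have := subrX1 q n; have := exprn_ge0 n q0; set x := q ^+ n; set S := \sum_(i < n) _; lra.
have : 0 <= \sum_(i < n) q ^+ i by apply: sumr_ge0 => i _; exact: exprn_ge0.
set S := \sum_(i < n) _; nra.
Qed.

(** Cauchy's estimate makes the tail geometric with ratio at most 1/2. The bound does not see the
    degree of [p], so it survives passage to the limit. *)
Lemma taylor_remainder p z h r M n : 0 < r -> 2 * normc h <= r ->
  (forall w, normc (w - z) <= r -> normc p.[w] <= M) ->
  normc (p.[z + h] - \sum_(i < n) p^`N(i).[z] * h ^+ i) <= 2 * M * (normc h / r) ^+ n.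
Proof.
move=> r0 hr pM; have M0 : 0 <= M.
  by rewrite (le_trans (normc_ge0 p.[z])) // pM // subrr normc0 ltW.
rewrite (nderiv_taylor_wide (mulrC _ _) (leq_addl n (size p))) big_split_ord /=.
rewrite [_ + _ - _]addrAC subrr add0r (le_trans (normc_sum _ _ _)) //.
pose q := normc h / r.
have q0 : 0 <= q <= 2^-1.
  apply/andP; split; first by rewrite divr_ge0 ?normc_ge0 ?ltW.
  by rewrite ler_pdivrMr //; lra.
have -> : 2 * M * (normc h / r) ^+ n = M * q ^+ n * 2 by rewrite -/q; ring.
have [q0' _] := andP q0.
apply: (le_trans _ (ler_wpM2l _ (sum_geometric_le (size p) q0))); last first.
  by rewrite mulr_ge0 // exprn_ge0.
rewrite mulr_sumr; apply: ler_sum => i _.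
rewrite normcM normcX -mulrA -exprD.
have := normc_nderivn_le (n + i) (ltW r0) pM; set a := normc _ => aM.
have -> : normc h = r * q by rewrite mulrC divfK // gt_eqF.
by rewrite exprMn mulrA ler_wpM2r // exprn_ge0.
Qed.

Lemma poly_bounded_disc p r :
  exists2 M, 0 <= M & forall z, normc z <= r -> normc p.[z] <= M.
Proof.
exists (\sum_(i < size p) normc p`_i * `|r| ^+ i).
  by apply: sumr_ge0 => i _; rewrite mulr_ge0 ?normc_ge0.
move=> z zr; rewrite horner_coef (le_trans (normc_sum _ _ _)) //.
apply: ler_sum => i _; rewrite normcM normcX ler_wpM2l ?normc_ge0 //.
by rewrite lerXn2r ?nnegrE ?normc_ge0 // (le_trans zr) // ler_norm.
Qed.

End PolynomialCauchyEstimates.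

(** * Entire functions as limits of polynomials *)

Section PolynomialLimits.
Variable R : realType.
Notation C := (R[i] : numClosedFieldType).
Implicit Types (f : C -> C) (p : nat -> {poly R[i]}) (r e : R).

Definition pcvg p f := cvg_discs (fun n z => (p n).[z]) f.

Lemma pcvg_bounded p f r : pcvg p f -> exists M N, 0 <= M /\
  forall n, (N <= n)%N -> forall z, normc z <= r -> normc (p n).[z] <= M.
Proof.
move=> pf; have [N HN] := pf r 1 ltr01.
have [M M0 HM] := poly_bounded_disc (p N) r.
exists (1 + 1 + M), N; split; first by rewrite !addr_ge0.
move=> n Nn z zr; have := HN n Nn z zr; have := HN N (leqnn _) z zr.
have t1 := ler_normcB_dist (p n).[z] (p N).[z].
have t2 := normc_triangle (f z) (p n).[z] (p N).[z].
rewrite [normc ((p N).[z] - _)]normc_distC; have := HM z zr; lra.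
Qed.

(** Weierstrass' theorem: Cauchy's estimate on unit circles makes the derivatives a Cauchy sequence,
    and the second-order Taylor remainder, uniform in [n], identifies their limit as the derivative
    of [f]. *)
Lemma pcvg_deriv p f : pcvg p f ->
  exists2 g, pcvg (fun n => (deriv (p n))) g & forall z, cdiff f z (g z).
Proof.
move=> pf.
have derE (q : {poly R[i]}) z : (deriv q).[z] = q^`N(1).[z] by rewrite nderivn1.
have [g pg] : exists g, pcvg (fun n => (deriv (p n))) g.
  apply: cauchy_discs => r e e0; have e20 : 0 < e / 2 by rewrite divr_gt0.
  have [N HN] := pf (r + 1) _ e20; exists N => m n Nm Nn z zr.
  have -> : (deriv (p m)).[z] - (deriv (p n)).[z] = (p m - p n)^`N(1).[z].
    by rewrite -derE derivB hornerD hornerN.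
  have H := @normc_nderivn_le R (p m - p n) z 1 e 1 ler01.
  rewrite expr1n mulr1 in H; apply: H => w wz.
  have wr : normc w <= r + 1.
    by rewrite -(subrK z w) (le_trans (normcD _ _)) // addrC lerD.
  have := HN m Nm w wr; have := HN n Nn w wr.
  rewrite hornerD hornerN [normc ((p n).[w] - _)]normc_distC.
  have := normc_triangle (f w) (p m).[w] (p n).[w]; lra.
exists g => // z e e0.
have [M [N [M0 HM]]] := pcvg_bounded (normc z + 1) pf.
(* The bound 1/2 is what [taylor_remainder] asks with radius 1; the other turns 2M |h|^2 into at
   most e |h|. *)
pose d := Num.min 2^-1 (e / (2 * M + 1)).
have M1 : 0 < 2 * M + 1 by rewrite ltr_wpDl ?mulr_ge0.
exists d => [|h]; first by rewrite lt_min invr_gt0 ltr0n divr_gt0.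
rewrite le_min ler_pdivlMr // => /andP[h1 h2]; have h0 := normc_ge0 h.
have zb w : normc (w - z) <= 1 -> normc w <= normc z + 1.
  by move=> wz; rewrite -{1}(subrK z w) (le_trans (normcD _ _)) // addrC lerD.
have main n : (N <= n)%N ->
    normc ((p n).[z + h] - (p n).[z] - h * (deriv (p n)).[z]) <= e * normc h.
  move=> Nn; have := @taylor_remainder R (p n) z h 1 M 2 ltr01.
  rewrite !big_ord_recl big_ord0 /= addr0 expr0 expr1 mulr1 nderivn0 -derE divr1.
  rewrite [_ * h]mulrC opprD addrA; set x := normc (_ - _).
  move=> /(_ _ _)/le_trans; apply; first by lra.
    by move=> w /zb; exact: HM.
  by rewrite expr2 mulrA ler_wpM2r //; nra.
apply/ler_addgt0Pr => t t0.
have t40 : 0 < t / 4 by rewrite divr_gt0.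
have [N1 H1] := pf (normc z + 1) _ t40; have [N2 H2] := pg (normc z) _ t40.
pose n := (N + N1 + N2)%N.
have k1 : normc ((p n).[z + h] - f (z + h)) <= t / 4.
  apply: H1; first exact: leq_trans (leq_addl N N1) (leq_addr _ _).
  by apply: zb; rewrite addrAC subrr add0r; lra.
have k2 : normc ((p n).[z] - f z) <= t / 4.
  apply: H1; first exact: leq_trans (leq_addl N N1) (leq_addr _ _).
  by apply: zb; rewrite subrr normc0.
have k3 : normc ((deriv (p n)).[z] - g z) <= t / 4 := H2 n (leq_addl _ _) z (lexx _).
have k4 : normc ((p n).[z + h] - (p n).[z] - h * (deriv (p n)).[z]) <= e * normc h.
  by apply: main; rewrite /n -addnA leq_addr.
set A := (p n).[z + h] in k1 k4; set B := (p n).[z] in k2 k4.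
set D := (deriv (p n)).[z] in k3 k4.
have -> : f (z + h) - f z - h * g z =
  (A - B - h * D) + (h * (D - g z) + ((B - f z) - (A - f (z + h)))) by ring.
rewrite (le_trans (normcD _ _)) // lerD //.
rewrite (le_trans (normcD _ _)) // normcM.
have := normcB (B - f z) (A - f (z + h)).
have : normc h * normc (D - g z) <= t / 4.
  by rewrite (le_trans _ k3) // ler_piMl ?normc_ge0 //; lra.
lra.
Qed.

Lemma pcvg_derive1 p f : pcvg p f -> pcvg (fun n => (deriv (p n))) (derive1 f).
Proof. by move=> /pcvg_deriv[g pg /cdiff_derive1 ->]. Qed.

Lemma pcvg_derive1n p f k : pcvg p f -> pcvg (fun n => (derivn k (p n))) (derive1n k f).
Proof.
move=> pf; elim: k => [|k IH]; first exact: pf.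
by have := pcvg_derive1 IH; congr (pcvg _ _); apply/funext => n; rewrite derivnS.
Qed.

Lemma pcvg_entire p f : pcvg p f -> entire f.
Proof. by move=> /pcvg_deriv[g _ /cdiff_entire]. Qed.

Lemma pcvg_cdiff p f z : pcvg p f -> cdiff f z (derive1 f z).
Proof. by move=> /pcvg_deriv[g _ H]; rewrite (cdiff_derive1 H). Qed.

Lemma poly_approx_pcvg f : poly_approx f -> exists p, pcvg p f.
Proof.
move=> fa.
have [p Hp] := choice (fun n => fa n%:R n.+1%:R^-1 ltac:(by rewrite invr_gt0)).
exists p => r e e0; pose N := ((Num.truncn r).+1 + (Num.truncn e^-1).+1)%N.
exists N => n Nn z zr; rewrite normc_distC.
apply: (le_trans (Hp n z _)).
  rewrite (le_trans zr) // (le_trans (ltW (truncnS_gt _))) // ler_nat.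
  exact: leq_trans (leq_addr _ _) Nn.
rewrite -[e]invrK lef_pV2 ?posrE ?invr_gt0 //.
rewrite (le_trans (ltW (truncnS_gt _))) // ler_nat.
by apply: leqW; exact: leq_trans (leq_addl _ _) Nn.
Qed.

Lemma entire_pcvg f : entire f -> exists p, pcvg p f.
Proof. by move=> /entire_poly_approx/poly_approx_pcvg. Qed.

Lemma cvg_discs_entire (F : nat -> C -> C) f :
  (forall n, entire (F n)) -> cvg_discs F f -> entire f.
Proof.
move=> eF Ff; have [r e e0|p /pcvg_entire //] := @poly_approx_pcvg f.
have e20 : 0 < e / 2 by rewrite divr_gt0.
have [N HN] := Ff r _ e20; have [p Hp] := entire_poly_approx (eF N) r e20.
exists p => z zr; rewrite (le_trans (normc_triangle (F N z) _ _)) // [e]splitr lerD ?Hp //.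
by rewrite normc_distC HN.
Qed.

Lemma entire_derive1n f k : entire f -> entire (derive1n k f).
Proof. by move=> /entire_pcvg[p /(pcvg_derive1n k)/pcvg_entire]. Qed.

Lemma entire_bounded_disc f r : entire f ->
  exists2 M, 0 <= M & forall z, normc z <= r -> normc (f z) <= M.
Proof.
move=> /entire_poly_approx /(_ r 1 ltr01)[p Hp]; have [M M0 HM] := poly_bounded_disc p r.
exists (1 + M) => [|z zr]; first by rewrite addr_ge0.
by rewrite -(subrK p.[z] (f z)) (le_trans (normcD _ _)) // lerD ?Hp ?HM.
Qed.

Lemma normc_derive1n_le f z r M k : entire f -> 0 < r ->
  (forall w, normc (w - z) <= r -> normc (f w) <= M) ->
  normc (derive1n k f z) * r ^+ k <= k`!%:R * M.
Proof.
move=> /entire_pcvg[p pf] r0 fM; apply/ler_addgt0Pr => t t0.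
have rk : 0 < r ^+ k by rewrite exprn_gt0.
have kf : 0 < k`!%:R :> R by rewrite ltr0n fact_gt0.
have t1 : 0 < t / 2 / k`!%:R by rewrite !divr_gt0.
have t2 : 0 < t / 2 / r ^+ k by rewrite !divr_gt0.
have [N1 H1] := pf (normc z + r) _ t1.
have [N2 H2] := pcvg_derive1n k pf (normc z) t2.
pose n := (N1 + N2)%N.
have pN : normc (p n)^`N(k).[z] * r ^+ k <= M + t / 2 / k`!%:R.
  apply: normc_nderivn_le => [|w wz]; first exact: ltW.
  rewrite -(subrK (f w) (p n).[w]) (le_trans (normcD _ _)) // addrC lerD ?fM //.
  apply: H1; first exact: leq_addr.
  by rewrite -(subrK z w) (le_trans (normcD _ _)) // addrC lerD.
have pk : normc (derivn k (p n)).[z] * r ^+ k <= k`!%:R * M + t / 2.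
  rewrite nderivn_def hornerMn -mulr_natl normcM normc_nat -mulrA.
  by have := ler_wpM2l (ltW kf) pN; rewrite mulrDr [_ * (t / 2 / _)]mulrC divfK ?gt_eqF.
have := H2 n (leq_addl _ _) z (lexx _).
rewrite ler_pdivlMr // => dk.
rewrite -(subrK (derivn k (p n)).[z] (derive1n k f z)).
rewrite [leRHS](_ : _ = t / 2 + (k`!%:R * M + t / 2)); last by rewrite addrCA -splitr.
apply: le_trans (lerD dk pk).
by rewrite -mulrDl ler_pM2r // [normc ((derivn k (p n)).[z] - _)]normc_distC normcD.
Qed.

(** The increment is 1 because exp(D) is the translation by 1. A disc of radius 2 around [z] gives
    the remainder a factor 2^-n. *)
Lemma taylor_cvg f z : entire f -> forall e, 0 < e -> exists N, forall n, (N <= n)%N ->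
  normc (\sum_(k < n) derive1n k f z / k`!%:R - f (z + 1)) <= e.
Proof.
move=> /entire_pcvg[p pf] e e0.
have [M [N0 [M0 HM]]] := pcvg_bounded (normc z + 2) pf.
pose K := 2 * M + 1; have K0 : 0 < K by rewrite ltr_wpDl ?mulr_ge0.
exists (Num.truncn (K / e)).+1 => n Nn.
apply/ler_addgt0Pr => t t0.
(* The n Taylor coefficients and the value at z + 1 are each replaced by those of a polynomial, at a
   total cost of (n + 1) s = t. *)
pose s := t / (n%:R + 1).
have n1 : 0 < n%:R + 1 :> R by rewrite ltr_wpDl.
have s0 : 0 < s by rewrite divr_gt0.
have [N1 H1] := pf (normc z + 2) _ s0.
have [|N2 H2] := @uniform_threshold _ (iota 0 n)
  (fun k m => normc ((derivn k (p m)).[z] - derive1n k f z) <= s).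
  move=> k _; have [N HN] := pcvg_derive1n k pf (normc z) s0.
  by exists N => m /HN /(_ z (lexx _)).
pose m := (N0 + N1 + N2)%N.
have T : normc ((p m).[z + 1] - \sum_(k < n) (p m)^`N(k).[z] * 1 ^+ k) <=
    2 * M * (normc 1 / 2) ^+ n.
  apply: taylor_remainder => //; first by rewrite normc1 mulr1.
  move=> w wz; apply: HM; first by rewrite /m -addnA leq_addr.
  by rewrite -(subrK z w) (le_trans (normcD _ _)) // addrC lerD.
have Te : 2 * M * (normc 1 / 2) ^+ n <= e.
  rewrite normc1 div1r exprVn ler_pdivrMr ?exprn_gt0 // [e * _]mulrC -ler_pdivrMr //.
  rewrite (@le_trans _ _ (K / e)) //; first by rewrite ler_pM2r ?invr_gt0 // lerDl.
  rewrite (le_trans (ltW (truncnS_gt _))) // -natrX ler_nat.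
  by rewrite (leq_trans Nn) // ltnW // ltn_expl.
have S1 : normc ((p m).[z + 1] - f (z + 1)) <= s.
  apply: H1; first exact: leq_trans (leq_addl N0 N1) (leq_addr _ _).
  by rewrite (le_trans (normcD _ _)) // normc1 lerD2l ler1n.
have S2 : normc (\sum_(k < n) derive1n k f z / k`!%:R -
    \sum_(k < n) (p m)^`N(k).[z] * 1 ^+ k) <= n%:R * s.
  rewrite -sumrB (le_trans (normc_sum _ _ _)) // mulr_natl.
  have -> : s *+ n = \sum_(k < n) s by rewrite sumr_const card_ord.
  apply: ler_sum => k _; rewrite expr1n mulr1.
  have kf : (k`!)%:R != 0 :> R[i] by rewrite pnatr_eq0 -lt0n fact_gt0.
  have -> : (p m)^`N(k).[z] = (derivn k (p m)).[z] / k`!%:R.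
    by rewrite nderivn_def hornerMn -mulr_natr mulfK.
  rewrite -mulrBl normcM normcV normc_nat normc_distC ler_pdivrMr ?ltr0n ?fact_gt0 //.
  rewrite (@le_trans _ _ s) //.
    by apply: H2; rewrite ?mem_iota ?add0n ?ltn_ord // leq_addl.
  by rewrite ler_peMr ?(ltW s0) // ler1n fact_gt0.
move: S1 S2 T; rewrite normc_distC.
set A := (p m).[_]; set B := \sum_(k < n) _; set D := \sum_(k < n) _.
move=> S1 S2 T.
have -> : t = s + n%:R * s by rewrite /s; field; rewrite gt_eqF.
have t1 := normc_triangle D B (f (z + 1)); have t2 := normc_triangle A D (f (z + 1)).
move: t1 t2; rewrite [normc (D - A)]normc_distC [normc (A - f _)]normc_distC.
lra.
Qed.

End PolynomialLimits.

(** * The complex exponential *)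

Section EntireCalculus.
Variable R : realType.
Notation C := (R[i] : numClosedFieldType).
Implicit Types (f g : C -> C) (z a b : C) (r e : R).

Lemma entire_cdiff1 f z : entire f -> cdiff f z (derive1 f z).
Proof. by move=> /entire_pcvg[p /pcvg_cdiff]. Qed.

Lemma cdiff_affine f a b z d : cdiff f (a + b * z) d ->
  cdiff (fun t => f (a + b * t)) z (b * d).
Proof.
move=> fd e e0; pose K := normc b + 1.
have K0 : 0 < K by rewrite ltr_wpDl ?normc_ge0.
have eK : 0 < e / K by rewrite divr_gt0.
have [r r0 Hr] := fd _ eK; exists (r / K) => [|h]; first by rewrite divr_gt0.
rewrite ler_pdivlMr // => hr; have h0 := normc_ge0 h.
have bh : normc (b * h) <= normc h * K by rewrite normcM mulrC ler_wpM2l // lerDl.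
have -> : f (a + b * (z + h)) - f (a + b * z) - h * (b * d) =
  f (a + b * z + b * h) - f (a + b * z) - b * h * d.
  by rewrite mulrDr addrA mulrA [h * b]mulrC.
rewrite (le_trans (Hr _ (le_trans bh hr))) // mulrAC ler_pdivrMr // -mulrA.
by rewrite ler_pM2l.
Qed.

Lemma cdiff_scale f a z d : cdiff f z d -> cdiff (fun t => a * f t) z (a * d).
Proof.
move=> fd e e0; pose K := normc a + 1.
have K0 : 0 < K by rewrite ltr_wpDl ?normc_ge0.
have eK : 0 < e / K by rewrite divr_gt0.
have [r r0 Hr] := fd _ eK; exists r => // h /Hr.
have -> : a * f (z + h) - a * f z - h * (a * d) = a * (f (z + h) - f z - h * d) by ring.
rewrite normcM mulrAC ler_pdivlMr // mulrC => H; apply: le_trans H.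
by rewrite ler_wpM2r ?normc_ge0 // lerDl.
Qed.

Lemma cdiffD f g z d d' : cdiff f z d -> cdiff g z d' -> cdiff (fun t => f t + g t) z (d + d').
Proof.
move=> fd gd e e0; have e20 : 0 < e / 2 by rewrite divr_gt0.
have [r r0 Hr] := fd _ e20; have [s s0 Hs] := gd _ e20.
exists (Num.min r s) => [|h]; first by rewrite lt_min r0.
rewrite le_min => /andP[/Hr h1 /Hs h2].
have -> : f (z + h) + g (z + h) - (f z + g z) - h * (d + d') =
  (f (z + h) - f z - h * d) + (g (z + h) - g z - h * d') by ring.
by rewrite (le_trans (normcD _ _)) // [e]splitr mulrDl lerD.
Qed.

Lemma entire_affine f a b : entire f -> entire (fun t => f (a + b * t)).
Proof.
move=> ef; apply: (@cdiff_entire R _ (fun t => b * derive1 f (a + b * t))) => z.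
exact: cdiff_affine (entire_cdiff1 _ ef).
Qed.

Lemma entireZ f a : entire f -> entire (fun t => a * f t).
Proof.
move=> ef; apply: (@cdiff_entire R _ (fun t => a * derive1 f t)) => z.
exact: cdiff_scale (entire_cdiff1 _ ef).
Qed.

Lemma entireD f g : entire f -> entire g -> entire (fun t => f t + g t).
Proof.
move=> ef eg; apply: (@cdiff_entire R _ (fun t => derive1 f t + derive1 g t)) => z.
exact: cdiffD (entire_cdiff1 z ef) (entire_cdiff1 z eg).
Qed.

Lemma entire_cst a : entire (fun _ : C => a).
Proof. by move=> z; exact: derivable_cst. Qed.

Lemma entireM f g : entire f -> entire g -> entire (fun t => f t * g t).
Proof. by move=> ef eg z; exact: derivableM (ef z) (eg z). Qed.

Lemma entireX f n : entire f -> entire (fun t => f t ^+ n).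
Proof.
move=> ef; elim: n => [|n IH].
  have -> : (fun t => f t ^+ 0) = (fun=> 1) by apply/funext => t; rewrite expr0.
  exact: entire_cst.
have -> : (fun t => f t ^+ n.+1) = (fun t => f t * f t ^+ n).
  by apply/funext => t; rewrite exprS.
exact: entireM ef IH.
Qed.

Lemma entire_sum (I : Type) (s : seq I) (F : I -> C -> C) :
  (forall i, entire (F i)) -> entire (fun t => \sum_(i <- s) F i t).
Proof.
move=> eF; elim: s => [|i s IH].
  have -> : (fun t => \sum_(i <- [::]) F i t) = (fun=> 0).
    by apply/funext => t; rewrite big_nil.
  exact: entire_cst.
have -> : (fun t => \sum_(j <- i :: s) F j t) = (fun t => F i t + \sum_(j <- s) F j t).
  by apply/funext => t; rewrite big_cons.
exact: entireD (eF i) IH.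
Qed.

Lemma entireB f g : entire f -> entire g -> entire (fun t => f t - g t).
Proof.
move=> ef eg; have := entireD ef (entireZ (a := -1) eg).
have -> // : (fun t => f t - g t) = (fun t => f t + -1 * g t).
by apply/funext => t; rewrite mulN1r.
Qed.

Lemma derive1D f g : entire f -> entire g ->
  derive1 (fun t => f t + g t) = fun t => derive1 f t + derive1 g t.
Proof.
move=> ef eg; apply: cdiff_derive1 => z.
exact: cdiffD (entire_cdiff1 z ef) (entire_cdiff1 z eg).
Qed.

Lemma derive1Z f a : entire f -> derive1 (fun t => a * f t) = fun t => a * derive1 f t.
Proof. by move=> ef; apply: cdiff_derive1 => z; exact: cdiff_scale (entire_cdiff1 _ ef). Qed.

Lemma derive1_affine f a b : entire f ->
  derive1 (fun t => f (a + b * t)) = fun t => b * derive1 f (a + b * t).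
Proof. by move=> ef; apply: cdiff_derive1 => z; exact: cdiff_affine (entire_cdiff1 _ ef). Qed.

Lemma derive1nD f g k : entire f -> entire g ->
  derive1n k (fun t => f t + g t) = fun t => derive1n k f t + derive1n k g t.
Proof.
move=> ef eg; elim: k => [//|k IH].
by rewrite derive1nS IH (derive1D (entire_derive1n (k := k) ef) (entire_derive1n (k := k) eg)).
Qed.

Lemma derive1nZ f a k : entire f ->
  derive1n k (fun t => a * f t) = fun t => a * derive1n k f t.
Proof.
move=> ef; elim: k => [//|k IH].
by rewrite derive1nS IH (derive1Z a (entire_derive1n (k := k) ef)).
Qed.

Lemma derive1n_affine f a b k : entire f ->
  derive1n k (fun t => f (a + b * t)) = fun t => b ^+ k * derive1n k f (a + b * t).
Proof.
move=> ef; elim: k => [|k IH]; first by apply/funext => t; rewrite mul1r.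
have edf := entire_derive1n (k := k) ef.
rewrite derive1nS IH derive1Z; last exact: entire_affine.
by rewrite derive1_affine //; apply/funext => t; rewrite exprSr mulrA.
Qed.

End EntireCalculus.

Section Exponential.
Variable R : realType.
Notation C := (R[i] : numClosedFieldType).
Implicit Types (z w : C) (a : R).

Definition exp_poly n : {poly R[i]} := \poly_(k < n) k`!%:R^-1.

Lemma horner_exp_poly n z : (exp_poly n).[z] = series (fun k => z ^+ k / k`!%:R) n.
Proof.
rewrite horner_poly /series /= big_mkord.
by apply: eq_bigr => k _; rewrite mulrC.
Qed.

Lemma real_exp_series (x e : R) : 0 < e -> exists N, forall n, (N <= n)%N ->
  `|series (exp_coeff x) n - expR x| <= e.
Proof.
move=> e0; have /cvgrPdist_le /(_ e e0) [N _ HN] := @is_cvg_series_exp_coeff R x.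
by exists N => n Nn; rewrite distrC; exact: HN.
Qed.

(** On the disc of radius r the tails are dominated by those of the real exponential series at r. *)
Lemma pcvg_cexp : pcvg exp_poly (@cexp C).
Proof.
have [f Hf] : exists f, pcvg exp_poly f.
  apply: cauchy_discs => r' e e0.
  pose r := Num.max r' 0; have r0 : 0 <= r by rewrite le_max lexx orbT.
  have e20 : 0 < e / 2 by rewrite divr_gt0.
  have [N HN] := real_exp_series r e20.
  suff H m n z : (N <= m)%N -> (m <= n)%N -> normc z <= r ->
      normc ((exp_poly n).[z] - (exp_poly m).[z]) <= e.
    exists N => m n Nm Nn z zr; have zr' : normc z <= r by rewrite le_max zr.
    have [mn|/ltnW nm] := leqP m n; last exact: H.
    by rewrite normc_distC; exact: H.
  move=> Nm mn zr; rewrite !horner_exp_poly sub_series_geq //.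
  rewrite (le_trans (normc_sum _ _ _)) //.
  rewrite (@le_trans _ _ (\sum_(m <= k < n) exp_coeff r k)) //.
    apply: ler_sum => k _; rewrite normcM normcV normc_nat normcX.
    by rewrite ler_pM2r ?invr_gt0 ?ltr0n ?fact_gt0 // lerXn2r ?nnegrE ?normc_ge0.
  rewrite -sub_series_geq // (le_trans (ler_norm _)) //.
  have := HN m Nm; have := HN n (leq_trans Nm mn).
  rewrite [`|series _ m - _|]distrC => h1 h2.
  rewrite -(subrK (expR r) (series _ n)) -addrA (le_trans (ler_normD _ _)) //.
  by rewrite [e]splitr lerD.
suff -> : @cexp C = f by [].
apply/funext => z; apply: limn_normc => e e0; have [N HN] := Hf (normc z) e e0.
by exists N => n Nn; rewrite -horner_exp_poly; exact: HN.
Qed.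

Lemma entire_cexp : entire (@cexp C).
Proof. exact: pcvg_entire pcvg_cexp. Qed.

Lemma deriv_exp_poly n : deriv (exp_poly n) = exp_poly n.-1.
Proof.
apply/polyP => i; rewrite coef_deriv !coef_poly.
have -> : (i.+1 < n)%N = (i < n.-1)%N by case: n.
case: ifP => _; last by rewrite mul0rn.
by rewrite -[_ *+ i.+1]mulr_natl factS natrM invfM mulrA divff ?mul1r //.
Qed.

Lemma derive1_cexp : derive1 (@cexp C) = @cexp C.
Proof.
apply: (cvg_discs_unique (pcvg_derive1 pcvg_cexp)) => r e e0.
have [N HN] := pcvg_cexp r e0; exists N.+1 => -[//|n] Nn z zr.
by rewrite deriv_exp_poly; exact: HN.
Qed.

Lemma derive1n_cexp k : derive1n k (@cexp C) = @cexp C.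
Proof. by elim: k => [//|k IH]; rewrite derive1nS IH derive1_cexp. Qed.

Lemma cexp_scaleE (l : C) : (fun z : C => cexp (l * z)) = (fun z => cexp (0 + l * z)).
Proof. by apply/funext => z; congr cexp; rewrite add0r. Qed.

Lemma entire_cexp_scale (l : C) : entire (fun z : C => cexp (l * z)).
Proof. by rewrite cexp_scaleE; exact: (@entire_affine R (@cexp C) 0 l entire_cexp). Qed.

Lemma derive1n_cexp_scale (l : C) k :
  derive1n k (fun z : C => cexp (l * z)) = fun z => l ^+ k * cexp (l * z).
Proof.
rewrite cexp_scaleE (@derive1n_affine R (@cexp C) 0 l k entire_cexp).
apply/funext => z; rewrite (congr1 (fun f => f (0 + l * z)) (derive1n_cexp k)).
by rewrite [0 + l * z]add0r.
Qed.

Lemma limit_unique (u : nat -> C) l l' :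
  (forall e : R, 0 < e -> exists N, forall n, (N <= n)%N -> normc (u n - l) <= e) ->
  (forall e : R, 0 < e -> exists N, forall n, (N <= n)%N -> normc (u n - l') <= e) ->
  l = l'.
Proof. by move=> /limn_normc <- /limn_normc <-. Qed.

Lemma cexp_series z (e : R) : 0 < e -> exists N, forall n, (N <= n)%N ->
  normc (\sum_(k < n) z ^+ k / k`!%:R - cexp z) <= e.
Proof.
move=> e0; have [N HN] := pcvg_cexp (normc z) e0; exists N => n /HN /(_ z (lexx _)).
by rewrite horner_exp_poly /series /= big_mkord.
Qed.

Lemma cexp0 : cexp (0 : C) = 1.
Proof.
apply: (limit_unique (cexp_series 0)) => e e0; exists 1%N => -[//|n] _.
rewrite big_ord_recl /= expr0 fact0 divr1 big1 ?addr0 ?subrr ?normc0 1?ltW //.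
by move=> k _; rewrite exprS mul0r mul0r.
Qed.

(** The Taylor series of t |-> exp(z + w t) at 0, taken at t = 1, is exp(z) times the series of
    exp(w). *)
Lemma cexpD z w : cexp (z + w) = cexp z * cexp w.
Proof.
apply: (@limit_unique (fun n => cexp z * \sum_(k < n) w ^+ k / k`!%:R)) => e e0.
  have [N HN] := taylor_cvg 0 (entire_affine (a := z) (b := w) (@entire_cexp)) e0.
  exists N => n /HN; rewrite add0r mulr1 mulr_sumr => H; apply: le_trans H.
  rewrite le_eqVlt; apply/orP; left; apply/eqP; congr (normc (_ - _)).
  apply: eq_bigr => k _; rewrite derive1n_affine; last exact: entire_cexp.
  by rewrite derive1n_cexp mulr0 addr0 mulrCA mulrA.
pose K := normc (cexp z) + 1; have K0 : 0 < K by rewrite ltr_wpDl ?normc_ge0.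
have eK : 0 < e / K by rewrite divr_gt0.
have [N HN] := cexp_series w eK; exists N => n /HN.
rewrite -mulrBr normcM ler_pdivlMr // mulrC => H; apply: le_trans H.
by rewrite ler_wpM2r ?normc_ge0 // lerDl.
Qed.

Lemma cexp_sum (I : Type) (s : seq I) (F : I -> C) :
  cexp (\sum_(i <- s) F i) = \prod_(i <- s) cexp (F i).
Proof.
by elim: s => [|i s IH]; rewrite ?big_nil ?cexp0 // !big_cons cexpD IH.
Qed.

Lemma cexpMn z n : cexp (n%:R * z) = cexp z ^+ n.
Proof.
elim: n => [|n IH]; first by rewrite mul0r cexp0.
by rewrite -[n.+1%:R]natr1 mulrDl mul1r cexpD IH exprSr.
Qed.

Lemma cexp_real a : cexp (a%:C%C : C) = (expR a)%:C%C.
Proof.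
apply: (limit_unique (cexp_series _)) => e e0; have [N HN] := real_exp_series a e0.
exists N => n /HN; rewrite /series /= big_mkord => H; apply: le_trans H.
rewrite -normc_real le_eqVlt; apply/orP; left; apply/eqP; congr normc.
rewrite rmorphB rmorph_sum /=; congr (_ - _); apply: eq_bigr => k _.
by rewrite /exp_coeff rmorphM fmorphV rmorphXn rmorph_nat.
Qed.

Lemma cexp_conj z : cexp (z^*)%C = ((cexp z : R[i])^*)%C.
Proof.
apply: (limit_unique (cexp_series _)) => e e0; have [N HN] := cexp_series z e0.
exists N => n /HN H; apply: le_trans H.
have NJ (x : R[i]) : normc (x^*)%C = normc x by case: x => x y /=; rewrite sqrrN.
rewrite -[X in _ <= X]NJ le_eqVlt; apply/orP; left; apply/eqP; congr normc.
rewrite rmorphB rmorph_sum /=; congr (_ - _); apply: eq_bigr => k _.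
by rewrite rmorphM fmorphV rmorphXn rmorph_nat.
Qed.

(** The square of the modulus is exp(z) times exp of the conjugate, that is exp(2 Re z). *)
Lemma normc_cexp z : normc (cexp z : R[i]) = expR (complex.Re z).
Proof.
have sq (x : R[i]) : (normc x ^+ 2)%:C%C = x * (x^*)%C.
  by rewrite -sqr_normc norm_normc rmorphXn.
apply/eqP; rewrite -(eqrXn2 (n := 2)) ?normc_ge0 ?expR_ge0 //; apply/eqP/complexI.
rewrite sq -cexp_conj -cexpD addcJ cexpMn cexp_real rmorphXn.
by [].
Qed.

End Exponential.

(** * The operator phi(D) *)

Section Operator.
Variables (R : realType) (P : {poly R[i]}).
Notation C := (R[i] : numClosedFieldType).
Implicit Types (f : C -> C) (z : C) (r e : R).

Definition symbol : C -> C := fun z => P.[z] * cexp z.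

Lemma pcvg_symbol : pcvg (fun n => P * exp_poly R n) symbol.
Proof.
move=> r e e0; have [M M0 HM] := poly_bounded_disc P r.
have M1 : 0 < M + 1 by rewrite ltr_wpDl.
have eM : 0 < e / (M + 1) by rewrite divr_gt0.
have [N HN] := pcvg_cexp r eM; exists N => n /HN H z zr.
rewrite hornerM -mulrBr normcM; have := H z zr.
rewrite ler_pdivlMr // mulrC => H'; apply: le_trans H'.
by rewrite ler_wpM2r ?normc_ge0 // (le_trans (HM z zr)) // lerDl.
Qed.

(** The n-th derivative at 0 of [P * exp_poly m] is the same for all m > n, so it equals its limit,
    the derivative of [symbol]. *)
Lemma taylor_coef_symbol n : taylor_coef symbol n =
  \sum_(j < size P) if (j <= n)%N then P`_j / (n - j)`!%:R else 0.
Proof.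
have nf : n`!%:R != 0 :> C by rewrite pnatr_eq0 -lt0n fact_gt0.
have E : derive1n n symbol 0 = (P * exp_poly R n.+1)`_n *+ n`!.
  apply: (@limit_unique R (fun m => (derivn n (P * exp_poly R m)).[0])) => e e0.
    by have [N HN] := pcvg_derive1n n pcvg_symbol 0 e0; exists N => m /HN; apply; rewrite normc0.
  exists n.+1 => m nm; rewrite horner_coef0 coef_derivn addn0 ffactnn.
  rewrite (_ : (P * exp_poly R m)`_n = (P * exp_poly R n.+1)`_n) ?subrr ?normc0 1?ltW //.
  rewrite !coefM; apply: eq_bigr => k _; rewrite !coef_poly ltnS leq_subr.
  by rewrite (leq_trans _ nm) // ltnS leq_subr.
rewrite /taylor_coef E -[(P * _)`_n *+ _]mulr_natr mulfK // -[P in P * _]coefK poly_def mulr_suml coef_sum.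
apply: eq_bigr => j _; rewrite -scalerAl coefZ coefXnM.
case: (leqP j n) => jn; last by rewrite mulr0.
by rewrite coef_poly ltnS leq_subr.
Qed.

Definition expD f : C -> C :=
  fun z => \sum_(j < size P) P`_j * derive1n j f (z + 1).

Lemma phiDE f : entire f -> phiD symbol f = expD f.
Proof.
move=> ef; apply/funext => z; apply: limn_normc => e e0.
pose S n j := \sum_(k < n) derive1n k (derive1n j f) z / k`!%:R.
have E n : series (fun n => taylor_coef symbol n * derive1n n f z) n =
    \sum_(j < size P) P`_j * S (n - j)%N j.
  rewrite /series /= big_mkord; elim: n => [|n IH].
    by rewrite big_ord0 big1 // => j _; rewrite sub0n /S big_ord0 mulr0.
  rewrite big_ord_recr /= IH taylor_coef_symbol mulr_suml -big_split.
  apply: eq_bigr => j _ /=; case: leqP => jn; last first.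
    have [-> ->] : (n - j = 0 /\ n.+1 - j = 0)%N by lia.
    by rewrite mul0r addr0.
  rewrite subSn // /S big_ord_recr /= mulrDr; congr (_ + _).
  by rewrite /derive1n -iterD subnK // mulrAC -mulrA.
pose K := \sum_(j < size P) normc P`_j + 1.
have K0 : 0 < K by rewrite ltr_wpDl // sumr_ge0 // => j _; exact: normc_ge0.
have eK : 0 < e / K by rewrite divr_gt0.
have [j _|N HN] := @uniform_threshold _ (iota 0 (size P))
    (fun j n => normc (S (n - j)%N j - derive1n j f (z + 1)) <= e / K).
  have [N HN] := taylor_cvg z (entire_derive1n (k := j) ef) eK.
  by exists (N + j)%N => n le_n; apply: HN; rewrite leq_subRL; lia.
exists N => n Nn; rewrite E /expD -sumrB.
apply: (@le_trans _ _ (\sum_(j < size P) normc P`_j * (e / K))).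
  rewrite (le_trans (normc_sum _ _ _)) //; apply: ler_sum => j _.
  rewrite -mulrBr normcM ler_wpM2l ?normc_ge0 //.
  by apply: HN => //; rewrite mem_iota add0n ltn_ord.
rewrite -mulr_suml mulrA ler_pdivrMr // mulrC ler_pM2l //.
by rewrite lerDl.
Qed.

Lemma entire_expD f : entire f -> entire (expD f).
Proof.
move=> ef; apply: entire_sum => j; apply: entireZ.
have := entire_affine (a := 1) (b := 1) (entire_derive1n (k := j) ef).
have -> // : (fun t => derive1n j f (1 + 1 * t)) = (fun t => derive1n j f (t + 1)).
by apply/funext => t; rewrite mul1r addrC.
Qed.

Lemma expD_linear f g a b : entire f -> entire g ->
  expD (fun z => a * f z + b * g z) = fun z => a * expD f z + b * expD g z.
Proof.
move=> ef eg; apply/funext => z; rewrite /expD !mulr_sumr -big_split.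
apply: eq_bigr => j _ /=.
rewrite (@derive1nD R (fun z => a * f z) (fun z => b * g z) j (entireZ ef) (entireZ eg)).
rewrite (@derive1nZ R f a j ef) (@derive1nZ R g b j eg).
by ring.
Qed.

Lemma expD_exp (l : C) : expD (fun z => cexp (l * z)) = fun z => symbol l * cexp (l * z).
Proof.
apply/funext => z; rewrite /expD /symbol horner_coef.
rewrite !mulr_suml; apply: eq_bigr => j _.
have -> : derive1n j (fun t : C => cexp (l * t)) (z + 1) = l ^+ j * (cexp (l * z) * cexp l).
  by rewrite (congr1 (fun f => f (z + 1)) (derive1n_cexp_scale l j)) mulrDr mulr1 -cexpD.
by rewrite [cexp (l * z) * _]mulrC !mulrA.
Qed.

Lemma expD_continuous : exists2 K, 0 <= K & forall f r e, entire f -> 0 <= e ->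
  (forall z, normc z <= r + 2 -> normc (f z) <= e) ->
  forall z, normc z <= r -> normc (expD f z) <= K * e.
Proof.
(* Cauchy's estimate on unit circles around z + 1; the margin 2 in the radius is 1 for the
   translation and 1 for these circles. *)
exists (\sum_(j < size P) normc P`_j * j`!%:R).
  by apply: sumr_ge0 => j _; rewrite mulr_ge0 ?normc_ge0.
move=> f r e ef e0 fe z zr; rewrite mulr_suml (le_trans (normc_sum _ _ _)) //.
apply: ler_sum => j _; rewrite normcM -mulrA ler_wpM2l ?normc_ge0 //.
have := @normc_derive1n_le R f (z + 1) 1 e j ef ltr01.
rewrite expr1n mulr1; apply=> w wz; apply: fe.
rewrite -(subrK (z + 1) w) (le_trans (normcD _ _)) //.
have := normcD z 1; rewrite normc1; lra.
Qed.

End Operator.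

(** * Growth of the symbol *)

Section LogConvexity.
Variable R : realType.
Implicit Types (t h D e : R).

Lemma expR_le_inv s : s < 1 -> expR s <= (1 - s)^-1 :> R.
Proof.
move=> s1; have := expR_ge1Dx (- s); rewrite expRN => H.
by rewrite -[leLHS]invrK lef_pV2 ?posrE ?invr_gt0 ?expR_gt0 //; lra.
Qed.

(** The function ln(x^2 + h^2) stays above its tangent at t by at least e^2 / (2D). With exp(s) <= 1
    / (1 - s) this becomes the polynomial inequality [key], true because h is large against b. *)
Lemma sqr_dist_ge_expR (b h t e D : R) : D = t ^+ 2 + h ^+ 2 -> 0 <= b -> 4 * (2 * b + 1) ^+ 2 <= h ^+ 2 ->
  `|t| <= b -> `|e| <= 1 ->
  D * expR (2 * t * e / D + e ^+ 2 / (2 * D)) <= (t + e) ^+ 2 + h ^+ 2.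
Proof.
move=> DE b0 hb tb e1.
have t2 := sqr_ge0 t.
have b2 : 1 <= (2 * b + 1) ^+ 2 by rewrite exprn_ege1 //; lra.
have hD : 4 * (2 * b + 1) ^+ 2 <= D by rewrite DE; lra.
have D0 : 0 < D by lra.
have /andP[tb1 tb2] : - b <= t <= b by rewrite -ler_norml.
have /andP[e11 e12] : - 1 <= e <= 1 by rewrite -ler_norml.
pose s := 2 * t * e / D + e ^+ 2 / (2 * D).
have sD : s * D = 2 * t * e + e ^+ 2 / 2 by rewrite /s; field; rewrite gt_eqF.
have s1 : s < 1.
  rewrite -(ltr_pM2r D0) sD mul1r.
  have : `|t * e| <= b by rewrite normrM (le_trans (ler_pM _ _ tb e1)) ?mulr1.
  rewrite ler_norml => /andP[_ te].
  have : e ^+ 2 <= 1 by rewrite -real_normK ?num_real // exprn_ile1.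
  nra.
have key : 0 <= e ^+ 2 * (D / 2 - (2 * t + e) * (2 * t + e / 2)).
  apply: mulr_ge0; first exact: sqr_ge0.
  have h1 : `|2 * t + e| <= 2 * b + 1 by apply/ler_normlP; split; lra.
  have h2 : `|2 * t + e / 2| <= 2 * b + 1 by apply/ler_normlP; split; lra.
  have := ler_norm ((2 * t + e) * (2 * t + e / 2)); rewrite normrM.
  have := ler_pM (normr_ge0 _) (normr_ge0 _) h1 h2; rewrite -expr2.
  lra.
have E : (t + e) ^+ 2 + h ^+ 2 = D + (2 * t * e + e ^+ 2) by rewrite DE; ring.
rewrite E -/s (le_trans (ler_wpM2l (ltW D0) (expR_le_inv s1))) //.
rewrite ler_pdivrMr ?subr_gt0 // -(ler_pM2r D0).
have -> : (D + (2 * t * e + e ^+ 2)) * (1 - s) * D =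
  (D + (2 * t * e + e ^+ 2)) * (D - s * D) by ring.
rewrite sD -subr_ge0.
have -> : (D + (2 * t * e + e ^+ 2)) * (D - (2 * t * e + e ^+ 2 / 2)) - D * D =
   e ^+ 2 * (D / 2 - (2 * t + e) * (2 * t + e / 2)) by field.
exact: key.
Qed.

(* Strict convexity of [x |-> ln |x + i h|] for [|x|] small compared with [h]. *)
Lemma prod_dist_gt (m : nat) (b h : R) (x : 'I_m -> R) : 0 <= b ->
  4 * (2 * b + 1) ^+ 2 <= h ^+ 2 ->
  (forall i, `|x i| <= b) -> (forall i j, `|x i - x j| <= 1) ->
  (exists i j, x i != x j) ->
  normc (Complex ((\sum_i x i) / m%:R) h) ^+ m < \prod_i normc (Complex (x i) h).
Proof.
move=> b0 hb xb xx [i0 [j0 xij]].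
have m0 : 0 < m%:R :> R by rewrite ltr0n (leq_ltn_trans (leq0n i0) (ltn_ord i0)).
set t := (\sum_i x i) / m%:R.
have tm : t * m%:R = \sum_i x i by rewrite divfK // gt_eqF.
have tb : `|t| <= b.
  rewrite normrM [`|_^-1|]ger0_norm ?invr_ge0 ?(ltW m0) // ler_pdivrMr //.
  rewrite (le_trans (ler_norm_sum _ _ _)) // mulr_natr.
  rewrite -[in leRHS](card_ord m) -sumr_const.
  by apply: ler_sum.
have xt i : `|x i - t| <= 1.
  rewrite -(ler_pM2r m0) mul1r -[m%:R in leLHS](ger0_norm (ltW m0)) -normrM mulrBl tm.
  have -> : x i * m%:R = \sum_(j < m) x i by rewrite sumr_const card_ord mulr_natr.
  rewrite -sumrB (le_trans (ler_norm_sum _ _ _)) //.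
  rewrite -[in leRHS](card_ord m) -sumr_const.
  by apply: ler_sum.
pose D := t ^+ 2 + h ^+ 2.
have D0 : 0 < D.
  have : 0 < h ^+ 2 by apply: lt_le_trans hb; rewrite mulr_gt0 // exprn_gt0 //; lra.
  by have := sqr_ge0 t; rewrite /D; lra.
have nE (y : R) : normc (Complex y h) ^+ 2 = y ^+ 2 + h ^+ 2 by rewrite normc_sqr.
pose s i := 2 * t * (x i - t) / D + (x i - t) ^+ 2 / (2 * D).
have n0 (y : R) : 0 <= normc (Complex y h) := normc_ge0 _.
rewrite -(ltr_pXn2r (n := 2)) ?nnegrE ?exprn_ge0 ?prodr_ge0 //.
rewrite exprAC nE -/D -prodrXl.
have le i : D * expR (s i) <= normc (Complex (x i) h) ^+ 2.
  by have := sqr_dist_ge_expR (erefl D) b0 hb tb (xt i); rewrite -/(s i) nE subrKC.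
apply: (@lt_le_trans _ _ (\prod_i (D * expR (s i)))); last first.
  by apply: ler_prod => i _; rewrite le andbT mulr_ge0 ?expR_ge0 // ltW.
rewrite big_split /= prodr_const card_ord -expR_sum ltr_pMr ?exprn_gt0 //.
(* The tangent terms cancel since [t] is the mean of the [x i]; the squares remain, and one of them
   is nonzero. *)
rewrite expR_gt1 /s big_split /= -!mulr_suml -mulr_sumr sumrB.
have -> : \sum_(i < m) t = t * m%:R by rewrite sumr_const card_ord mulr_natr.
rewrite tm subrr mulr0 mul0r add0r divr_gt0 ?mulr_gt0 //.
have [k xk] : exists k, x k != t.
  by have [xi|xi] := eqVneq (x i0) t; [exists j0; rewrite -xi eq_sym | exists i0].
rewrite (bigD1 k) //= ltr_wpDr //; first by apply: sumr_ge0 => i _; exact: sqr_ge0.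
by rewrite exprn_even_gt0 //= subr_eq0.
Qed.

End LogConvexity.

(** * Comparison of values of the symbol *)

Section SymbolGrowth.
Variables (R : realType) (P : {poly R[i]}).
Notation C := (R[i] : numClosedFieldType).
Hypothesis hP : (1 < size P)%N.
Implicit Types (z : R[i]) (y : R).

Lemma poly_factorization : exists (c : R[i]) (rs : seq R[i]) (A : R),
  [/\ 0 < normc c, (0 < size rs)%N, 0 <= A, (forall a, a \in rs -> normc a <= A) &
   forall z, P.[z] = c * \prod_(a <- rs) (z - a)].
Proof.
have [rs Prs] := closed_field_poly_normal P.
have P0 : lead_coef P != 0 by rewrite lead_coef_eq0 -size_poly_gt0 ltnW.
have sP : size P = (size rs).+1.
  by rewrite {1}Prs size_scale // (size_prod_XsubC rs id).
exists (lead_coef P), rs, (\sum_(a <- rs) normc a); split.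
- by rewrite normc_gt0.
- by rewrite -ltnS -sP.
- by apply: sumr_ge0 => a _; exact: normc_ge0.
- move=> a ars; rewrite (big_rem a) //= lerDl.
  by apply: sumr_ge0 => b _; exact: normc_ge0.
- move=> z; rewrite {1}Prs hornerZ horner_prod; congr (_ * _).
  by apply: eq_bigr => a _; rewrite hornerXsubC.
Qed.

Lemma normc_symbol z : normc (symbol P z) = normc P.[z] * expR (complex.Re z).
Proof. by rewrite normcM normc_cexp. Qed.

Lemma sum_Complex_div m (x : 'I_m -> R) y k :
  \sum_i Complex (x i) y / k%:R = Complex ((\sum_i x i) / k%:R) (m%:R * y / k%:R) :> R[i].
Proof.
rewrite -mulr_suml.
have -> : \sum_i Complex (x i) y = Complex (\sum_i x i) (m%:R * y) :> R[i].
  apply/eqP; rewrite eq_complex !raddf_sum /= eqxx /=.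
  by rewrite sumr_const card_ord mulr_natl.
rewrite -(rmorph_nat (real_complex R)) -fmorphV.
by apply/eqP; rewrite eq_complex /= !mulr0 subr0 add0r !eqxx.
Qed.

(* The exponential factors of both sides agree. *)
Lemma symbol_lt m k (x : 'I_m -> R) y : (0 < k)%N ->
  let s := \sum_i Complex (x i) y / k%:R in
  normc P.[s] ^+ k < \prod_i normc P.[Complex (x i) y] ->
  normc (symbol P s) ^+ k < \prod_i normc (symbol P (Complex (x i) y)).
Proof.
move=> k0 s H; have kR : k%:R != 0 :> R by rewrite pnatr_eq0 -lt0n.
have -> : normc (symbol P s) ^+ k = normc P.[s] ^+ k * expR (complex.Re s) ^+ k.
  by move: s {H} => z; rewrite -exprMn; congr (_ ^+ k); exact: normc_symbol.
rewrite (eq_bigr _ (fun i _ => normc_symbol (Complex (x i) y))).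
rewrite big_split /= -expR_sum -expRM_natl.
have -> : complex.Re s = (\sum_i x i) / k%:R by rewrite /s sum_Complex_div.
by rewrite [k%:R * _]mulrC divfK // ltr_pM2r ?expR_gt0.
Qed.

(** Each root of P contributes a strict inequality between distances, and there is at least one root
    because P is not constant. *)
Lemma symbol_average_lt : exists Y, forall y, Y <= y -> forall m (x : 'I_m -> R),
  (forall i, 0 <= x i <= 1) -> (exists i j, x i != x j) ->
  normc (symbol P (\sum_i Complex (x i) y / m%:R)) ^+ m <
  \prod_i normc (symbol P (Complex (x i) y)).
Proof.
have [c [rs [A [c0 rs0 A0 rsA PE]]]] := poly_factorization.
(* Seen from a root [a], the points have abscissas bounded by b = 1 + A and height at least y - A,
   and [prod_dist_gt] needs the height 2 (2b + 1) = 4A + 6. *)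
exists (5 * A + 6) => y yY m x x01 xx.
have m0 : (0 < m)%N by case: xx => i _; exact: leq_ltn_trans (leq0n i) (ltn_ord i).
apply: symbol_lt => //; rewrite PE normcM exprMn normc_prod -prodrXl.
rewrite [ltRHS](eq_bigr (fun i => normc c * \prod_(a <- rs) normc (Complex (x i) y - a))).
  2: by move=> i _; rewrite PE normcM normc_prod.
rewrite big_split /= prodr_const card_ord ltr_pM2l ?exprn_gt0 // exchange_big /=.
rewrite big_seq [ltRHS]big_seq; apply: ltr_prod.
  by apply/hasP; case: (rs) rs0 => // a s _; exists a; rewrite mem_head.
move=> a ars; rewrite exprn_ge0 ?normc_ge0 //= sum_Complex_div.
have aA := rsA a ars.
have Rea := le_trans (ler_Re_normc a) aA.
have Ima := le_trans (ler_Im_normc a) aA.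
have mR : m%:R != 0 :> R by rewrite pnatr_eq0 -lt0n.
have := @prod_dist_gt R m (1 + A) (y - complex.Im a) (fun i => x i - complex.Re a).
have -> : Complex ((\sum_i (x i - complex.Re a)) / m%:R) (y - complex.Im a) =
    Complex ((\sum_i x i) / m%:R) (m%:R * y / m%:R) - a.
  rewrite sumrB sumr_const card_ord mulrBl -[complex.Re a *+ m]mulr_natr mulfK // [m%:R * y]mulrC mulfK //.
  by case: (a).
have EI i : Complex (x i - complex.Re a) (y - complex.Im a) = Complex (x i) y - a.
  by case: (a).
under eq_bigr do rewrite EI.
apply.
- by rewrite addr_ge0.
- move: Ima; rewrite ler_norml => /andP[i1 i2].
  have -> : 4 * (2 * (1 + A) + 1) ^+ 2 = (2 * (2 * (1 + A) + 1)) ^+ 2 by ring.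
  by rewrite lerXn2r ?nnegrE //; lra.
- move=> i; have /andP[x0 x1] := x01 i; move: Rea; rewrite ler_norml => /andP[r1 r2].
  apply/ler_normlP; split; lra.
- move=> i j; have /andP[x0 x1] := x01 i; have /andP[x0' x1'] := x01 j.
  apply/ler_normlP; split; lra.
- by case: xx => i [j ij]; exists i, j; rewrite (inj_eq (addIr _)).
Qed.

Lemma normc_line_sub (A x y : R) (a : R[i]) : normc a <= A -> y - A <= normc (Complex x y - a).
Proof.
move=> aA.
have yn : y <= normc (Complex x y) := le_trans (ler_norm y) (ler_Im_normc (Complex x y)).
have := ler_normcB_dist (Complex x y) a; lra.
Qed.

Lemma poly_line_ge (X : R) : exists Y, forall y, Y <= y -> forall x,
  X <= normc P.[Complex x y].
Proof.
have [c [rs [A [c0 rs0 A0 rsA PE]]]] := poly_factorization.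
(* Then y - A is at least 1, so that its powers dominate it, and at least |X| / |c|. *)
exists (A + 1 + `|X| / normc c) => y yY x.
have Xc : 0 <= `|X| / normc c by rewrite divr_ge0 // normc_ge0.
rewrite PE normcM normc_prod.
have h1 : (y - A) ^+ size rs <= \prod_(a <- rs) normc (Complex x y - a).
  have -> : (y - A) ^+ size rs = \prod_(a <- rs) (y - A).
    by rewrite big_const_seq count_predT iter_mulr_1.
  rewrite big_seq [leRHS]big_seq; apply: ler_prod => a ars.
  by rewrite normc_line_sub ?rsA // andbT; lra.
have h2 : y - A <= (y - A) ^+ size rs.
  by case: (size rs) rs0 => // n _; rewrite exprS ler_peMr ?exprn_ege1 //; lra.
rewrite (le_trans (ler_norm _)) // mulrC -ler_pdivrMr //.
apply: le_trans (le_trans h2 h1); lra.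
Qed.

(** Root by root: for y >= 1 + 2A the point of the line is at distance at least y / 2 from the root,
    and [s] at distance at most 3My. *)
Lemma poly_comparable (M : nat) : (0 < M)%N ->
  exists (Y B : R), 1 <= B /\ forall y, Y <= y -> forall x (s : R[i]),
  normc s <= M%:R * (y + 1) -> normc P.[s] <= B * normc P.[Complex x y].
Proof.
move=> M0; have [c [rs [A [c0 rs0 A0 rsA PE]]]] := poly_factorization.
have M1 : 1 <= M%:R :> R by rewrite ler1n.
exists (1 + 2 * A), ((6 * M%:R) ^+ size rs); split.
  by rewrite exprn_ege1 //; lra.
move=> y yY x s sM; rewrite !PE !normcM !normc_prod mulrCA ler_pM2l //.
have -> : (6 * M%:R) ^+ size rs = \prod_(a <- rs) (6 * M%:R) :> R.
  by rewrite big_const_seq count_predT iter_mulr_1.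
rewrite -big_split /= big_seq [leRHS]big_seq; apply: ler_prod => a ars.
rewrite normc_ge0 /=; have aA := rsA a ars.
have h1 := normcB s a; have h2 := @normc_line_sub A x y a aA.
apply: (@le_trans _ _ (6 * M%:R * (y / 2))); first by nra.
by rewrite ler_pM2l; lra.
Qed.

Lemma symbol_line_gt1 : exists Y, forall y, Y <= y -> forall x, 0 <= x ->
  1 < normc (symbol P (Complex x y)).
Proof.
have [Y HY] := poly_line_ge 2; exists Y => y yY x x0.
rewrite [normc _]normc_symbol (@lt_le_trans _ _ (2 * 1)) //; first by rewrite mulr1 ltr1n.
by apply: ler_pM; rewrite ?HY // -expR0 ler_expR.
Qed.

(* The exponential factors again cancel, and [|P|] at the sum is at most [B]
   times its values at the points, all of which exceed [B ^ M]. *)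
Lemma symbol_sum_lt (M : nat) : exists Y, forall y, Y <= y ->
  forall k m (x : 'I_m -> R), (0 < k < m)%N -> (m <= M)%N ->
  (forall i, 0 <= x i <= 1) ->
  normc (symbol P (\sum_i Complex (x i) y / k%:R)) ^+ k <
  \prod_i normc (symbol P (Complex (x i) y)).
Proof.
have [Y1 [B [B1 H1]]] := poly_comparable (ltn0Sn M).
have [Y2 H2] := poly_line_ge (B ^+ M + 1).
exists (Num.max 0 (Num.max Y1 Y2)) => y; rewrite !ge_max => /and3P[y0 yY1 yY2] k m x.
move=> /andP[k0 km] mM x01; apply: symbol_lt => //.
set s := \sum_i _.
have sM : normc s <= M.+1%:R * (y + 1).
  rewrite (le_trans (normc_sum _ _ _)) // (@le_trans _ _ (\sum_(i < m) (y + 1))) //.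
    apply: ler_sum => i _; rewrite normcM normcV normc_nat.
    have ky : 1 <= k%:R :> R by rewrite ler1n.
    rewrite ler_pdivrMr ?ltr0n // (le_trans (normc_le_ReIm _)) //=.
    have /andP[a b] := x01 i; rewrite (ger0_norm a) (ger0_norm y0).
    by rewrite (@le_trans _ _ (y + 1)) ?ler_peMr //; lra.
  rewrite sumr_const card_ord -[(y + 1) *+ m]mulr_natl ler_wpM2r ?ler_nat ?(leqW mM) //; lra.
pose X0 := B ^+ M + 1; pose Q := normc P.[s] / B.
have B0 : 0 < B by lra.
(* Every factor on the right is at least [Z], and (B Q)^k <= B^M Z^k < Z^(k+1) <= Z^m because Z >
   B^M. *)
pose Z := Num.max Q X0.
have BM : 1 <= B ^+ M by rewrite exprn_ege1.
have Z1 : 1 <= Z by rewrite le_max; apply/orP; right; rewrite /X0; lra.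
apply: (@lt_le_trans _ _ (Z ^+ m)); last first.
  have -> : Z ^+ m = \prod_(i < m) Z by rewrite prodr_const card_ord.
  apply: ler_prod => i _; apply/andP; split; first by lra.
  by rewrite ge_max ler_pdivrMr // mulrC H1 //= H2.
have -> : normc P.[s] = B * Q by rewrite /Q mulrC divfK // gt_eqF.
have Q0 : 0 <= Q by rewrite divr_ge0 ?normc_ge0 // ltW.
apply: (@lt_le_trans _ _ (Z ^+ k.+1)); last by rewrite ler_weXn2l.
rewrite exprMn exprS.
apply: (@le_lt_trans _ _ (B ^+ M * Z ^+ k)).
  apply: ler_pM.
  - by rewrite exprn_ge0 // ltW.
  - by rewrite exprn_ge0.
  - by rewrite ler_weXn2l // (leq_trans (ltnW km)).
  - by rewrite lerXn2r ?nnegrE // ?le_max ?lexx //; lra.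
rewrite ltr_pM2r; last by rewrite exprn_gt0 //; lra.
by rewrite lt_max; apply/orP; right; rewrite /X0; lra.
Qed.

(** The hypotheses on [z] are those met by a sum of boundedly many frequencies, one of them near -G:
    |P| grows polynomially in G while the exponential decays like exp(-G). *)
Lemma symbol_left_lt1 (K : R) : 0 <= K -> exists G0, forall G, G0 <= G ->
  forall z, complex.Re z <= K - G -> normc z <= K * (G + 1) -> normc (symbol P z) < 1.
Proof.
move=> K0; pose n := size P; pose S := \sum_(i < n) normc P`_i.
have S0 : 0 <= S by apply: sumr_ge0 => i _; exact: normc_ge0.
(* With exp(G) > G^(n+1) / (n+1)!, the claim reduces to T G^n <= G^(n+1). *)
pose T := S * (2 * K + 1) ^+ n * expR K * n.+1`!%:R.
have T0 : 0 <= T by rewrite !mulr_ge0 ?expR_ge0 // exprn_ge0 //; lra.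
exists (T + 1) => G GT z Rz Nz; have G1 : 1 <= G by lra.
rewrite normc_symbol.
have pz : normc P.[z] <= S * ((2 * K + 1) * G) ^+ n.
  rewrite horner_coef (le_trans (normc_sum _ _ _)) // mulr_suml; apply: ler_sum => i _.
  rewrite normcM normcX ler_wpM2l ?normc_ge0 //.
  have u1 : 1 <= (2 * K + 1) * G by nra.
  apply: (@le_trans _ _ (((2 * K + 1) * G) ^+ i)).
    by rewrite lerXn2r ?nnegrE ?normc_ge0 //; nra.
  by rewrite ler_weXn2l // ltnW.
have ez : expR (complex.Re z) <= expR K / expR G.
  by rewrite -expRN -expRD ler_expR.
have eG : G ^+ n.+1 / n.+1`!%:R < expR G.
  by have := @expR_ge1Dxn _ G n ltac:(lra); lra.
apply: le_lt_trans (ler_pM (normc_ge0 _) (expR_ge0 _) pz ez) _.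
rewrite mulrA ltr_pdivrMr ?expR_gt0 // mul1r; apply: le_lt_trans eG.
have f0 : (0 : R) < n.+1`!%:R by rewrite ltr0n fact_gt0.
rewrite ler_pdivlMr // exprMn exprS.
have -> : S * ((2 * K + 1) ^+ n * G ^+ n) * expR K * n.+1`!%:R = T * G ^+ n.
  by rewrite /T; ring.
by rewrite ler_wpM2r ?exprn_ge0 //; lra.
Qed.

End SymbolGrowth.

(** * Density of exponential sums *)

Section ExponentialDensity.
Variable R : realType.
Notation C := (R[i] : numClosedFieldType).
Implicit Types (v : C -> C) (z : C) (r e : R).

Lemma poly_lipschitz (q : {poly R[i]}) r : exists2 K, 0 < K &
  forall x y, normc x <= r -> normc y <= r -> normc (q.[x] - q.[y]) <= K * normc (x - y).
Proof.
exists (1 + \sum_(j < size q) normc q`_j * (j%:R * `|r| ^+ j.-1)).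
  by rewrite ltr_wpDr // sumr_ge0 // => j _; rewrite !mulr_ge0 ?normc_ge0 ?exprn_ge0.
move=> x y xr yr; have rr := ler_norm r.
rewrite mulrDl mul1r ler_wpDl ?normc_ge0 // mulr_suml !horner_coef -sumrB.
rewrite (le_trans (normc_sum _ _ _)) //; apply: ler_sum => j _.
rewrite -mulrBr normcM -mulrA ler_wpM2l ?normc_ge0 // normc_subXX_le //.
  exact: le_trans xr rr.
exact: le_trans yr rr.
Qed.

(** Differentiability of exp at 0 for the increment z / n, uniformly for z in the disc. *)
Lemma cexp_difference_quotient r e : 0 <= r -> 0 < e -> exists N, forall n, (N < n)%N ->
  forall z, normc z <= r -> normc (n%:R * (cexp (z / n%:R) - 1) - z) <= e.
Proof.
move=> r0 e0; have r1 : 0 < r + 1 by lra.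
have er : 0 < e / (r + 1) by rewrite divr_gt0.
have [d d0 Hd] := entire_cdiff1 (f := @cexp C) 0 (@entire_cexp R) er.
exists (Num.truncn ((r + 1) / d)) => n Nn z zr.
have n0 : 0 < n%:R :> R by rewrite ltr0n (leq_ltn_trans _ Nn).
have nC : n%:R != 0 :> R[i] by rewrite pnatr_eq0 -lt0n (leq_ltn_trans _ Nn).
have nzn : normc (z / n%:R) = normc z / n%:R by rewrite normcM normcV normc_nat.
have zd : normc (z / n%:R) <= d.
  rewrite nzn ler_pdivrMr // mulrC -ler_pdivrMr //.
  have h : (r + 1) / d < n%:R by rewrite (lt_le_trans (truncnS_gt _)) // ler_nat.
  by rewrite (le_trans _ (ltW h)) // ler_pM2r ?invr_gt0 //; lra.
have := Hd _ zd; rewrite add0r derive1_cexp cexp0 mulr1 => H.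
have -> : n%:R * (cexp (z / n%:R) - 1) - z = n%:R * (cexp (z / n%:R) - 1 - z / n%:R).
  by field.
rewrite normcM normc_nat (le_trans (ler_wpM2l (ltW n0) H)) // nzn.
have -> : n%:R * (e / (r + 1) * (normc z / n%:R)) = e * (normc z / (r + 1)).
  by field; rewrite !gt_eqF.
by rewrite ler_piMr ?(ltW e0) // ler_pdivrMr //; lra.
Qed.

(* The polynomial [q(z)] is approximated by [q (n (exp (z / n) - 1))]. *)
Lemma exponential_sums_dense (l : C) v r e : entire v -> 0 < e ->
  exists (n L : nat) (b : 'I_L -> C), [/\ (0 < n)%N, (L <= n)%N &
  forall z, normc z <= r ->
    normc (v z - \sum_(i < L) b i * cexp ((l + i%:R / n%:R) * z)) <= e].
Proof.
move=> ev e0; pose s := `|r|.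
have el := @entire_cexp_scale R l; have el' := @entire_cexp_scale R (- l).
have [M M0 HM] := entire_bounded_disc s el.
have M1 : 0 < 2 * (M + 1) by lra.
have eM : 0 < e / (2 * (M + 1)) by rewrite divr_gt0.
(* The polynomial approximates v(z) exp(-l z); multiplying back by exp(l z), bounded by [M], shifts
   all frequencies by [l]. Half of the error goes to this step, half to the change of argument of
   [q]. *)
have [q Hq] := entire_poly_approx (entireM ev el') s eM.
have [K K0 HK] := poly_lipschitz q (s + 1).
pose t := Num.min 1 (e / (2 * (M + 1)) / K).
have t0 : 0 < t by rewrite lt_min ltr01 divr_gt0.
have [N HN] := cexp_difference_quotient (normr_ge0 r) t0.
(* Beyond [size q], so that the frequencies l + i / n stay in l + [0, 1]. *)
pose n := (N + size q).+1.
have nC : n%:R != 0 :> R[i] by rewrite pnatr_eq0.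
pose Q := q \Po (n%:R *: 'X - n%:R%:P).
exists n, (size q), (fun i => Q`_i); split => //; first by rewrite /n; lia.
move=> z zr; have zs : normc z <= s by rewrite (le_trans zr) // ler_norm.
have sQ : (size Q <= size q)%N.
  rewrite size_comp_poly2 // -polyCN size_addl ?size_scale ?size_polyX //.
  by rewrite (leq_ltn_trans (size_polyC_leq1 _)).
have -> : \sum_(i < size q) Q`_i * cexp ((l + i%:R / n%:R) * z) =
    q.[n%:R * (cexp (z / n%:R) - 1)] * cexp (l * z).
  have -> : q.[n%:R * (cexp (z / n%:R) - 1)] = Q.[cexp (z / n%:R)].
    by rewrite horner_comp !hornerE mulrBr mulr1.
  rewrite (horner_coef_wide _ sQ) mulr_suml; apply: eq_bigr => i _.
  have -> : (l + i%:R / n%:R) * z = i%:R * (z / n%:R) + l * z by ring.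
  by rewrite [cexp (_ + _)]cexpD [cexp (i%:R * _)]cexpMn mulrA.
have -> : v z = v z * cexp (- l * z) * cexp (l * z).
  by rewrite -mulrA -cexpD mulNr addNr cexp0 mulr1.
rewrite -mulrBl normcM.
set w := n%:R * (cexp (z / n%:R) - 1).
have wz : normc (w - z) <= t by apply: HN zs; rewrite ltnS leq_addr.
have ws : normc w <= s + 1.
  rewrite -(subrK z w) (le_trans (normcD _ _)) // addrC lerD // (le_trans wz) //.
  by rewrite ge_min lexx.
have qz := Hq z zs.
have qzw : normc (q.[z] - q.[w]) <= e / (2 * (M + 1)).
  rewrite (le_trans (HK _ _ _ ws)) //; first lra.
  by rewrite mulrC -ler_pdivlMr // normc_distC (le_trans wz) // ge_min lexx orbT.
have tri := normc_triangle q.[z] (v z * cexp (- l * z)) q.[w].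
have h : normc (v z * cexp (- l * z) - q.[w]) <= e / (M + 1).
  rewrite (le_trans tri) // (le_trans (lerD qz qzw)) //.
  by rewrite le_eqVlt; apply/orP; left; apply/eqP; field; lra.
rewrite (le_trans (ler_pM (normc_ge0 _) (normc_ge0 _) h (HM z zs))) //.
by rewrite mulrAC ler_pdivrMr; [rewrite ler_pM2l // lerDl | lra].
Qed.

Lemma geometric_small (K q e : R) : 0 <= q < 1 -> 0 < e ->
  exists N, forall n, (N <= n)%N -> K * q ^+ n <= e.
Proof.
move=> /andP[q0 q1] e0.
have := @cvg_geometric R K q; rewrite ger0_norm // => /(_ q1).
move=> /cvgrPdist_le /(_ e e0) [N _ HN]; exists N => n /HN /=.
by rewrite sub0r normrN => /(le_trans (ler_norm _)).
Qed.

Lemma sum_geometric_small (I : finType) (A : pred I) (a q : I -> R) e :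
  (forall i, A i -> 0 <= q i < 1) -> 0 < e ->
  exists N, forall n, (N <= n)%N -> \sum_(i | A i) a i * q i ^+ n <= e.
Proof.
move=> Hq e0; pose c : R := #|I|%:R + 1.
have c0 : 0 < c by rewrite ltr_wpDl.
have ec : 0 < e / c by rewrite divr_gt0.
have [i _|N HN] := @uniform_threshold _ (enum I) (fun i n => A i -> a i * q i ^+ n <= e / c).
  have [Ai|nA] := boolP (A i); last by exists 0%N.
  by have [N HN] := geometric_small (a i) (Hq i Ai) ec; exists N => n /HN.
exists N => n Nn; apply: (@le_trans _ _ (\sum_(i : I) (e / c))).
  rewrite big_mkcond /=; apply: ler_sum => i _; case: ifP => Ai; last exact: ltW.
  by apply: HN; rewrite ?mem_enum.
rewrite sumr_const -mulr_natl mulrA ler_pdivrMr // mulrC ler_pM2l //.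
by rewrite lerDl.
Qed.

End ExponentialDensity.

(** * The operator on exponential sums *)

Section ExponentialSums.
Variables (R : realType) (P : {poly R[i]}).
Notation C := (R[i] : numClosedFieldType).

Definition expsum (I : finType) (a l : I -> C) : C -> C :=
  fun z => \sum_i a i * cexp (l i * z).

Lemma entire_expsum (I : finType) (a l : I -> C) : entire (expsum a l).
Proof. by apply: entire_sum => i; apply: entireZ; exact: entire_cexp_scale. Qed.

Lemma expD_sum (I : Type) (s : seq I) (a : I -> C) (F : I -> C -> C) :
  (forall i, entire (F i)) ->
  expD P (fun z => \sum_(i <- s) a i * F i z) = fun z => \sum_(i <- s) a i * expD P (F i) z.
Proof.
move=> eF; elim: s => [|i s IH].
  have e1 : entire (fun _ : C => 1 : C) := @entire_cst R 1.
  have -> : (fun z => \sum_(i <- [::]) a i * F i z) = (fun z => 0 * 1 + 0 * 1).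
    by apply/funext => z; rewrite big_nil !mul0r addr0.
  rewrite (expD_linear P 0 0 e1 e1).
  by apply/funext => z; rewrite big_nil !mul0r addr0.
have es : entire (fun z => \sum_(j <- s) a j * F j z).
  by apply: entire_sum => j; exact: entireZ.
have -> : (fun z => \sum_(j <- i :: s) a j * F j z) =
    (fun z => a i * F i z + 1 * \sum_(j <- s) a j * F j z).
  by apply/funext => z; rewrite big_cons mul1r.
rewrite (expD_linear P (a i) 1 (eF i) es) IH.
by apply/funext => z; rewrite big_cons mul1r.
Qed.

Lemma iter_expD_expsum (I : finType) (a l : I -> C) n :
  iter n (expD P) (expsum a l) = expsum (fun i => a i * symbol P (l i) ^+ n) l.
Proof.
elim: n => [|n IH].
  by apply/funext => z; apply: eq_bigr => i _; rewrite expr0 mulr1.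
rewrite iterS IH /expsum expD_sum; last by move=> i; exact: entire_cexp_scale.
apply/funext => z; apply: eq_bigr => i _.
by rewrite expD_exp exprSr !mulrA.
Qed.

Lemma expsum_expr (I : finType) (a l : I -> C) m :
  (fun z => expsum a l z ^+ m) =
  expsum (fun w : {ffun 'I_m -> I} => \prod_i a (w i)) (fun w => \sum_i l (w i)).
Proof.
apply/funext => z; rewrite -[m in LHS]card_ord -prodr_const bigA_distr_bigA.
by apply: eq_bigr => w _; rewrite big_split /= mulr_suml cexp_sum.
Qed.

Lemma normc_cexp_le (l z : C) (r : R) : normc z <= r ->
  normc (cexp (l * z)) <= expR (normc l * r).
Proof.
move=> zr; rewrite normc_cexp ler_expR (le_trans (ler_norm _)) //.
by rewrite (le_trans (ler_Re_normc _)) // normcM ler_wpM2l ?normc_ge0.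
Qed.

Lemma normc_expsum_le (I : finType) (a l : I -> C) (A : pred I) (z : C) (r : R) :
  normc z <= r -> normc (\sum_(i | A i) a i * cexp (l i * z)) <=
    \sum_(i | A i) normc (a i) * expR (normc (l i) * r).
Proof.
move=> zr; rewrite (le_trans (normc_sum _ _ _)) //; apply: ler_sum => i _.
by rewrite normcM ler_wpM2l ?normc_ge0 // normc_cexp_le.
Qed.

End ExponentialSums.

(** * Words of frequencies and the ratios attached to them *)

Section Words.
Variables (R : realType) (P : {poly R[i]}) (m0 M p q : nat) (y G : R).
Variables (t : 'I_p -> R) (x : 'I_q -> R) (kappa : 'I_q -> R[i]).
Hypothesis hm0 : (0 < m0)%N.
Hypotheses (y0 : 0 <= y) (G1 : 1 <= G).
Hypotheses (t01 : forall i, 0 <= t i <= 1) (x01 : forall l, 0 <= x l <= 1).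
Hypothesis x_inj : injective x.
Hypothesis kappaE : forall l, kappa l ^+ m0 = symbol P (Complex (x l) y).
Hypothesis avg_lt : forall m (x : 'I_m -> R),
  (forall i, 0 <= x i <= 1) -> (exists i j, x i != x j) ->
  normc (symbol P (\sum_i Complex (x i) y / m%:R)) ^+ m <
  \prod_i normc (symbol P (Complex (x i) y)).
Hypothesis sum_lt : forall k m (x : 'I_m -> R), (0 < k < m)%N -> (m <= M)%N ->
  (forall i, 0 <= x i <= 1) ->
  normc (symbol P (\sum_i Complex (x i) y / k%:R)) ^+ k <
  \prod_i normc (symbol P (Complex (x i) y)).
Hypothesis line_gt1 : forall x, 0 <= x -> 1 < normc (symbol P (Complex x y)).
Hypothesis left_lt1 : forall z, complex.Re z <= M%:R * (y + 2) + 1 - G ->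
  normc z <= (M%:R * (y + 2) + 1) * (G + 1) -> normc (symbol P z) < 1.

Definition letter_exponent (a : 'I_p + 'I_q) : R[i] :=
  match a with inl i => Complex (t i - G) 0 | inr l => Complex (x l) y / m0%:R end.

(** In u the coefficient of a letter is divided by the n-th power of its weight: left letters belong
    to f and are unchanged, right letters belong to v and shrink. *)
Definition letter_weight (a : 'I_p + 'I_q) : R[i] :=
  match a with inl _ => 1 | inr l => kappa l end.

Lemma normc_kappa_gt1 l : 1 < normc (kappa l).
Proof.
rewrite -(ltr_pXn2r (n := m0)) ?nnegrE ?normc_ge0 // expr1n -normcX kappaE.
by apply: line_gt1; case/andP: (x01 l).
Qed.

Lemma normc_letter_weight_ge1 a : 1 <= normc (letter_weight a).
Proof. case: a => [i|l]; first by rewrite [letter_weight _]/= normc1.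
exact/ltW/normc_kappa_gt1. Qed.

Lemma Re_letter_le a : complex.Re (letter_exponent a) <= 1.
Proof.
case: a => [i|l]; first by have [_ ?] := andP (t01 i); have := G1; rewrite /=; lra.
have [xa xb] := andP (x01 l).
have -> : complex.Re (letter_exponent (inr l)) = x l / m0%:R.
  rewrite /letter_exponent -(rmorph_nat (real_complex R)) -fmorphV /=.
  by rewrite mulr0 subr0.
by rewrite ler_pdivrMr ?ltr0n // mul1r (le_trans xb) // ler1n.
Qed.

Lemma normc_letter_le a : normc (letter_exponent a) <= G + y + 1.
Proof.
case: a => [i|l].
  rewrite (le_trans (normc_le_ReIm _)) //= normr0 addr0.
  have [ta tb] := andP (t01 i); have h1 := G1; have h2 := y0.
  by apply/ler_normlP; split; lra.
have [xa xb] := andP (x01 l); have h1 := G1; have h2 := y0.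
rewrite normcM normcV normc_nat ler_pdivrMr ?ltr0n //.
have k1 : 1 <= m0%:R :> R by rewrite ler1n.
rewrite (le_trans (normc_le_ReIm _)) //= (ger0_norm xa) (ger0_norm y0).
by rewrite (@le_trans _ _ (G + y + 1)) ?ler_peMr //; lra.
Qed.

(** One letter of f drags the sum far to the left, where |phi| < 1, while all weights are at least
    1. Words in letters of v only are compared after raising to the power m0, which turns the
    weights into values of phi: [sum_lt] serves for m > m0 and [avg_lt] for m = m0. *)
Lemma word_symbol_lt m (w : {ffun 'I_m -> 'I_p + 'I_q}) : (m0 <= m <= M)%N ->
  (m = m0 -> ~ exists l, forall i, w i = inr l) ->
  normc (symbol P (\sum_i letter_exponent (w i))) < normc (\prod_i letter_weight (w i)).
Proof.
move=> /andP[m0m mM] nc; rewrite normc_prod.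
have [[i0 [j0 wi0]]|noinl] := pselect (exists i j, w i = inl j).
  apply: (@lt_le_trans _ _ 1); last first.
    have E1 : \prod_(i < m) (1 : R) = 1 by rewrite big1_eq.
    rewrite -[leLHS]E1.
    by apply: ler_prod => i _; rewrite ler01 normc_letter_weight_ge1.
  have Mm : m%:R <= M%:R :> R by rewrite ler_nat.
  have h1 := G1; have h2 := y0; have M0 : 0 <= M%:R :> R by [].
  (* The letter [w i0] has real part at most 1 - G and the others at most 1, which gives 1 + M - G;
     the modulus is at most M (G + y + 1). Both fit the constant M (y + 2) + 1. *)
  apply: left_lt1.
    rewrite raddf_sum /= (bigD1 i0) //= wi0.
    have [_ tb] := andP (t01 j0).
    have : \sum_(i < m | i != i0) complex.Re (letter_exponent (w i)) <= m%:R.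
      rewrite (@le_trans _ _ (\sum_(i < m) 1)) //; last by rewrite sumr_const card_ord.
      rewrite big_mkcond; apply: ler_sum => i _; case: ifP => // _.
      exact: Re_letter_le.
    rewrite [complex.Re (letter_exponent (inl j0))]/=; nra.
  rewrite (le_trans (normc_sum _ _ _)) //.
  rewrite (@le_trans _ _ (\sum_(i < m) (G + y + 1))) //.
    by apply: ler_sum => i _; exact: normc_letter_le.
  rewrite sumr_const card_ord -[(G + y + 1) *+ m]mulr_natl.
  apply: (@le_trans _ _ (M%:R * (G + y + 1))); first by rewrite ler_wpM2r //; lra.
  have G0 : 0 <= G by lra.
  have := mulr_ge0 (mulr_ge0 M0 h2) G0; have := mulr_ge0 M0 G0; lra.
have allr i : exists l, w i = inr l.
  by case E: (w i) => [j|l]; [case: noinl; exists i, j | exists l].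
have [l wl] := choice allr.
have sE : \sum_i letter_exponent (w i) = \sum_i Complex (x (l i)) y / m0%:R.
  by apply: eq_bigr => i _; rewrite wl.
rewrite sE -(ltr_pXn2r (n := m0)) ?nnegrE ?normc_ge0 ?prodr_ge0 //; last first.
  by move=> i _; exact: normc_ge0.
rewrite -prodrXl [ltRHS](eq_bigr (fun i => normc (symbol P (Complex (x (l i)) y)))); last first.
  by move=> i _; rewrite wl -normcX kappaE.
have [mE|ne] := eqVneq m m0; last first.
  by apply: sum_lt => //; rewrite hm0 ltn_neqAle eq_sym ne.
rewrite -mE; apply: avg_lt => //.
apply: contrapT => alleq; apply: (nc mE).
(* If all abscissas agree, injectivity of [x] makes the word constant, which is excluded. *)
have i0 : 'I_m by rewrite mE; exact: Ordinal hm0.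
exists (l i0) => i; rewrite wl; congr inr; apply: x_inj.
by apply: contrapT => /eqP ne; apply: alleq; exists i, i0.
Qed.

End Words.

(** * Transitivity for powers *)

Section Transitivity.
Variables (R : realType) (P : {poly R[i]}).
Notation C := (R[i] : numClosedFieldType).
Hypothesis hP : (1 < size P)%N.

(* [u] is [f] up to small errors, made of exponentials with frequencies far to
   the left, plus the sum of the [(b l)^(1/m0) phi(lambda_l)^(-n/m0) exp(lambda_l z / m0)].
   Expanding [u ^ m] over words of [m] letters and applying [phi(D)^n], each word
   is multiplied by the [n]-th power of a ratio of modulus less than [1], except
   the constant words for [m = m0], which reproduce [v]. *)
Lemma powers_transitive (f v : C -> C) (m0 M : nat) (r d s e : R) :
  entire f -> entire v -> (0 < m0)%N -> 0 < d -> 0 < e ->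
  exists (u : C -> C) (n : nat), [/\ entire u,
    forall z, normc z <= r -> normc (u z - f z) <= d &
    forall m, (m0 <= m <= M)%N -> forall z, normc z <= s ->
      normc (iter n (expD P) (fun z => u z ^+ m) z - (if m == m0 then v z else 0)) <= e].
Proof.
move=> ef ev m00 d0 e0.
have [Y1 avg_lt] := symbol_average_lt hP.
have [Y2 sum_lt] := symbol_sum_lt hP M.
have [Y3 line_gt1] := symbol_line_gt1 hP.
pose y := Num.max 0 (Num.max Y1 (Num.max Y2 Y3)).
have y0 : 0 <= y by rewrite le_max lexx.
have yY1 : Y1 <= y by rewrite !le_max lexx !orbT.
have yY2 : Y2 <= y by rewrite !le_max lexx !orbT.
have yY3 : Y3 <= y by rewrite !le_max lexx !orbT.
have K0 : 0 <= M%:R * (y + 2) + 1 by rewrite addr_ge0 // mulr_ge0 // addr_ge0.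
have [G0 left_lt1] := symbol_left_lt1 P K0.
pose G := Num.max 1 G0.
have G1 : 1 <= G by rewrite le_max lexx.
have GG : G0 <= G by rewrite le_max lexx orbT.
have d20 : 0 < d / 2 by rewrite divr_gt0.
have e20 : 0 < e / 2 by rewrite divr_gt0.
(* [G] is fixed before the approximation: its size depends on [M] and [y], not on the number of
   letters. *)
have [n1 [p [a [n10 pn1 Ha]]]] := exponential_sums_dense (Complex (- G) 0) r ef d20.
have [n2 [q [b [n20 qn2 Hb]]]] := exponential_sums_dense (Complex 0 y) s ev e20.
pose t (i : 'I_p) : R := i%:R / n1%:R; pose x (l : 'I_q) : R := l%:R / n2%:R.
have ratio (k k' : nat) : (0 < k')%N -> (k <= k')%N -> 0 <= (k%:R / k'%:R : R) <= 1.
  move=> k'0 kk'; rewrite divr_ge0 //= ler_pdivrMr ?ltr0n // mul1r ler_nat //.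
have t01 i : 0 <= t i <= 1 by apply: ratio => //; rewrite (leq_trans (ltnW (ltn_ord i))).
have x01 l : 0 <= x l <= 1 by apply: ratio => //; rewrite (leq_trans (ltnW (ltn_ord l))).
have n2R : n2%:R != 0 :> R by rewrite pnatr_eq0 -lt0n.
have x_inj : injective x.
  by move=> l l' /(mulIf (invr_neq0 n2R)) /eqP; rewrite eqr_nat => /eqP /val_inj.
have ratC (k k' : nat) : k%:R / k'%:R = Complex (k%:R / k'%:R) 0 :> R[i].
  by rewrite -[RHS]/((k%:R / k'%:R)%:C%C) rmorphM fmorphV !rmorph_nat.
have tE (i : 'I_p) : Complex (- G) 0 + i%:R / n1%:R = Complex (t i - G) 0 :> R[i].
  by rewrite ratC /t; apply/eqP; rewrite eq_complex /= addr0 addrC !eqxx.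
have xE (l : 'I_q) : Complex 0 y + l%:R / n2%:R = Complex (x l) y :> R[i].
  by rewrite ratC /x; apply/eqP; rewrite eq_complex /= addr0 add0r !eqxx.
(* Any m0-th root would do, as only the m0-th power and the modulus of [kappa l] matter. *)
pose kappa l : C := m0.-root (symbol P (Complex (x l) y)).
have kappaE l : kappa l ^+ m0 = symbol P (Complex (x l) y) by exact: rootCK.
have kappa_gt1 := @normc_kappa_gt1 R P m0 q y x kappa m00 x01 kappaE (line_gt1 y yY3).
have kappa0 l : kappa l != 0.
  by rewrite -normc_gt0 (lt_trans ltr01).
pose mu := letter_exponent m0 y G t x.
pose wt := letter_weight kappa : 'I_p + 'I_q -> R[i].
pose coef (c : 'I_p + 'I_q) : C := match c with inl i => a i | inr l => m0.-root (b l) end.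
pose u n : C -> C := expsum (fun c => coef c * (wt c)^-1 ^+ n) mu.
pose A m (w : {ffun 'I_m -> 'I_p + 'I_q}) : C := \prod_i coef (w i).
pose sg m (w : {ffun 'I_m -> 'I_p + 'I_q}) : C := \sum_i mu (w i).
pose K m (w : {ffun 'I_m -> 'I_p + 'I_q}) : C := \prod_i wt (w i).
pose th m (w : {ffun 'I_m -> 'I_p + 'I_q}) : C := symbol P (sg m w) / K m w.
have iterE n m z : iter n (expD P) (fun z => u n z ^+ m) z =
    \sum_w (A m w * th m w ^+ n) * cexp (sg m w * z).
  rewrite expsum_expr iter_expD_expsum; apply: eq_bigr => w _; congr (_ * _).
  by rewrite big_split /= prodrXl prodfV -mulrA -exprMn [_^-1 * _]mulrC.
pose cw (l : 'I_q) : {ffun 'I_m0 -> 'I_p + 'I_q} := [ffun _ => inr l].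
have cw_inj : injective cw.
  by move=> l l' /ffunP /(_ (Ordinal m00)); rewrite !ffunE => -[].
(* The exceptional words, the constant ones on letters of v with m = m0; their ratio [th] is 1. *)
pose E m : pred {ffun 'I_m -> 'I_p + 'I_q} :=
  fun w => (m == m0) && [exists l, [forall i, w i == inr l]].
have small m : (m0 <= m <= M)%N -> exists N, forall n, (N <= n)%N ->
    \sum_(w | ~~ E m w) (normc (A m w) * expR (normc (sg m w) * s)) * normc (th m w) ^+ n <= e / 2.
  move=> m0M; apply: sum_geometric_small => // w nE.
  rewrite normc_ge0 /= normcM normcV ltr_pdivrMr; last first.
    rewrite normc_gt0 prodf_seq_neq0; apply/allP => i _; apply/implyP => _.
    by rewrite -normc_gt0 (lt_le_trans ltr01) // (normc_letter_weight_ge1 m00 x01 kappaE (line_gt1 y yY3)).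
  rewrite mul1r; apply: (word_symbol_lt m00 y0 G1 t01 x01 x_inj kappaE (avg_lt y yY1) (sum_lt y yY2) (line_gt1 y yY3) (left_lt1 G GG) m0M).
  move=> mE [l wl]; move/negP: nE; apply; apply/andP; split; first exact/eqP.
  by apply/existsP; exists l; apply/forallP => i; rewrite wl.
have [m _|N1 HN1] := @uniform_threshold _ (iota 0 M.+1) (fun m n => (m0 <= m <= M)%N ->
    \sum_(w | ~~ E m w) (normc (A m w) * expR (normc (sg m w) * s)) * normc (th m w) ^+ n <= e / 2).
  have [/small[N HN]|nm] := boolP (m0 <= m <= M)%N; last by exists 0%N.
  by exists N => n /HN.
have [l _|N2 HN2] := @sum_geometric_small R 'I_q xpredT
   (fun l => normc (coef (inr l)) * expR (normc (mu (inr l)) * r)) (fun l => normc (kappa l)^-1) (d / 2) _ d20.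
  by rewrite normc_ge0 normcV invf_lt1 ?kappa_gt1 // (lt_trans ltr01).
(* The same [n] defines u and counts the iterations: [N2] makes the part of u coming from v small,
   [N1] the unwanted words. *)
pose n := (N1 + N2)%N; exists (u n), n; split.
- exact: entire_expsum.
- move=> z zr; rewrite /u /expsum big_sumType /=.
  have -> : \sum_(i < p) a i * 1^-1 ^+ n * cexp (Complex (t i - G) 0 * z) =
      \sum_(i < p) a i * cexp ((Complex (- G) 0 + i%:R / n1%:R) * z).
    by apply: eq_bigr => i _; rewrite invr1 expr1n mulr1 tE.
  rewrite addrAC (le_trans (normcD _ _)) // [d]splitr lerD //.
    by rewrite normc_distC Ha.
  apply: le_trans (normc_expsum_le _ _ _ zr) _.
  apply: le_trans (HN2 n (leq_addl _ _)); rewrite le_eqVlt; apply/orP; left; apply/eqP.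
  by apply: eq_bigr => l _; rewrite normcM normcX mulrAC.
move=> m m0M z zs; rewrite iterE (bigID (E m)) /=.
have rest : normc (\sum_(w | ~~ E m w) A m w * th m w ^+ n * cexp (sg m w * z)) <= e / 2.
  apply: le_trans (normc_expsum_le _ _ _ zs) _.
  have mi : m \in iota 0 M.+1 by rewrite mem_iota add0n ltnS; case/andP: m0M.
  apply: le_trans (HN1 n (leq_addr _ _) m mi m0M); rewrite le_eqVlt; apply/orP; left; apply/eqP.
  by apply: eq_bigr => w _; rewrite normcM normcX mulrAC.
rewrite addrAC (le_trans (normcD _ _)) // [e]splitr lerD //.
have [mE|ne] := eqVneq m m0; last first.
  rewrite big_pred0 ?subr0 ?normc0 ?(ltW e20) // => w.
  by rewrite /E (negPf ne).
subst m.
rewrite normc_distC; apply: le_trans (Hb z zs).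
rewrite le_eqVlt; apply/orP; left; apply/eqP; congr (normc (_ - _)).
have EE w : E m0 w = (w \in [set cw l | l in [set: 'I_q]]%SET).
  rewrite /E eqxx /=; apply/existsP/imsetP => [[l /forallP wl]|[l _ ->]].
    by exists l; rewrite ?inE //; apply/ffunP => i; rewrite ffunE; exact/eqP.
  by exists l; apply/forallP => i; rewrite ffunE.
rewrite (eq_bigl _ _ EE) big_imset /=; last by move=> l l' _ _; exact: cw_inj.
apply: eq_big => [l|l _]; first by rewrite inE.
have sgE : sg m0 (cw l) = Complex (x l) y.
  rewrite /sg; under eq_bigr do rewrite ffunE.
  rewrite sumr_const card_ord -mulr_natr divfK // pnatr_eq0 -lt0n //.
have KE : K m0 (cw l) = symbol P (Complex (x l) y).
  rewrite /K; under eq_bigr do rewrite ffunE.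
  by rewrite prodr_const card_ord -kappaE.
have AE : A m0 (cw l) = b l.
  rewrite /A; under eq_bigr do rewrite ffunE.
  by rewrite prodr_const card_ord /= rootCK.
have thE : th m0 (cw l) = 1 by rewrite /th sgE KE divff // -kappaE expf_neq0.
by rewrite [RHS]/= sgE xE [A m0 (cw l)]AE [th m0 (cw l)]thE expr1n mulr1.
Qed.

End Transitivity.

(** * Baire argument and hypercyclicity *)

Section BaireCategory.
Variable R : realType.
Notation C := (R[i] : numClosedFieldType).

(** The hypothesis says that each [G t] contains an open set close to any f. Nested neighbourhoods,
    given by a disc and a tolerance, shrink to a common element. *)
Lemma entire_baire (G : nat -> (C -> C) -> Prop) :
  (forall t f (r d : R), entire f -> 0 < d -> exists (u : C -> C) (r' d' : R),
    [/\ entire u, 0 < d', forall z, normc z <= r -> normc (u z - f z) <= d &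
     forall w, entire w -> (forall z, normc z <= r' -> normc (w z - u z) <= d') -> G t w]) ->
  exists2 w, entire w & forall t, G t w.
Proof.
move=> H.
pose good (s : nat * (C -> C) * R * R) := entire s.1.1.2 /\ 0 < s.2.
pose next (s s' : {s | good s}) :=
  (* The radii grow by at least 1, so convergence holds on every disc. Moving by d / 2 with the next
     tolerance at most d / 2 keeps all later functions within [d] of [f]. *)
  let: (t, f, r, d) := sval s in let: (t', u, r', d') := sval s' in
  [/\ t' = t.+1, r + 1 <= r', d' <= d / 2,
    forall z, normc z <= r -> normc (u z - f z) <= d / 2 &
    forall w, entire w -> (forall z, normc z <= r' -> normc (w z - u z) <= d') -> G t w].
have ex_next s : {s' | next s s'}.
  apply/cid; case: s => -[[[t f] r] d] [/= ef d0].
  have d20 : 0 < d / 2 by rewrite divr_gt0.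
  have [u [r' [d' [eu d'0 uf Gu]]]] := H t f r _ ef d20.
  have gd : good (t.+1, u, Num.max r' (r + 1), Num.min d' (d / 2)).
    by split => //=; rewrite lt_min d'0.
  exists (exist good _ gd); rewrite /next /=; split => //.
  - by rewrite le_max lexx orbT.
  - by rewrite ge_min lexx orbT.
  - move=> w ew wu; apply: Gu => // z zr; rewrite (le_trans (wu z _)) ?ge_min ?lexx //.
    by rewrite le_max zr.
have good0 : good (0%N, fun=> 0, 0, 1) by split => //; exact: entire_cst.
have [s [s0 sS]] := dependent_choice ex_next (exist good _ good0).
pose f n := (sval (s n)).1.1.2; pose r n := (sval (s n)).1.2; pose d n := (sval (s n)).2.
have tE n : (sval (s n)).1.1.1 = n.
  elim: n => [|n IH]; first by rewrite s0.
  have := sS n; rewrite /next; case: (sval (s n)) IH => -[[t ?] ?] ? /= ->.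
  by case: (sval (s n.+1)) => -[[t' ?] ?] ? /= [].
have step n : [/\ r n + 1 <= r n.+1, d n.+1 <= d n / 2,
    forall z, normc z <= r n -> normc (f n.+1 z - f n z) <= d n / 2 &
    forall w, entire w ->
      (forall z, normc z <= r n.+1 -> normc (w z - f n.+1 z) <= d n.+1) -> G n w].
  have := sS n; have := tE n; rewrite /next /f /r /d.
  case: (sval (s n)) => -[[t ?] ?] ? /= ->.
  by case: (sval (s n.+1)) => -[[t' ?] ?] ? /= [].
have ef n : entire (f n) by have [] := svalP (s n).
have rn n : n%:R <= r n.
  elim: n => [|n IH]; first by rewrite /r s0.
  by have [h _ _ _] := step n; rewrite -[n.+1%:R]natr1; lra.
have rr n k : r n <= r (n + k)%N.
  elim: k => [|k IH]; first by rewrite addn0.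
  by have [h _ _ _] := step (n + k)%N; rewrite addnS; lra.
have dn n : d n <= 2^-1 ^+ n.
  elim: n => [|n IH]; first by rewrite /d s0.
  by have [_ h _ _] := step n; rewrite exprS; lra.
have close k : forall n z, normc z <= r n -> normc (f (n + k)%N z - f n z) <= d n.
  elim: k => [|k IH] n z zr.
    by rewrite addn0 subrr normc0; have [_ /ltW] := svalP (s n).
  have [h1 h2 h3 _] := step n.
  have zr' : normc z <= r n.+1 by lra.
  have := IH n.+1 z zr'; rewrite addSnnS; have := h3 z zr.
  have := normc_triangle (f n.+1 z) (f (n + k.+1)%N z) (f n z); lra.
have [w fw] : exists w, cvg_discs f w.
  apply: cauchy_discs => rho e e0.
  have half : 0 <= (2^-1 : R) < 1 by apply/andP; split; lra.
  have [N1 HN1] := geometric_small 2 half e0.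
  pose N := (N1 + (Num.truncn rho).+1)%N; exists N => m n Nm Nn z zr.
  have zN : normc z <= r N.
    rewrite (le_trans zr) // (le_trans (ltW (truncnS_gt _))) // (le_trans _ (rn N)) //.
    by rewrite ler_nat leq_addl.
  have cm := close (m - N)%N N z zN; have cn := close (n - N)%N N z zN.
  rewrite !subnKC // in cm cn.
  have := HN1 N (leq_addr _ _); have := dn N.
  have := normc_triangle (f N z) (f m z) (f n z).
  rewrite [normc (f N z - _)]normc_distC; lra.
exists w => [|n]; first exact: cvg_discs_entire ef fw.
have [_ _ _] := step n; apply; first exact: cvg_discs_entire ef fw.
move=> z zr; apply/ler_addgt0Pr => e e0.
have [N HN] := fw (r n.+1) e e0.
have := HN (n.+1 + N)%N (leq_addl _ _) z zr; have := close N n.+1 z zr.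
have := normc_triangle (f (n.+1 + N)%N z) (w z) (f n.+1 z).
rewrite [normc (w z - f (n.+1 + N)%N z)]normc_distC; lra.
Qed.

End BaireCategory.

(** * Linearity and continuity of the iterates *)

Section Iterates.
Variables (R : realType) (P : {poly R[i]}).
Notation C := (R[i] : numClosedFieldType).
Implicit Types (f g : C -> C) (r e : R).

Lemma entire_iter_expD f n : entire f -> entire (iter n (expD P) f).
Proof. by move=> ef; elim: n => [//|n IH]; exact: entire_expD. Qed.

Lemma iter_phiDE f n : entire f -> iter n (phiD (symbol P)) f = iter n (expD P) f.
Proof.
move=> ef; elim: n => [//|n IH].
by rewrite iterS IH (phiDE P (entire_iter_expD (n := n) ef)).
Qed.

Lemma iter_expD_sum (I : Type) (s : seq I) (a : I -> C) (F : I -> C -> C) n :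
  (forall i, entire (F i)) ->
  iter n (expD P) (fun z => \sum_(i <- s) a i * F i z) =
  fun z => \sum_(i <- s) a i * iter n (expD P) (F i) z.
Proof.
move=> eF; elim: n => [//|n IH].
rewrite iterS IH.
exact: (@expD_sum R P I s a (fun i => iter n (expD P) (F i))
  (fun i => entire_iter_expD (n := n) (eF i))).
Qed.

Lemma iter_expDB f g n : entire f -> entire g ->
  iter n (expD P) (fun z => f z - g z) =
  fun z => iter n (expD P) f z - iter n (expD P) g z.
Proof.
move=> ef eg; elim: n => [//|n IH].
rewrite iterS IH; have h1 := entire_iter_expD (n := n) ef; have h2 := entire_iter_expD (n := n) eg.
have -> : (fun z => iter n (expD P) f z - iter n (expD P) g z) =
    (fun z => 1 * iter n (expD P) f z + -1 * iter n (expD P) g z).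
  by apply/funext => z; rewrite mul1r mulN1r.
by rewrite (expD_linear P 1 (-1) h1 h2); apply/funext => z; rewrite mul1r mulN1r.
Qed.

Lemma iter_expD_continuous n : exists2 K, 0 <= K & forall f r e, entire f -> 0 <= e ->
  (forall z, normc z <= r + 2 * n%:R -> normc (f z) <= e) ->
  forall z, normc z <= r -> normc (iter n (expD P) f z) <= K * e.
Proof.
have [K K0 HK] := expD_continuous P.
elim: n => [|n [L L0 HL]].
  by exists 1 => // f r e ef e0 fe z zr; rewrite mul1r; apply: fe; rewrite mulr0 addr0.
exists (K * L) => [|f r e ef e0 fe z zr]; first exact: mulr_ge0.
have bd w : normc w <= r + 2 -> normc (iter n (expD P) f w) <= L * e.
  by apply: (HL f (r + 2) e ef e0) => t tr; apply: fe; rewrite -[n.+1%:R]natr1; lra.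
rewrite -mulrA.
exact: (HK (iter n (expD P) f) r (L * e) (entire_iter_expD (n := n) ef) (mulr_ge0 L0 e0) bd).
Qed.

(** This gives the openness needed by [entire_baire], for all powers up to M at once: w^m - u^m is
    bounded by m (B + 1)^(m-1) |w - u|, where B bounds u and |w - u| <= 1. *)
Lemma iter_expr_continuous u n (M : nat) (r e : R) : entire u -> 0 < e ->
  exists r' d', 0 < d' /\ forall w, entire w ->
    (forall z, normc z <= r' -> normc (w z - u z) <= d') ->
    forall m, (m <= M)%N -> forall z, normc z <= r ->
    normc (iter n (expD P) (fun z => w z ^+ m) z - iter n (expD P) (fun z => u z ^+ m) z) <= e.
Proof.
move=> eu e0; have [K K0 HK] := iter_expD_continuous n.
pose r' := r + 2 * n%:R; have [B B0 HB] := entire_bounded_disc r' eu.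
pose c := K * (M%:R * (B + 1) ^+ M) + 1.
have BM : 0 <= (B + 1) ^+ M by rewrite exprn_ge0 // addr_ge0.
have c0 : 0 < c by rewrite ltr_wpDl // !mulr_ge0.
pose d := Num.min 1 (e / c).
have d0 : 0 < d by rewrite lt_min ltr01 divr_gt0.
exists r', d; split=> // w ew wu m mM z zr.
have ewm := @entireX R w m ew; have eum := @entireX R u m eu.
have -> : iter n (expD P) (fun z => w z ^+ m) z - iter n (expD P) (fun z => u z ^+ m) z =
    iter n (expD P) (fun z => w z ^+ m - u z ^+ m) z by rewrite (iter_expDB n ewm eum).
pose b := M%:R * (B + 1) ^+ M * d.
have b0 : 0 <= b by rewrite !mulr_ge0 // ltW.
apply: (le_trans (HK _ r b (entireB ewm eum) b0 _ z zr)).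
  move=> t tr; have ut := HB t tr; have wut := wu t tr.
  have d1 : d <= 1 by rewrite ge_min lexx.
  have wt : normc (w t) <= B + 1.
    by rewrite -(subrK (u t) (w t)) (le_trans (normcD _ _)) // addrC lerD // (le_trans wut).
  have ut' : normc (u t) <= B + 1 by lra.
  apply: (le_trans (normc_subXX_le m wt ut')).
  apply: ler_pM; rewrite ?normc_ge0 // ?mulr_ge0 ?exprn_ge0 ?addr_ge0 //.
  apply: ler_pM; rewrite ?ler_nat ?exprn_ge0 ?addr_ge0 //.
  by rewrite ler_weXn2l ?lerDr // (leq_trans (leq_pred _)).
have : d <= e / c by rewrite ge_min lexx orbT.
rewrite ler_pdivlMr // mulrC => h; apply: le_trans h; rewrite mulrA ler_wpM2r ?(ltW d0) //.
by rewrite /c lerDl.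
Qed.

End Iterates.

(** * A countable dense set of targets *)

Section Targets.
Variable R : realType.
Notation C := (R[i] : numClosedFieldType).

Definition rational_complex (c : rat * rat) : R[i] := Complex (ratr c.1) (ratr c.2).

(** Coefficients are given as a sequence of pairs of rationals, a countable type, so that the
    targets can be enumerated. *)
Definition rational_poly (s : seq (rat * rat)) : C -> C :=
  fun z => \sum_(j < size s) rational_complex (nth (0, 0) s j) * z ^+ j.

Lemma rational_dense (x e : R) : 0 < e -> exists q : rat, `|x - ratr q| <= e.
Proof.
move=> e0; have [|q] := @rat_in_itvoo R (x - e) (x + e); first by lra.
rewrite in_itv /= => /andP[q1 q2]; exists q; apply/ler_normlP; split; lra.
Qed.

Lemma rational_complex_dense (z : R[i]) (e : R) : 0 < e ->
  exists c, normc (z - rational_complex c) <= e.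
Proof.
move=> e0; have e20 : 0 < e / 2 by rewrite divr_gt0.
have [a Ha] := rational_dense (complex.Re z) e20.
have [b Hb] := rational_dense (complex.Im z) e20.
exists (a, b); rewrite (le_trans (normc_le_ReIm _)) // [e]splitr.
by case: z Ha Hb => x y /= Ha Hb; rewrite lerD.
Qed.

Lemma entire_id : entire (fun z : C => z).
Proof. by move=> z; exact: derivable_id. Qed.

Lemma entire_horner (p : {poly R[i]}) (w : C -> C) : entire w -> entire (fun z => p.[w z]).
Proof.
move=> ew; have -> : (fun z => p.[w z]) = (fun z => \sum_(j < size p) p`_j * w z ^+ j).
  by apply/funext => z; rewrite horner_coef.
by apply: entire_sum => j; apply: entireZ; exact: entireX.
Qed.

Lemma entire_rational_poly s : entire (rational_poly s).
Proof. by apply: entire_sum => j; apply: entireZ; apply: entireX; exact: entire_id. Qed.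

Lemma rational_poly_dense (v : C -> C) (r e : R) : entire v -> 0 < e ->
  exists s, forall z, normc z <= r -> normc (v z - rational_poly s z) <= e.
Proof.
move=> ev e0; have e20 : 0 < e / 2 by rewrite divr_gt0.
have [p Hp] := entire_poly_approx ev r e20.
pose S := \sum_(j < size p) `|r| ^+ j + 1.
have S0 : 0 < S by rewrite ltr_wpDl // sumr_ge0 // => j _; exact: exprn_ge0.
have eS : 0 < e / 2 / S by rewrite divr_gt0.
have [c Hc] := choice (fun j => rational_complex_dense p`_j eS).
exists (mkseq c (size p)) => z zr.
rewrite (le_trans (normc_triangle p.[z] _ _)) // [e]splitr lerD ?Hp //.
rewrite /rational_poly size_mkseq horner_coef -sumrB (le_trans (normc_sum _ _ _)) //.
apply: (@le_trans _ _ (\sum_(j < size p) e / 2 / S * `|r| ^+ j)).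
  apply: ler_sum => j _; rewrite nth_mkseq // -mulrBl normcM normcX ler_pM ?exprn_ge0 ?normc_ge0 ?Hc //.
  by rewrite lerXn2r ?nnegrE ?normc_ge0 // (le_trans zr) // ler_norm.
rewrite -mulr_sumr mulrAC ler_pdivrMr // ler_pM2l //.
by rewrite lerDl.
Qed.

End Targets.

(** * The generic function and its algebra *)

Section Hypercyclicity.
Variables (R : realType) (P : {poly R[i]}).
Notation C := (R[i] : numClosedFieldType).
Hypothesis hP : (1 < size P)%N.

(** One iterate must serve all powers, so that it acts on a whole polynomial in [w]. *)
Definition simultaneous_target (m0 M k : nat) (v : C -> C) (e : R) (w : C -> C) :=
  exists n, forall m, (m0 <= m <= M)%N -> forall z, normc z <= k%:R ->
    normc (iter n (expD P) (fun z => w z ^+ m) z - (if m == m0 then v z else 0)) <= e.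

(** The conditions are indexed by a countable type, and each one is dense by [powers_transitive] and
    open by [iter_expr_continuous]. *)
Lemma exists_generic_function : exists2 w : C -> C, entire w &
  forall (m0 M k : nat) (s : seq (rat * rat)), (0 < m0)%N ->
    simultaneous_target m0 M k (rational_poly s) k.+1%:R^-1 w.
Proof.
pose G t (w : C -> C) := forall m0 M k s,
  @unpickle (nat * nat * nat * seq (rat * rat))%type t = Some (m0, M, k, s) -> (0 < m0)%N ->
  simultaneous_target m0 M k (rational_poly s) k.+1%:R^-1 w.
have [t f r d ef d0|w ew Gw] := @entire_baire R G; last first.
  exists w => // m0 M k s m00.
  by apply: (Gw (pickle (m0, M, k, s))) => //; rewrite pickleK.
case E: (@unpickle (nat * nat * nat * seq (rat * rat))%type t) => [[[[m0 M] k] s]|]; last first.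
  (* Numbers that code no quadruple impose no condition; likewise below for m0 = 0. *)
  exists f, 0, 1; split => // [z _|w _ _ m0 M k s]; first by rewrite subrr normc0 ltW.
  by rewrite E.
have [m00|m00] := posnP m0.
  exists f, 0, 1; split => // [z _|w _ _ m0' M' k' s']; first by rewrite subrr normc0 ltW.
  by rewrite E => -[<- _ _ _]; rewrite m00.
have e0 : 0 < (k.+1%:R^-1 : R) / 2 by rewrite divr_gt0 // invr_gt0.
have [u [n [eu uf Hu]]] :=
  powers_transitive hP M r k%:R ef (@entire_rational_poly R s) m00 d0 e0.
have [r' [d' [d'0 Hw]]] := iter_expr_continuous P n M k%:R eu e0.
exists u, r', d'; split => // w ew wu m0' M' k' s'; rewrite E => -[<- <- <- <-] _.
exists n => m mM z zk; have /andP[_ m_M] := mM.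
rewrite (le_trans (normc_triangle (iter n (expD P) (fun z => u z ^+ m) z) _ _)) //.
by rewrite [leRHS]splitr lerD ?Hu // Hw.
Qed.

Section Generic.
Variable w : C -> C.
Hypothesis ew : entire w.
Hypothesis Gw : forall (m0 M k : nat) s, (0 < m0)%N ->
  simultaneous_target m0 M k (rational_poly s) k.+1%:R^-1 w.

(** With c the coefficient of lowest degree m0, the target g / c is aimed at: the iterate sends c
    w^m0 near g and all higher terms of p(w) near 0. *)
Lemma generic_HC (p : {poly R[i]}) : p`_0 = 0 -> p != 0 ->
  HC (phiD (symbol P)) (fun z => p.[w z]).
Proof.
move=> p0 pn0; split; first exact: entire_horner.
move=> g eg; apply: closure_compact_normc => r r0.
have ex_m0 : exists m, p`_m != 0 by exists (size p).-1; rewrite -lead_coefE lead_coef_eq0.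
pose m0 := ex_minn ex_m0.
have [pm0 min_m0] : p`_m0 != 0 /\ forall m, p`_m != 0 -> (m0 <= m)%N.
  by rewrite /m0; case: ex_minnP.
have m00 : (0 < m0)%N by rewrite lt0n; apply: contra pm0 => /eqP ->; rewrite p0.
(* The sum collects the errors on the powers of [w], |c| the error in replacing g / c by a rational
   polynomial, and 1 keeps [S] positive. *)
pose c := p`_m0; pose S := \sum_(m < size p) normc p`_m + normc c + 1.
have S0 : 0 < S.
  by rewrite ltr_wpDl // addr_ge0 ?normc_ge0 // sumr_ge0 // => m _; exact: normc_ge0.
pose h := r^-1 / S; have h0 : 0 < h by rewrite !divr_gt0 ?invr_gt0.
(* Larger than [r], for the disc, and than 1 / h, for the tolerance. *)
pose k := ((Num.truncn r).+1 + (Num.truncn h^-1).+1)%N.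
have kr : r <= k%:R.
  by rewrite (le_trans (ltW (truncnS_gt _))) // ler_nat leq_addr.
have kh : k.+1%:R^-1 <= h.
  rewrite -[h]invrK lef_pV2 ?posrE ?invr_gt0 //.
  rewrite (le_trans (ltW (truncnS_gt _))) // ler_nat.
  by apply: leqW; exact: leq_addl.
have egc : entire (fun z => c^-1 * g z) by exact: entireZ.
have [s Hs] := rational_poly_dense r egc h0.
have [n Hn] := @Gw m0 (size p) k s m00.
exists (iter n (phiD (symbol P)) (fun z => p.[w z])); first by exists n.
move=> z zr; rewrite (@iter_phiDE R P _ n (@entire_horner R p w ew)).
have -> : (fun z => p.[w z]) = (fun z => \sum_(m < size p) p`_m * w z ^+ m).
  by apply/funext => t; rewrite horner_coef.
rewrite (@iter_expD_sum R P _ (index_enum 'I_(size p)) (fun m => p`_m) (fun m z => w z ^+ m) n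
  (fun m => @entireX R w m ew)).
have m0p : (m0 < size p)%N by rewrite ltnNge; apply: contra pm0 => /(nth_default 0) ->.
have gE : g z = \sum_(m < size p) p`_m * (if m == m0 :> nat then rational_poly s z else 0) +
    c * (c^-1 * g z - rational_poly s z).
  rewrite (bigD1 (Ordinal m0p)) //= eqxx big1 ?addr0; last first.
    by move=> m; rewrite -val_eqE /= => /negPf ->; rewrite mulr0.
  by rewrite mulrBr mulVKf // subrKC.
rewrite {1}gE opprD addrA -sumrB (le_trans (normcB _ _)) //.
have -> : r^-1 = h * S by rewrite /h divfK // gt_eqF.
have -> : h * S = h * \sum_(m < size p) normc p`_m + h * normc c + h.
  by rewrite /S !mulrDr mulr1.
rewrite -[leLHS]addr0 lerD ?(ltW h0) // lerD //; last first.
  by rewrite normcM mulrC ler_wpM2r ?normc_ge0 // Hs.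
rewrite (le_trans (normc_sum _ _ _)) // mulr_sumr; apply: ler_sum => m _.
rewrite -mulrBr normcM mulrC.
have [->|pm] := eqVneq p`_m 0; first by rewrite normc0 !mulr0.
rewrite ler_wpM2r ?normc_ge0 // (le_trans _ kh) // Hn ?(le_trans zr) //.
by rewrite min_m0 //= ltnW.
Qed.

Lemma generic_neq0 : w <> (fun=> 0).
Proof.
(* The target is the constant 2 with tolerance 1 at the point 0, whereas iterates of the zero
   function vanish. *)
move=> w0; have [n Hn] := @Gw 1 1 0 [:: (2, 0)] isT.
have := Hn 1%N isT 0; rewrite normc0 lexx => /(_ isT).
rewrite eqxx.
(* Zero is written as w - w, so that [iter_expDB] shows its image to be zero. *)
have -> : (fun z => w z ^+ 1) = (fun z => w z - w z).
  by apply/funext => z; rewrite w0 subrr expr1.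
rewrite (iter_expDB P n ew ew) subrr sub0r normcN.
rewrite /rational_poly big_ord1 expr0 mulr1 /= /rational_complex /= ratr_nat rmorph0.
by rewrite expr0n addr0 sqrtr_sqr normr_nat invr1 lern1.
Qed.

End Generic.
End Hypercyclicity.

Theorem corollary3p4 (R : realType) (P : {poly R[i]}) (hP : (1 < size P)%N) :
  exists A : set (R[i] -> R[i]),
    hypercyclic_algebra (phiD (fun z : R[i] => P.[z] * cexp z)) A.
Proof.
have [w ew Gw] := exists_generic_function hP.
pose A := [set f | exists2 p : {poly R[i]}, p`_0 = 0 & f = (fun z => p.[w z])].
have AX : A w by exists 'X; [rewrite coefX | apply/funext => z; rewrite hornerX].
exists A; split; first split.
- by move=> f [p _ ->]; exact: entire_horner.
- by exists 0; [rewrite coef0 | apply/funext => z; rewrite horner0].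
- move=> f g [p p0 ->] [q q0 ->]; exists (p + q); first by rewrite coefD p0 q0 addr0.
  by apply/funext => z; rewrite hornerD.
- move=> a f [p p0 ->]; exists (a *: p); first by rewrite coefZ p0 mulr0.
  by apply/funext => z; rewrite hornerZ.
- move=> f g [p p0 ->] [q q0 ->]; exists (p * q); first by rewrite coef0M p0 mul0r.
  by apply/funext => z; rewrite hornerM.
- move=> A0; have : [set 0] w by rewrite -A0.
  by move=> w0; apply: (generic_neq0 ew Gw).
- move=> f [p p0 ->]; have [->|pn0] := eqVneq p 0.
    by right; apply/funext => z; rewrite horner0.
  by left; exact: generic_HC ew Gw p p0 pn0.
Qed.
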